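(* Let $\eta\in\mathbb N\cup\{\infty\}$ and $\kappa\in\mathbb Z_+$, let $X=X_{\eta,\kappa}$ and $\phi=\phi_{\eta,\kappa}$ be the set and self-map described in the context, and let $\mu$ be a discrete measure on $X$ such that the composition operator $C_\phi$ in $L^2(\mu)$ is a bounded operator defined on all of $L^2(\mu)$. Then $C_\phi$ is subnormal if and only if $\{\mathsf h_{\phi^n}(x)\}_{n=0}^\infty$ is a Stieltjes moment sequence for every $x\in\{x_0\}\cup\{x_{i,1}:i\in J_\eta\}$.
   Context: Notation: $\mathbb N=\{1,2,\ldots\}$, $\mathbb Z_+=\{0,1,2,\ldots\}$, $\mathbb R_+=[0,\infty)$, $J_k=\{i\in\mathbb N:i\le k\}$ for $k\in\mathbb Z_+\cup\{\infty\}$ ($J_0=\emptyset$, $J_\infty=\mathbb N$); $0^0=1$. All measures are positive. The set and the symbol. $X=X_{\eta,\kappa}=\{x_0,\ldots,x_\kappa\}\cup\{x_{i,j}:i\in J_\eta,\ j\in\mathbb N\}$, all listed points being distinct, and $\phi=\phi_{\eta,\kappa}\colon X\to X$ is given by $\phi(x_{i,j})=x_{i,j-1}$ for $i\in J_\eta$, $j\ge2$; $\phi(x_{i,1})=x_\kappa$ for $i\in J_\eta$; $\phi(x_0)=x_\kappa$; $\phi(x_r)=x_{r-1}$ for $r\in J_\kappa$. A discrete measure on $X$ is a $\sigma$-finite measure $\mu$ on $2^X$ with $\mu(x):=\mu(\{x\})>0$ for all $x\in X$ (so $\mu(x)<\infty$ as well). The composition operator $C_\phi$ in $L^2(\mu)$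 has domain $\{f\in L^2(\mu):f\circ\phi\in L^2(\mu)\}$ and $C_\phi f=f\circ\phi$. For $n\in\mathbb Z_+$, $\mathsf h_{\phi^n}(x)=\mu((\phi^n)^{-1}(\{x\}))/\mu(x)$. An operator $A$ in a complex Hilbert space $\mathcal H$ is subnormal if it is densely defined and there is a normal operator $N$ (possibly unbounded) in a complex Hilbert space $\mathcal K\supseteq\mathcal H$ (isometric embedding) with $\mathcal D(A)\subseteq\mathcal D(N)$ and $Af=Nf$ for $f\in\mathcal D(A)$. A real sequence $\{\gamma_n\}_{n=0}^\infty$ is a Stieltjes moment sequence if there is a Borel measure $\nu$ on $\mathbb R_+$ with all moments finite and $\gamma_n=\int_{[0,\infty)}t^n\,d\nu(t)$ for all $n\in\mathbb Z_+$. *)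

(* Defs.v *)
From HB Require Import structures.
From mathcomp Require Import all_boot all_order all_algebra sesquilinear.
From mathcomp Require Import complex ring lra.
From mathcomp Require Import all_classical all_reals all_analysis.

Set Implicit Arguments.
Unset Strict Implicit.
Unset Printing Implicit Defensive.

Import Order.TTheory GRing.Theory Num.Theory.
Import numFieldNormedType.Exports ComplexField.Normc.

Local Open Scope classical_set_scope.
Local Open Scope complex_scope.
Local Open Scope ring_scope.

(* [{dot H for Num.conj}] is linear in the first argument; norms of vectors take
   values in R[i]. *)
HB.mixin Record CompleteNormedModule_isHilbert (R : realType) H
    & CompleteNormedModule R[i] H := {
  inner : {dot H for Num.conj};
  norm_inner : forall x : H, `|x| ^+ 2 = inner x x
}.

#[short(type="hilbertType")]
HB.structure Definition Hilbert (R : realType) :=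
  {H of CompleteNormedModule R[i] H & CompleteNormedModule_isHilbert R H}.

Section dot_norm.
Context {C : numClosedFieldType} {U : lmodType C} (dot : {dot U for Num.conj}).

Definition dot_norm (x : U) : C := sqrtC (dot x x).

Lemma dot_cauchy_schwarz (u v : U) : `|dot u v| ^+ 2 <= dot u u * dot v v.
Proof.
have [->|v0] := eqVneq v 0; first by rewrite !linear0r normr0 expr0n.
have vv : 0 < dot v v by rewrite dnorm_gt0.
pose a := dot u v / dot v v.
have := dnorm_ge0 dot (u - a *: v).
rewrite dnormB dnormZ linearZr_LR/= -/a.
have cvv : (dot v v)^* = dot v v by rewrite geC0_conj// ltW.
have aE : a^* * dot u v = `|dot u v| ^+ 2 / dot v v.
  by rewrite /a rmorphM/= fmorphV/= cvv normCK mulrAC [_^* * _]mulrC.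
rewrite aE.
have rE : (`|dot u v| ^+ 2 / dot v v)^* = `|dot u v| ^+ 2 / dot v v.
  by rewrite geC0_conj// divr_ge0 ?exprn_ge0// ltW.
rewrite rE.
have -> : `|a| ^+ 2 * dot v v = `|dot u v| ^+ 2 / dot v v.
  rewrite /a normrM exprMn normfV (ger0_norm (ltW vv)) -mulrA; congr (_ * _).
  by rewrite exprVn expr2 invfM -mulrA mulVf ?mulr1// gt_eqF.
by rewrite opprD addrA addrK subr_ge0 ler_pdivrMr.
Qed.

Lemma dot_norm_triangle (x y : U) :
  dot_norm (x + y) <= dot_norm x + dot_norm y.
Proof.
have nx := sqrt_dnorm_ge0 dot x; have ny := sqrt_dnorm_ge0 dot y.
rewrite -ler_sqr ?nnegrE ?addr_ge0 ?sqrt_dnorm_ge0//.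
rewrite sqrrD !sqrtCK dnormD [X in _ <= X]addrAC lerD2l.
have -> : dot x y + (dot x y)^* = 'Re (dot x y) *+ 2.
  by rewrite -mulr_natr ReE divfK// pnatr_eq0.
rewrite lerMn2r/=; apply: le_trans (leif_Re_Creal _) _.
rewrite -ler_sqr ?nnegrE ?mulr_ge0//.
by rewrite exprMn !sqrtCK dot_cauchy_schwarz.
Qed.

Lemma dot_normZ (l : C) (x : U) : dot_norm (l *: x) = `|l| * dot_norm x.
Proof.
by rewrite /dot_norm dnormZ sqrtCM ?nnegrE ?exprn_ge0 ?dnorm_ge0// sqrCK.
Qed.

Lemma dot_norm0_eq0 (x : U) : dot_norm x = 0 -> x = 0.
Proof. by move/eqP; rewrite sqrt_dnorm_eq0 => /eqP. Qed.

End dot_norm.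

HB.factory Record Lmodule_isHilbert (R : realType) H & GRing.Lmodule R[i] H := {
  inner : {dot H for Num.conj};
  inner_complete : forall u : nat -> H,
    (forall e : R[i], 0 < e -> exists N, forall m n, (N <= m)%N -> (N <= n)%N ->
       inner (u m - u n) (u m - u n) < e) ->
    exists l, forall e : R[i], 0 < e -> exists N, forall n, (N <= n)%N ->
       inner (u n - l) (u n - l) < e
}.

HB.builders Context R H & Lmodule_isHilbert R H.

HB.instance Definition _ := Lmodule_isNormed.Build R[i] H
  (dot_norm_triangle inner) (dot_normZ inner) (@dot_norm0_eq0 _ _ inner).

Lemma norm_innerE (x : H) : `|x| ^+ 2 = inner x x.
Proof. by rewrite /Num.norm/= sqrtCK. Qed.

Lemma inner_lt (x : H) (e : R[i]) : 0 < e -> inner x x < e ^+ 2 -> `|x| < e.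
Proof.
by move=> e0; rewrite -norm_innerE ltr_pXn2r ?nnegrE ?normr_ge0 ?ltW.
Qed.

Lemma hilbert_complete (F : set_system H) :
  ProperFilter F -> cauchy F -> cvg F.
Proof.
move=> FF /cauchyP Fc.
have e0 n : 0 < n.+1%:R^-1 :> R[i] by rewrite invr_gt0 ltr0n.
have /choice[u uF] : forall n, exists x, F (ball x (n.+1%:R^-1 : R[i])).
  by move=> n; exact: Fc.
have udist m n : `|u m - u n| < m.+1%:R^-1 + n.+1%:R^-1.
  have [x [um un]] := filter_ex (filterI (uF m) (uF n)).
  move: um un; rewrite -!ball_normE/= => um un.
  rewrite -(subrKA x); apply: le_lt_trans (ler_normD _ _) _.
  by rewrite ltrD// distrC.
have arch (e : R[i]) : 0 < e -> exists N, forall n, (N <= n)%N -> n.+1%:R^-1 < e.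
  case: e => a b; rewrite ltcE/= => /andP[/eqP b0 a0].
  have [N _ NP] := near_infty_natSinv_lt (PosNum a0).
  exists N => n Nn.
  have -> : n.+1%:R^-1 = (n.+1%:R^-1 : R)%:C.
    by rewrite fmorphV/= rmorph_nat.
  by rewrite ltcE/= b0 eqxx/=; exact: NP.
have [|l lP] := @inner_complete u.
  move=> e e_gt0.
  have se : 0 < sqrtC e by rewrite sqrtC_gt0.
  have [N NP] := arch _ (divr_gt0 se (ltr0n _ 2)).
  exists N => m n Nm Nn; rewrite -norm_innerE -[ltRHS]sqrtCK.
  rewrite ltr_pXn2r ?nnegrE ?normr_ge0 ?ltW//.
  by apply: lt_trans (udist m n) _; rewrite [ltRHS]splitr ltrD ?NP.
apply/cvg_ex; exists l; apply/cvgrPdist_lt => e e_gt0.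
have e2 : 0 < e / 2 by rewrite divr_gt0.
have [N NP] := arch _ e2.
have [M MP] := lP ((e / 2) ^+ 2) (exprn_gt0 _ e2).
pose n := maxn N M; apply: filterS (uF n) => x.
rewrite -ball_normE/= => xn.
rewrite -(subrKA (u n)); apply: le_lt_trans (ler_normD _ _) _.
rewrite [ltRHS]splitr ltrD//.
  by rewrite distrC; apply: inner_lt => //; apply: MP; rewrite leq_maxr.
by apply: lt_trans xn _; apply: NP; rewrite leq_maxl.
Qed.

HB.instance Definition _ := Uniform_isComplete.Build H hilbert_complete.
HB.instance Definition _ :=
  CompleteNormedModule_isHilbert.Build R H norm_innerE.
HB.end.

(* T with the sigma-algebra of all subsets *)
Definition discrete_space (T : pointedType) : Type := T.

HB.instance Definition _ (T : pointedType) := Pointed.on (discrete_space T).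
HB.instance Definition _ (T : pointedType) :=
  @isMeasurable.Build default_measure_display (discrete_space T)
    discrete_measurable discrete_measurable0
    discrete_measurableC discrete_measurableU.

Record discreteMeasure (R : realType) (T : pointedType) := DiscreteMeasure {
  dmeasure :> {measure set (discrete_space T) -> \bar R};
  dmeasure_sigma_finite : sigma_finite setT dmeasure;
  dmeasure_gt0 : forall x : T, (0 < dmeasure [set x])%E
}.

Local Notation Re := complex.Re.
Local Notation Im := complex.Im.

Section complex_integral.
Context {R : realType} {T : pointedType} (mu : discreteMeasure R T).

Definition square_integrable (f : T -> R[i]) : Prop :=
  (\int[mu]_x (normc (f x) ^+ 2)%:E < +oo)%E.

Definition cintegral (h : T -> R[i]) : R[i] :=
  (\int[mu]_x Re (h x)) +i* (\int[mu]_x Im (h x)).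

Definition cintegrable (h : T -> R[i]) : Prop :=
  mu.-integrable setT (EFin \o (fun x => Re (h x))) /\
  mu.-integrable setT (EFin \o (fun x => Im (h x))).

Lemma discrete_measurable_fun d (S : measurableType d)
  (D : set (discrete_space T)) (f : discrete_space T -> S) : measurable_fun D f.
Proof. by []. Qed.

Lemma dmeasure_lty (x : T) : (mu [set x] < +oo)%E.
Proof.
have [F FT Foo] := dmeasure_sigma_finite mu.
have [n _ Fnx] : (\bigcup_i F i) x by rewrite -FT.
apply: le_lt_trans (Foo n).2; apply: le_measure; rewrite ?inE//.
by move=> _ ->.
Qed.

Lemma sqr_normcE (z : R[i]) : normc z ^+ 2 = Re z ^+ 2 + Im z ^+ 2.
Proof. by case: z => a b /=; rewrite sqr_sqrtr ?addr_ge0 ?sqr_ge0. Qed.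

Lemma square_integrable_point (f : T -> R[i]) (x : T) :
  ((normc (f x) ^+ 2)%:E * mu [set x] <= \int[mu]_x (normc (f x) ^+ 2)%:E)%E.
Proof.
have <- : (\int[mu]_(y in [set x]) (normc (f y) ^+ 2)%:E =
   (normc (f x) ^+ 2)%:E * mu [set x])%E.
  rewrite -(integral_cst mu (D := [set x]))//.
  by apply: eq_integral => y; rewrite inE => ->.
by apply: ge0_subset_integral => // y _; rewrite lee_fin sqr_ge0.
Qed.

Lemma sqr_normcZD (a z w : R[i]) :
  normc (a * z + w) ^+ 2 <= 2 * normc a ^+ 2 * normc z ^+ 2 + 2 * normc w ^+ 2.
Proof.
rewrite !sqr_normcE; case: a z w => [a b] [c d] [e h] /=.
have -> : 2 * (a ^+ 2 + b ^+ 2) * (c ^+ 2 + d ^+ 2) =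
  2 * ((a * c - b * d) ^+ 2 + (a * d + b * c) ^+ 2) by ring.
have := sqr_ge0 (a * c - b * d - e).
by have := sqr_ge0 (a * d + b * c - h); lra.
Qed.

Lemma square_integrableZD (a : R[i]) (f g : T -> R[i]) :
  square_integrable f -> square_integrable g ->
  square_integrable (fun x => a * f x + g x).
Proof.
move=> fi gi.
pose k := 2 * normc a ^+ 2.
have k0 : 0 <= k by rewrite mulr_ge0 ?sqr_ge0.
apply: (@le_lt_trans _ _ (\int[mu]_x (k%:E * (normc (f x) ^+ 2)%:E +
    2%:E * (normc (g x) ^+ 2)%:E))%E).
  apply: ge0_le_integral => //.
  - by move=> x _; rewrite lee_fin sqr_ge0.
  - by move=> x _; rewrite -!EFinM -EFinD lee_fin sqr_normcZD.
rewrite ge0_integralD//; last 2 first.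
- by move=> x _; rewrite mule_ge0 ?lee_fin ?sqr_ge0.
- by move=> x _; rewrite mule_ge0 ?lee_fin ?sqr_ge0.
rewrite !ge0_integralZl//; try by move=> x _; rewrite lee_fin sqr_ge0.
by rewrite lte_add_pinfty// lte_mul_pinfty// ?lee_fin// ?integral_ge0// => x _;
  rewrite lee_fin sqr_ge0.
Qed.

Lemma integrable_le_sqr (h : T -> R) (f g : T -> R[i]) :
  square_integrable f -> square_integrable g ->
  (forall x, `|h x| <= normc (f x) ^+ 2 + normc (g x) ^+ 2) ->
  mu.-integrable setT (EFin \o h).
Proof.
move=> fi gi hle; apply/integrableP; split => //.
apply: (@le_lt_trans _ _ (\int[mu]_x ((normc (f x) ^+ 2)%:E +
    (normc (g x) ^+ 2)%:E))%E).
  by apply: ge0_le_integral => //= x _; rewrite -EFinD lee_fin.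
rewrite ge0_integralD//; try by move=> x _; rewrite lee_fin sqr_ge0.
by rewrite lte_add_pinfty.
Qed.

Lemma cintegrable_mulconj (f g : T -> R[i]) :
  square_integrable f -> square_integrable g ->
  cintegrable (fun x => f x * (g x)^*%C).
Proof.
move=> fi gi; split; apply: (integrable_le_sqr fi gi) => x;
  rewrite !sqr_normcE; case: (f x) (g x) => [a b] [c d] /=;
  rewrite ler_norml; apply/andP; split.
- by have := sqr_ge0 (a + c); have := sqr_ge0 (b + d);
     have := sqr_ge0 a; have := sqr_ge0 b; have := sqr_ge0 c;
     have := sqr_ge0 d; lra.
- by have := sqr_ge0 (a - c); have := sqr_ge0 (b - d);
     have := sqr_ge0 a; have := sqr_ge0 b; have := sqr_ge0 c;
     have := sqr_ge0 d; lra.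
- by have := sqr_ge0 (a - d); have := sqr_ge0 (b + c);
     have := sqr_ge0 a; have := sqr_ge0 b; have := sqr_ge0 c;
     have := sqr_ge0 d; lra.
- by have := sqr_ge0 (a + d); have := sqr_ge0 (b - c);
     have := sqr_ge0 a; have := sqr_ge0 b; have := sqr_ge0 c;
     have := sqr_ge0 d; lra.
Qed.

Lemma integrableZr_fin (c : R) (h : T -> R) :
  mu.-integrable setT (EFin \o h) ->
  mu.-integrable setT (EFin \o (fun x => c * h x)).
Proof. by move=> hi; exact: (integrableZl measurableT c hi). Qed.

Lemma integrableD_fin (h k : T -> R) :
  mu.-integrable setT (EFin \o h) -> mu.-integrable setT (EFin \o k) ->
  mu.-integrable setT (EFin \o (fun x => h x + k x)).
Proof. by move=> hi ki; exact: (integrableD measurableT hi ki). Qed.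

Lemma Rintegral_lin3 (a b : R) (h k l : T -> R) :
  mu.-integrable setT (EFin \o h) -> mu.-integrable setT (EFin \o k) ->
  mu.-integrable setT (EFin \o l) ->
  \int[mu]_x (a * h x + b * k x + l x) =
  a * (\int[mu]_x h x) + b * (\int[mu]_x k x) + \int[mu]_x l x.
Proof.
move=> hi ki li.
rewrite RintegralD//.
  2: exact: integrableD_fin (integrableZr_fin _ _) (integrableZr_fin _ _).
rewrite RintegralD//; [|exact: integrableZr_fin..].
by rewrite !RintegralZl.
Qed.

Lemma cintegralZD (a : R[i]) (h k : T -> R[i]) :
  cintegrable h -> cintegrable k ->
  cintegral (fun x => a * h x + k x) = a * cintegral h + cintegral k.
Proof.
move=> [hr hi] [kr ki]; rewrite /cintegral.
case: a => a b; apply/eqP; rewrite eq_complex /=; apply/andP; split; apply/eqP.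
- rewrite -mulNr -Rintegral_lin3//; apply: eq_Rintegral => x _.
  by case: (h x) (k x) => [? ?] [? ?] /=; rewrite mulNr.
- rewrite -Rintegral_lin3//; apply: eq_Rintegral => x _.
  by case: (h x) (k x) => [? ?] [? ?] /=.
Qed.

Lemma cintegral_conj (h : T -> R[i]) : cintegrable h ->
  cintegral (fun x => (h x)^*%C) = (cintegral h)^*%C.
Proof.
move=> [hr hi]; rewrite /cintegral /=; congr (_ +i* _).
  by apply: eq_Rintegral => x _; case: (h x).
rewrite -mulN1r -RintegralZl//; apply: eq_Rintegral => x _.
by case: (h x) => ? ? /=; rewrite mulN1r.
Qed.

Lemma cintegral_sqr (f : T -> R[i]) :
  cintegral (fun x => f x * (f x)^*%C) =
  (fine (\int[mu]_x (normc (f x) ^+ 2)%:E))%:C.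
Proof.
rewrite /cintegral; congr (_ +i* _).
  apply: eq_Rintegral => x _; rewrite sqr_normcE.
  by case: (f x) => a b /=; rewrite mulrN opprK !expr2.
rewrite (_ : (fun x => _) = cst 0) ?Rintegral_cst ?mul0r//.
by apply/funext => x; case: (f x) => a b /=; rewrite mulrN mulrC addNr.
Qed.

(* Every point has positive mass, so almost everywhere equality is equality and
   no quotient is needed; every function is measurable. *)
Record L2 := MkL2 {
  L2_fun :> T -> R[i]^o;
  _ : L2_fun \in [pred f | `[< square_integrable f >]]
}.

HB.instance Definition _ := [isSub for L2_fun].
HB.instance Definition _ := [Choice of L2 by <:].

Lemma square_integrable_submod_closed :
  submod_closed [pred f : T -> R[i]^o | `[< square_integrable f >]].
Proof.
split=> [|a f g]; rewrite !inE.
  rewrite /square_integrable integral0_eq ?ltry// => x _.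
  by rewrite normc0 expr0n.
exact: square_integrableZD.
Qed.

HB.instance Definition _ :=
  GRing.SubChoice_isSubLmodule.Build _ _ _ L2 square_integrable_submod_closed.

Lemma L2P (f : L2) : square_integrable f.
Proof. by case: f => f fP; apply/asboolP; exact: fP. Qed.

Definition toL2 (f : T -> R[i]^o) (fi : square_integrable f) : L2 :=
  @MkL2 f (asboolT fi).

Definition L2_inner (f g : L2) : R[i] := cintegral (fun x => f x * (g x)^*%C).

Lemma L2_innerZDl (a : R[i]) (f g h : L2) :
  L2_inner (a *: f + g) h = a * L2_inner f h + L2_inner g h.
Proof.
rewrite /L2_inner -cintegralZD; [|exact: cintegrable_mulconj (L2P _) (L2P _)..].
by congr cintegral; apply/funext => x; rewrite /= mulrDl mulrA.
Qed.

Lemma L2_inner_conj (f g : L2) : L2_inner f g = (L2_inner g f)^*.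
Proof.
transitivity ((L2_inner g f)^*%C) => //.
rewrite /L2_inner -cintegral_conj; last exact: cintegrable_mulconj (L2P _) (L2P _).
congr cintegral; apply/funext => x.
by rewrite rmorphM/= conjcK mulrC.
Qed.

Lemma L2_inner_bilinear : bilinear_for
  (GRing.Scale.Law.clone _ _ ( *%R ) _)
  (GRing.Scale.Law.clone _ _ (Num.conj \; *%R ) _) L2_inner.
Proof.
split=> [h|h] a f g /=; first exact: L2_innerZDl.
by rewrite L2_inner_conj L2_innerZDl rmorphD rmorphM/= -!L2_inner_conj.
Qed.

HB.instance Definition _ := bilinear_isBilinear.Build R[i] L2 L2 R[i]
  (GRing.Scale.Law.clone _ _ ( *%R ) _)
  (GRing.Scale.Law.clone _ _ (Num.conj \; *%R ) _) L2_inner L2_inner_bilinear.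

Lemma L2_inner_hermitian (f g : L2) :
  L2_inner f g = (-1) ^+ false * (L2_inner g f)^*.
Proof. by rewrite expr0 mul1r -L2_inner_conj. Qed.

HB.instance Definition _ :=
  isHermitianSesquilinear.Build R[i] L2 false Num.conj L2_inner
    L2_inner_hermitian.

Lemma L2_innerE (f : L2) :
  L2_inner f f = (fine (\int[mu]_x (normc (f x) ^+ 2)%:E))%:C.
Proof. exact: cintegral_sqr. Qed.

Lemma L2_integralE (f : L2) :
  (\int[mu]_x (normc (f x) ^+ 2)%:E)%E = (Re (L2_inner f f))%:E.
Proof.
rewrite L2_innerE/= fineK// ge0_fin_numE; first exact: L2P.
by apply: integral_ge0 => x _; rewrite lee_fin sqr_ge0.
Qed.

Lemma L2_inner_lt (f : L2) (e : R[i]) : 0 < e ->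
  (L2_inner f f < e) = (\int[mu]_x (normc (f x) ^+ 2)%:E < (Re e)%:E)%E.
Proof.
case: e => a b; rewrite L2_integralE L2_innerE !ltcE/= => /andP[/eqP -> _].
by rewrite eqxx lte_fin.
Qed.

Lemma L2_inner_gt0 (f : L2) : f != 0 -> 0 < L2_inner f f.
Proof.
move=> f0; have /existsNP[x fx] : ~ forall x, f x = 0.
  apply: contra_not (negP f0) => f0'; apply/eqP/val_inj/funext => x /=.
  exact: f0'.
have nfx : 0 < normc (f x).
  rewrite lt_def; apply/andP; split; first by apply/eqP => /eq0_normc.
  by case: (f x) => a b; exact: sqrtr_ge0.
rewrite L2_innerE ltcE/= eqxx/=; rewrite -lte_fin.
rewrite fineK; last first.
  rewrite ge0_fin_numE; first exact: L2P.
  by apply: integral_ge0 => y _; rewrite lee_fin sqr_ge0.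
apply: lt_le_trans (square_integrable_point f x).
by rewrite mule_gt0 ?dmeasure_gt0// lte_fin exprn_gt0.
Qed.

HB.instance Definition _ :=
  isDotProduct.Build R[i] L2 L2_inner L2_inner_gt0.

Lemma fatou_bound (F : nat -> T -> R) (G : T -> R) (c : \bar R) :
  (forall n x, 0 <= F n x) -> (forall x, F n x @[n --> \oo] --> G x) ->
  (forall n, (\int[mu]_x (F n x)%:E <= c)%E) ->
  (\int[mu]_x (G x)%:E <= c)%E.
Proof.
move=> F0 FG Fc.
have -> : (\int[mu]_x (G x)%:E)%E =
    (\int[mu]_x limn_einf (fun n => (F n x)%:E))%E.
  apply: eq_integral => x _.
  have FGx : (F n x)%:E @[n --> \oo] --> (G x)%:E.
    by apply: cvg_EFin; [exact: nearW|exact: FG].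
  by rewrite (cvg_limn_einf_sup FGx).1.
apply: le_trans (fatou (f := fun n x => (F n x)%:E) mu measurableT _ _) _ => //.
- by move=> n x _; rewrite lee_fin.
rewrite limn_einf_lim; apply: lime_le; first exact: is_cvg_einfs.
apply: nearW => n; apply: le_trans (Fc n).
by apply: ereal_inf_lbound; exists n => /=.
Qed.

Lemma L2_complete (u : nat -> L2) :
  (forall e : R[i], 0 < e -> exists N, forall m n, (N <= m)%N -> (N <= n)%N ->
     L2_inner (u m - u n) (u m - u n) < e) ->
  exists l, forall e : R[i], 0 < e -> exists N, forall n, (N <= n)%N ->
     L2_inner (u n - l) (u n - l) < e.
Proof.
move=> uc.
have {}uc (e : R) : 0 < e -> exists N, forall m n, (N <= m)%N -> (N <= n)%N ->
    (\int[mu]_x (normc (u m x - u n x) ^+ 2)%:E < e%:E)%E.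
  move=> e0; have e0' : 0 < e%:C by rewrite ltcR.
  have [N NP] := uc _ e0'; exists N => m n Nm Nn.
  by have := NP _ _ Nm Nn; rewrite L2_inner_lt.
have ucx x (e : R) : 0 < e -> exists N, forall m n, (N <= m)%N -> (N <= n)%N ->
    normc (u m x - u n x) ^+ 2 < e ^+ 2.
  move=> e0; have mx0 := dmeasure_gt0 mu x.
  have mxE : mu [set x] = (fine (mu [set x]))%:E.
    by rewrite fineK// ge0_fin_numE ?dmeasure_lty.
  have mxr : 0 < fine (mu [set x]) by rewrite -lte_fin -mxE.
  have [N NP] := uc _ (mulr_gt0 (exprn_gt0 2 e0) mxr).
  exists N => m n Nm Nn; have := NP _ _ Nm Nn.
  move/(le_lt_trans (square_integrable_point (fun x => u m x - u n x) x)).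
  by rewrite mxE -EFinM lte_fin ltr_pM2r.
have cvgx (p : R[i] -> R) x : (forall z w, p (z - w) = p z - p w) ->
    (forall z, p z ^+ 2 <= normc z ^+ 2) -> cvg (p (u n x) @[n --> \oo]).
  move=> pB ple; apply/cauchy_cvgP/cauchy_exP => e e0.
  have [N NP] := ucx x e e0; exists (p (u N x)).
  exists N => // n /= Nn; rewrite -ball_normE/= -pB.
  rewrite -ltr_sqr ?nnegrE ?normr_ge0 ?ltW// real_normK ?num_real//.
  by apply: le_lt_trans (ple _) _; exact: NP.
pose l x : R[i]^o := (lim (Re (u n x) @[n --> \oo])) +i*
  (lim (Im (u n x) @[n --> \oo])).
have ReB z w : Re (z - w) = Re z - Re w by case: z w => [? ?] [? ?].
have ImB z w : Im (z - w) = Im z - Im w by case: z w => [? ?] [? ?].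
have ul n x : normc (u n x - u m x) ^+ 2 @[m --> \oo] -->
    normc (u n x - l x) ^+ 2.
  under eq_fun do rewrite sqr_normcE ReB ImB.
  rewrite sqr_normcE ReB ImB.
  apply: cvgD; rewrite -?[(_ - _) ^+ 2]/(_ * _).
    apply: cvgM; apply: cvgB; [exact: cvg_cst| |exact: cvg_cst|];
    by apply: cvgx => // z; rewrite sqr_normcE lerDl sqr_ge0.
  apply: cvgM; apply: cvgB; [exact: cvg_cst| |exact: cvg_cst|];
  by apply: cvgx => // z; rewrite sqr_normcE lerDr sqr_ge0.
have ule (e : R) : 0 < e -> exists N, forall n, (N <= n)%N ->
    (\int[mu]_x (normc (u n x - l x) ^+ 2)%:E <= e%:E)%E.
  move=> e0; have [N NP] := uc _ e0; exists N => n Nn.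
  apply: (@fatou_bound (fun k x => normc (u n x - u (k + N)%N x) ^+ 2)).
  - by move=> k x; exact: sqr_ge0.
  - by move=> x; rewrite (cvg_shiftn N (fun m => normc (u n x - u m x) ^+ 2)).
  - by move=> k; apply: ltW; apply: NP => //; rewrite leq_addl.
have [N NP] := ule _ ltr01.
have li : square_integrable l.
  have -> : l = fun x => -1 * (u N x - l x) + u N x.
    by apply/funext => x; rewrite mulN1r opprB subrK.
  apply: square_integrableZD (L2P (u N)).
  by apply: le_lt_trans (NP _ (leqnn N)) _; rewrite ltry.
exists (toL2 li) => e e0.
have re0 : 0 < Re e by move: e0; rewrite ltcE/= => /andP[].
have [M MP] := ule _ (divr_gt0 re0 (ltr0n _ 2)).
exists M => n Mn; rewrite L2_inner_lt//.
apply: le_lt_trans (MP _ Mn) _.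
by rewrite lte_fin ltr_pdivrMr// ltr_pMr// ltr1n.
Qed.

HB.instance Definition _ := Lmodule_isHilbert.Build R L2 L2_complete.
End complex_integral.

(* Unbounded operators are identified with their graphs; [(graph A).`1] is
   the domain of A. *)
Record operator (R : realType) (H : hilbertType R) := Operator {
  graph : set (H * H);
  graph_submod : graph 0 /\
    forall (a : R[i]) (p q : H * H), graph p -> graph q -> graph (a *: p + q);
  graph_functional : forall y : H, graph (0, y) -> y = 0
}.

Section operators.
Context {R : realType} {H : hilbertType R}.

Definition densely_defined (A : operator H) : Prop := dense (graph A).`1.

Definition everywhere_defined (A : operator H) : Prop :=
  (graph A).`1 = [set: H].

Definition bounded_operator (A : operator H) : Prop :=
  exists M : R, forall p : H * H, graph A p -> `|p.2| <= M%:C * `|p.1|.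

(* For densely defined A this is the graph of the Hilbert space adjoint. *)
Definition adjoint (A : operator H) : set (H * H) :=
  [set q | forall p : H * H, graph A p -> inner p.2 q.1 = inner p.1 q.2].

(* [graph N \; adjoint N] is the graph of N^* N, with its natural domain. *)
Definition normal_operator (N : operator H) : Prop :=
  [/\ densely_defined N, closed (graph N) &
      (graph N \; adjoint N = adjoint N \; graph N)%relation].

End operators.

Definition subnormal (R : realType) (H : hilbertType R) (A : operator H) : Prop :=
  densely_defined A /\
  exists (K : hilbertType R) (V : {linear H -> K}) (N : operator K),
    [/\ forall f : H, `|V f| = `|f|, normal_operator N &
        forall p : H * H, graph A p -> graph N (V p.1, V p.2)].

Section composition_operator.
Context {R : realType} {T : pointedType} (mu : discreteMeasure R T) (phi : T -> T).

(* Both components are square integrable, so the domain of this graph is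
   { f in L2 | f \o phi in L2 }. *)
Definition composition_graph : set (L2 mu * L2 mu) :=
  [set p : L2 mu * L2 mu | forall x : T, p.2 x = p.1 (phi x)].

Lemma composition_graph_submod : composition_graph 0 /\
  forall (a : R[i]) (p q : L2 mu * L2 mu),
    composition_graph p -> composition_graph q -> composition_graph (a *: p + q).
Proof.
by split=> [x|a p q pC qC x] //=; rewrite -[LHS]/(a * p.2 x + q.2 x) pC qC.
Qed.

Lemma composition_graph_functional (g : L2 mu) :
  composition_graph (0, g) -> g = 0.
Proof. by move=> gC; apply/val_inj/funext => x /=; rewrite gC. Qed.

Definition composition_operator : operator (L2 mu) :=
  Operator composition_graph_submod composition_graph_functional.

Definition h_ (n : nat) (x : T) : \bar R :=
  (mu (iter n phi @^-1` [set x]) / mu [set x])%E.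

End composition_operator.

(* A sequence with an infinite term is not a moment sequence. *)
Definition stieltjes_moment_sequence (R : realType) (gamma : nat -> \bar R) : Prop :=
  exists nu : {measure set (measurableTypeR R) -> \bar R}, forall n : nat,
    (\int[nu]_(t in `[0%R, +oo[) (t ^+ n)%:E < +oo)%E /\
    gamma n = (\int[nu]_(t in `[0%R, +oo[) (t ^+ n)%:E)%E.

(* [None] stands for infinity; indices are shifted to start at 0, so that
   [J (Some n)] has n elements and [J None] is all of nat. *)
Definition J (eta : option nat) : Type :=
  {i : nat | if eta is Some n then (i < n)%N else true}.

(* [stem r] is x_r and [branch i j] is x_{i+1,j+1}. *)
Inductive X (eta : option nat) (kappa : nat) : Type :=
| stem of 'I_kappa.+1
| branch of J eta & nat.
Arguments stem {eta kappa}.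
Arguments branch {eta kappa}.

(* The base point is only there because measurable types are pointed. *)
Section X_instances.
Context {eta : option nat} {kappa : nat}.

HB.instance Definition _ := gen_eqMixin (X eta kappa).
HB.instance Definition _ := gen_choiceMixin (X eta kappa).
HB.instance Definition _ := isPointed.Build (X eta kappa) (stem ord_max).

Definition phi (x : X eta kappa) : X eta kappa :=
  match x with
  | stem r => stem (if r == 0%N :> nat then ord_max else inord r.-1)
  | branch i 0 => stem ord_max
  | branch i j.+1 => branch i j
  end.

End X_instances.

(* Main.v *)
From HB Require Import structures.
Require Import Defs.
From mathcomp Require Import all_boot all_order all_algebra sesquilinear.
From mathcomp Require Import complex ring lra zify.
From mathcomp Require Import all_classical all_reals all_analysis.
From mathcomp Require Import measurable_realfun.

(** Write S for the operator f |-> f o phi and h_n(x) = mu(phi^-n x) / mu(x). The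
    proof passes through the condition of Halmos and Bram: sum_(m, n) <S^n f_m, S^m f_n>
    is nonnegative for every finite family f_m. For a bounded everywhere defined
    operator it is equivalent to subnormality ([subnormal_halmosP]).

    If N is a normal extension, the sum is the squared norm of sum_m N^*^m f_m
    ([normal_extension_halmos]). As N may be unbounded, this uses that the domain of N
    is contained in that of N^* ([normal_dom_adjoint]), which follows because the
    domain of N^* N = N N^* is a core of N. Conversely, the sum defines a semi-inner
    product on finitely supported sequences; on its completion, applying S termwise is
    a bounded normal operator whose adjoint is the right shift
    ([halmos_normal_extension]).

    The condition implies that gamma_n = |S^n f|^2 satisfies all inequalities of the
    Hausdorff moment problem on an interval [0, B], so gamma is a moment sequence
    ([halmos_moment_measure]). The representing measure is obtained from Bernstein
    weights: an ultrafilter limit of their quantile functions ([hausdorff_moment]). For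
    f the normalized indicator function of x one has gamma_n = h_n(x), and necessity
    follows.

    For sufficiency, every point x is the only point that some iterate phi^r maps to
    x_0 or to some x_(i,1), so h_n(x) is a multiple of a shift of the given moment
    sequences and L_x : t^n |-> h_n(x) is positive on polynomials that are nonnegative
    on [0, M], for some M ([local_pos_of_initial]). The change of variables
    int F o phi^k dmu = int F(x) L_x(t^k) dmu(x) turns the sum in the condition into
    int F dmu with F = sum_(m, n) f_m o phi^n * f_n o phi^m, for real functions f_m with
    m < d. Multiplying F by t^(2 d) allows composing both factors of each term with
    phi^(2 d - m - n), and then
      int F(x) L_x(t^(2 d) q^2) dmu = int L_x((sum_m t^m f_m(phi^(2 d - m) x))^2 q^2) dmu,
    which is nonnegative ([halmos_density_sqr_ge0]). The measure behind L_x has no atom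
    at 0, since it is at most a multiple of t times the one behind L_(phi x)
    ([local_moment_decay]); hence t^(2 d) q^2 can be made to tend to 1 boundedly, and
    int F dmu is nonnegative ([halmos_density_ge0]). *)

Set Implicit Arguments.
Unset Strict Implicit.
Unset Printing Implicit Defensive.

Import Order.TTheory GRing.Theory Num.Theory.
Import numFieldNormedType.Exports ComplexField.Normc.

Local Open Scope classical_set_scope.
Local Open Scope complex_scope.
Local Open Scope ring_scope.

Local Notation Re := complex.Re.
Local Notation Im := complex.Im.

(** * Elementary estimates *)

(** The value of the quadratic at its minimum; for c = 0 an affine function that
    stays nonnegative must be constant. *)
Lemma discriminant_le {R : realFieldType} (a b c : R) : 0 <= c ->
  (forall t, 0 <= a + 2 * t * b + t ^+ 2 * c) -> b ^+ 2 <= a * c.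
Proof.
rewrite le_eqVlt => /predU1P[<-|c0] quad; last first.
  have := quad (- b / c).
  have -> : a + 2 * (- b / c) * b + (- b / c) ^+ 2 * c = a - b ^+ 2 / c.
    by field; rewrite gt_eqF.
  by rewrite subr_ge0 ler_pdivrMr.
rewrite mulr0 real_exprn_even_le0 ?num_real//=; apply/eqP; apply: contrapT => /eqP r0.
have := quad (- (a + 1) / (2 * b)).
have -> : a + 2 * (- (a + 1) / (2 * b)) * b + (- (a + 1) / (2 * b)) ^+ 2 * 0 = -1.
  by field.
by rewrite ler0N1.
Qed.

(** The ratios of consecutive terms increase, so the first of them cannot exceed
    the geometric growth rate of the sequence. *)
Lemma log_convex_growth {R : archiRealFieldType} (delta : nat -> R) (C B : R) :
  0 <= B -> (forall n, 0 <= delta n) ->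
  (forall n, delta n.+1 ^+ 2 <= delta n * delta n.+2) ->
  (forall n, delta n <= C * B ^+ n) -> delta 1%N <= B * delta 0%N.
Proof.
move=> B0 d_ge0 dlog dC; rewrite leNgt; apply/negP => Bd.
have d1 : 0 < delta 1%N by apply: le_lt_trans Bd; rewrite mulr_ge0.
have d0 : 0 < delta 0%N.
  rewrite lt_def d_ge0 andbT; apply/eqP => d00.
  have := dlog 0%N; rewrite d00 mul0r.
  by rewrite leNgt exprn_gt0.
have Bgt0 : 0 < B.
  rewrite lt_def B0 andbT; apply/eqP => B00.
  by have := dC 1%N; rewrite B00 expr1 mulr0 leNgt d1.
pose r := delta 1%N / delta 0%N.
have r0 : 0 < r by rewrite divr_gt0.
have rB : 0 < r / B - 1 by rewrite subr_gt0 ltr_pdivlMr// mul1r ltr_pdivlMr.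
have ratio n : 0 < delta n /\ r * delta n <= delta n.+1.
  elim: n => [|n [dn rn]]; first by rewrite /r divfK ?gt_eqF.
  have dn1 : 0 < delta n.+1 by apply: lt_le_trans rn; rewrite mulr_gt0.
  split=> //; rewrite -(ler_pM2r dn).
  rewrite [leRHS]mulrC; apply: le_trans (dlog n).
  by rewrite mulrAC expr2 ler_pM2r.
have geom n : delta 0%N * r ^+ n <= delta n.
  elim: n => [|n IHn]; first by rewrite expr0 mulr1.
  apply: le_trans (ratio n).2; rewrite exprSr mulrA [leRHS]mulrC.
  by rewrite ler_pM2r.
have bern n : 1 + n%:R * (r / B - 1) <= (r / B) ^+ n.
  elim: n => [|n IHn]; first by rewrite mul0r addr0 expr0.
  have -> : (r / B) ^+ n.+1 = (r / B) ^+ n + (r / B - 1) * (r / B) ^+ n.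
    by rewrite exprS; ring.
  have h1 : 1 <= (r / B) ^+ n.
    by apply: le_trans IHn; rewrite lerDl mulr_ge0// ltW.
  rewrite -natr1 mulrDl mul1r addrA lerD//.
  by rewrite ler_peMr// ltW.
have big n : n%:R * (r / B - 1) <= C / delta 0%N.
  apply: (@le_trans _ _ ((r / B) ^+ n)).
    by apply: le_trans (bern n); rewrite lerDr.
  rewrite expr_div_n ler_pdivrMr ?exprn_gt0// mulrAC ler_pdivlMr// mulrC.
  exact: le_trans (geom n) (dC n).
have [n nP] : exists n : nat, C / delta 0%N / (r / B - 1) < n%:R.
  exists (Num.bound `|C / delta 0%N / (r / B - 1)|).
  exact: le_lt_trans (ler_norm _) (archi_boundP (normr_ge0 _)).
by have := big n; rewrite leNgt -ltr_pdivrMr// nP.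
Qed.

Lemma natSinv_small {R : realType} (e : R) : 0 < e ->
  exists N, forall n, (N <= n)%N -> n.+1%:R^-1 < e.
Proof.
move=> e0; have [N _ NP] := near_infty_natSinv_lt (PosNum e0).
by exists N => n Nn; exact: NP.
Qed.

Lemma bernoulli_le {R : realFieldType} (y : R) n : 0 <= y <= 1 -> 1 - (1 - y) ^+ n <= n%:R * y.
Proof.
move=> /andP[y0 y1]; elim: n => [|n IHn]; first by rewrite expr0 subrr mul0r.
rewrite exprS -natr1 mulrDl mul1r.
have z1 : (1 - y) ^+ n <= 1 by rewrite exprn_ile1 ?subr_ge0// gerBl.
have : y * (1 - y) ^+ n <= y by rewrite ler_piMr.
by move: IHn; move: ((1 - y) ^+ n) => z; lra.
Qed.

Lemma exprB_le {R : realFieldType} (x y : R) m : 0 <= x <= 1 -> 0 <= y <= 1 ->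
  `|x ^+ m - y ^+ m| <= m%:R * `|x - y|.
Proof.
move=> /andP[x0 x1] /andP[y0 y1]; elim: m => [|m IHm].
  by rewrite !expr0 subrr normr0 mul0r.
have -> : x ^+ m.+1 - y ^+ m.+1 = x * (x ^+ m - y ^+ m) + (x - y) * y ^+ m.
  by rewrite !exprS; ring.
apply: le_trans (ler_normD _ _) _; rewrite !normrM -natr1 mulrDl mul1r.
apply: lerD.
  by apply: le_trans IHm; rewrite ler_piMl// ger0_norm.
by rewrite ler_piMr// ger0_norm ?exprn_ge0// exprn_ile1.
Qed.

(** * Real and imaginary parts *)

Section complex_parts.
Context {R : realType}.
Implicit Types z w : R[i].

Lemma ReD z w : Re (z + w) = Re z + Re w. Proof. by case: z w => [? ?] []. Qed.
Lemma ImD z w : Im (z + w) = Im z + Im w. Proof. by case: z w => [? ?] []. Qed.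
Lemma ReN z : Re (- z) = - Re z. Proof. by case: z. Qed.
Lemma ImN z : Im (- z) = - Im z. Proof. by case: z. Qed.
Lemma ReB z w : Re (z - w) = Re z - Re w. Proof. by rewrite ReD ReN. Qed.
Lemma ImB z w : Im (z - w) = Im z - Im w. Proof. by rewrite ImD ImN. Qed.
Lemma ReM z w : Re (z * w) = Re z * Re w - Im z * Im w.
Proof. by case: z w => [? ?] []. Qed.
Lemma ImM z w : Im (z * w) = Re z * Im w + Im z * Re w.
Proof. by case: z w => [? ?] []. Qed.
Lemma Re_conjc z : Re z^*%C = Re z. Proof. by case: z. Qed.
Lemma Im_conjc z : Im z^*%C = - Im z. Proof. by case: z. Qed.
Lemma complexP z w : Re z = Re w -> Im z = Im w -> z = w.
Proof. by case: z w => [? ?] [? ?] /= -> ->. Qed.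
Lemma Re_sum I (r : seq I) (P : pred I) (F : I -> R[i]) :
  Re (\sum_(i <- r | P i) F i) = \sum_(i <- r | P i) Re (F i).
Proof. by elim/big_rec2: _ => // i x y _ <-; rewrite ReD. Qed.
End complex_parts.

(** * Semi-inner products *)

(** Semi-definite forms, so that the one built from the Halmos condition is an
    instance before its null vectors have been divided out. *)
Record semiInner (R : realType) (U : lmodType R[i]) := SemiInner {
  sip :> U -> U -> R[i];
  sipZDl : forall a x y z, sip (a *: x + y) z = a * sip x z + sip y z;
  sipC : forall x y, sip x y = (sip y x)^*%C;
  Re_sip_ge0 : forall x, 0 <= Re (sip x x)
}.

Section semi_inner_theory.
Context {R : realType} {U : lmodType R[i]} (s : semiInner U).
Implicit Types (x y z : U) (a : R[i]).

Definition sqn x : R := Re (s x x).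

Lemma sqn_ge0 x : 0 <= sqn x. Proof. exact: Re_sip_ge0. Qed.

Lemma sipDl x y z : s (x + y) z = s x z + s y z.
Proof. by rewrite -[x]scale1r sipZDl mul1r scale1r. Qed.

Lemma sip0l z : s 0 z = 0.
Proof. by apply: (addrI (s 0 z)); rewrite -sipDl !addr0. Qed.

Lemma sipZl a x z : s (a *: x) z = a * s x z.
Proof. by rewrite -[a *: x]addr0 sipZDl sip0l addr0. Qed.

Lemma sipNl x z : s (- x) z = - s x z.
Proof. by rewrite -scaleN1r sipZl mulN1r. Qed.

Lemma sipBl x y z : s (x - y) z = s x z - s y z.
Proof. by rewrite sipDl sipNl. Qed.

Lemma sip_suml I (r : seq I) (P : pred I) (F : I -> U) z :
  s (\sum_(i <- r | P i) F i) z = \sum_(i <- r | P i) s (F i) z.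
Proof. by apply: (big_morph (s^~ z)) => [x y|]; rewrite ?sipDl ?sip0l. Qed.

Lemma sipDr x y z : s z (x + y) = s z x + s z y.
Proof. by rewrite sipC sipDl rmorphD/= -!sipC. Qed.

Lemma sip0r z : s z 0 = 0.
Proof. by rewrite sipC sip0l rmorph0. Qed.

Lemma sipZr a x z : s z (a *: x) = a^*%C * s z x.
Proof. by rewrite sipC sipZl rmorphM/= -sipC. Qed.

Lemma sipNr x z : s z (- x) = - s z x.
Proof. by rewrite sipC sipNl rmorphN/= -sipC. Qed.

Lemma sipBr x y z : s z (x - y) = s z x - s z y.
Proof. by rewrite sipDr sipNr. Qed.

Lemma sip_sumr I (r : seq I) (P : pred I) (F : I -> U) z :
  s z (\sum_(i <- r | P i) F i) = \sum_(i <- r | P i) s z (F i).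
Proof. by apply: (big_morph (s z)) => [x y|]; rewrite ?sipDr ?sip0r. Qed.

Lemma Im_sipxx x : Im (s x x) = 0.
Proof.
have /(congr1 (@complex.Im R)) := sipC s x x; rewrite Im_conjc => h.
lra.
Qed.

Lemma sipxx x : s x x = (sqn x)%:C.
Proof. by apply: complexP => //=; rewrite Im_sipxx. Qed.

Lemma Re_sipC x y : Re (s x y) = Re (s y x).
Proof. by rewrite sipC Re_conjc. Qed.

Lemma sqn0 : sqn 0 = 0. Proof. by rewrite /sqn sip0l. Qed.

Lemma sqnZ a x : sqn (a *: x) = (Re a ^+ 2 + Im a ^+ 2) * sqn x.
Proof.
by rewrite /sqn sipZl sipZr sipxx !ReM ?ImM /= Re_conjc Im_conjc; ring.
Qed.

Lemma sqnN x : sqn (- x) = sqn x.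
Proof. by rewrite -scaleN1r sqnZ /= oppr0 expr0n sqrrN expr1n addr0 mul1r. Qed.

Lemma sqn_subC x y : sqn (x - y) = sqn (y - x).
Proof. by rewrite -sqnN opprB. Qed.

Lemma sqnD x y : sqn (x + y) = sqn x + 2 * Re (s x y) + sqn y.
Proof. by rewrite /sqn sipDl !sipDr !ReD (Re_sipC y x); ring. Qed.

Lemma sqnB x y : sqn (x - y) = sqn x - 2 * Re (s x y) + sqn y.
Proof. by rewrite sqnD sipNr ReN sqnN; ring. Qed.

Lemma sqn_parallelogram x y : sqn (x + y) + sqn (x - y) = 2 * sqn x + 2 * sqn y.
Proof. by rewrite sqnD sqnB; ring. Qed.

(** With squared norms this takes the place of the triangle inequality. Its factors 2
    are the origin of the powers of 2 that divide e in the estimates below. *)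
Lemma sqnD_le x y : sqn (x + y) <= 2 * sqn x + 2 * sqn y.
Proof. by rewrite -sqn_parallelogram lerDl sqn_ge0. Qed.

Lemma sqn_sub_le x y z : sqn (x - z) <= 2 * sqn (x - y) + 2 * sqn (y - z).
Proof. by rewrite -(subrKA y) sqnD_le. Qed.

Lemma Re_sip_sqr_le x y : Re (s x y) ^+ 2 <= sqn x * sqn y.
Proof.
apply: discriminant_le; rewrite ?sqn_ge0// => t.
have := sqn_ge0 (x + t%:C *: y); rewrite sqnD sqnZ sipZr ReM /= oppr0.
by rewrite mul0r subr0 expr0n addr0 mulrA.
Qed.

(** The bound on the real part, applied to i x. *)
Lemma Im_sip_sqr_le x y : Im (s x y) ^+ 2 <= sqn x * sqn y.
Proof.
have := Re_sip_sqr_le (0 +i* 1 *: x) y.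
by rewrite sqnZ sipZl ReM/= !mul0r mul1r sub0r sqrrN expr0n expr1n add0r mul1r.
Qed.

End semi_inner_theory.

(** * Orthogonal projection *)

Section projection.
Context {R : realType} {U : lmodType R[i]} (s : semiInner U).

Definition sip_cauchy (u : nat -> U) : Prop :=
  forall e : R, 0 < e -> exists N, forall m n, (N <= m)%N -> (N <= n)%N ->
    sqn s (u m - u n) < e.

Definition sip_cvg (u : nat -> U) (l : U) : Prop :=
  forall e : R, 0 < e -> exists N, forall n, (N <= n)%N -> sqn s (u n - l) < e.

(** A minimizing sequence is Cauchy by the parallelogram law; testing the
    minimum against multiples of z makes the limit orthogonal to z. *)
Theorem orthogonal_projection (W : set U) :
  W 0 -> (forall a x y, W x -> W y -> W (a *: x + y)) ->
  (forall u, (forall n, W (u n)) -> sip_cauchy u ->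
     exists2 w, W w & sip_cvg u w) ->
  forall x, exists2 w, W w & forall z, W z -> s (x - w) z = 0.
Proof.
move=> W0 Wlin Wcomplete x.
pose D := [set sqn s (x - z) | z in W].
have D0 : has_inf D.
  split; first by exists (sqn s (x - 0)), 0.
  by exists 0 => _ [z _ <-]; exact: sqn_ge0.
have dle z : W z -> inf D <= sqn s (x - z).
  by move=> Wz; apply: ge_inf; [case: D0|exists z].
have /choice[u uP] : forall n : nat, exists z, W z /\ sqn s (x - z) < inf D + n.+1%:R^-1.
  move=> n; have [] := @inf_adherent _ D n.+1%:R^-1 _ D0.
    by rewrite invr_gt0.
  by move=> _ [z Wz <-] ?; exists z.
have uW n : W (u n) by case: (uP n).
have udist m n : sqn s (u m - u n) <= 2 * m.+1%:R^-1 + 2 * n.+1%:R^-1.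
  have := sqn_parallelogram s (x - u n) (x - u m).
  have -> : x - u n - (x - u m) = u m - u n by rewrite opprB addrC addrA subrK.
  have -> : x - u n + (x - u m) = (2%:R : R)%:C *: (x - (2%:R^-1 : R)%:C *: (u m + u n)).
    rewrite scalerBr scalerA -rmorphM/= divff ?pnatr_eq0// rmorph1 scale1r.
    rewrite addrACA -opprD [u n + _]addrC; congr (_ - _).
    by rewrite rmorph_nat scaler_nat mulr2n.
  rewrite sqnZ /= expr0n addr0.
  have Wmid : W ((2%:R^-1 : R)%:C *: (u m + u n)).
    rewrite -[_ *: _]addr0; apply: (Wlin) => //.
    by rewrite -[u m]scale1r; apply: (Wlin).
  have := dle _ Wmid; have := (uP m).2; have := (uP n).2.
  move: (sqn s _) (sqn s _) (sqn s _) (sqn s _) => a b c d.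
  by move: (m.+1%:R^-1) (n.+1%:R^-1) (inf D) => p q r; lra.
have [w Ww wP] : exists2 w, W w & sip_cvg u w.
  apply: Wcomplete => // e e0.
  have [N NP] := natSinv_small (divr_gt0 e0 (ltr0n _ 4)).
  exists N => m n Nm Nn; apply: le_lt_trans (udist m n) _.
  have := NP _ Nm; have := NP _ Nn.
  by move: (m.+1%:R^-1) (n.+1%:R^-1) => p q; lra.
exists w => // z Wz.
have Re0 z' : W z' -> Re (s (x - w) z') = 0.
  move=> Wz'.
  have near_orth n : Re (s (x - u n) z') ^+ 2 <= n.+1%:R^-1 * sqn s z'.
    apply: discriminant_le; first exact: sqn_ge0.
    move=> t; have Wt : W ((- t)%:C *: z' + u n) by apply: (Wlin).
    have := dle _ Wt; have := (uP n).2.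
    have -> : x - ((- t)%:C *: z' + u n) = (x - u n) + t%:C *: z'.
      by rewrite opprD rmorphN scaleNr opprK addrCA addrC.
    rewrite (sqnD s (x - u n)) sqnZ sipZr ReM/= oppr0 mul0r subr0 expr0n addr0.
    by move: (sqn s _) (sqn s _) (inf D) (Re _) (_^-1) => a b c d e; lra.
  have small e : 0 < e -> Re (s (x - w) z') ^+ 2 <= e * sqn s z'.
    move=> e0; have e4 : 0 < e / 4 by rewrite divr_gt0.
    have [N NP] := natSinv_small e4; have [M MP] := wP _ e4.
    pose n := maxn N M.
    have := NP n (leq_maxl _ _); have := MP n (leq_maxr _ _) => h1 h2.
    have z0 := sqn_ge0 s z'.
    have hb : Re (s (x - u n) z') ^+ 2 <= e / 4 * sqn s z'.
      by apply: le_trans (near_orth n) _; rewrite ler_wpM2r// ltW.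
    have ha : Re (s (u n - w) z') ^+ 2 <= e / 4 * sqn s z'.
      by apply: le_trans (Re_sip_sqr_le _ _ _) _; rewrite ler_wpM2r// ltW.
    have -> : s (x - w) z' = s (x - u n) z' + s (u n - w) z' by rewrite -sipDl subrKA.
    rewrite ReD; move: ha hb; move: (Re _) (Re _) (sqn s z') => a b c ha hb.
    have := sqr_ge0 (a - b); lra.
  have [z0|zn0] := eqVneq (sqn s z') 0.
    have := small 1 ltr01; rewrite z0 mulr0 => h.
    by apply/eqP; rewrite -sqrf_eq0 eq_le h sqr_ge0.
  have z0 : 0 < sqn s z' by rewrite lt_def zn0 sqn_ge0.
  apply/eqP; rewrite -sqrf_eq0; have [//|r0] := eqVneq (Re (s (x - w) z') ^+ 2) 0.
  have r1 : 0 < Re (s (x - w) z') ^+ 2 by rewrite lt_def r0 sqr_ge0.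
  have := small _ (divr_gt0 (divr_gt0 r1 z0) (ltr0n _ 2)).
  rewrite mulrAC divfK//.
  by move: r1; move: (_ ^+ 2) => c; lra.
apply: complexP; first by rewrite Re0.
have Wiz : W ((0 +i* 1) *: z) by rewrite -[_ *: _]addr0; exact: Wlin.
have := Re0 _ Wiz; rewrite sipZr ReM/=; lra.
Qed.

End projection.

(** * Sequences in Hilbert spaces *)

Section hilbert_sequences.
Context {R : realType} {H : hilbertType R}.

Lemma inner_ZDl a (x y z : H) : inner (a *: x + y) z = a * inner x z + inner y z.
Proof. by rewrite linearDl/= linearZl_LR. Qed.

Lemma inner_conj (x y : H) : inner x y = (inner y x)^*%C.
Proof. by rewrite hermC expr0 mul1r. Qed.

Lemma Re_inner_ge0 (x : H) : 0 <= Re (inner x x).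
Proof. by have := dnorm_ge0 inner x; rewrite lecE => /andP[]. Qed.

Definition hsip : semiInner H := SemiInner inner_ZDl inner_conj Re_inner_ge0.

Lemma hsip_eq0 (x : H) : sqn hsip x = 0 -> x = 0.
Proof.
move=> x0; apply/eqP; rewrite -(dnorm_eq0 inner); apply/eqP.
by rewrite -[LHS]/(hsip x x) sipxx x0.
Qed.

Lemma hnorm_lt (x : H) (e : R) : 0 < e -> (`|x| < e%:C) = (sqn hsip x < e ^+ 2).
Proof.
move=> e0; have e0' : 0 < e%:C by rewrite ltcR.
rewrite -(@ltr_pXn2r _ 2)// ?nnegrE ?normr_ge0 ?ltW// norm_inner.
by rewrite -[inner x x]/(hsip x x) sipxx -rmorphXn/= ltcR.
Qed.

Lemma sip_cvg_cvg (u : nat -> H) l : sip_cvg hsip u l -> u @ \oo --> l.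
Proof.
move=> ul; apply/cvgrPdist_lt => -[e i]; rewrite ltcE/= => /andP[/eqP -> e0].
have [N NP] := ul _ (exprn_gt0 2 e0).
exists N => // n /= Nn; rewrite distrC -[_ +i* _]/(e%:C) hnorm_lt//.
exact: NP.
Qed.

Lemma hilbert_complete_seq (u : nat -> H) :
  sip_cauchy hsip u -> exists l, sip_cvg hsip u l.
Proof.
move=> uc.
have ucvg : cvg (u @ \oo).
  apply/cauchy_cvgP/cauchy_exP => -[e i]; rewrite ltcE/= => /andP[/eqP -> e0].
  have [N NP] := uc _ (exprn_gt0 2 e0).
  exists (u N); exists N => // n /= Nn.
  rewrite -ball_normE/= -[_ +i* _]/(e%:C) hnorm_lt//.
  by apply: NP.
exists (lim (u @ \oo)) => e e0.
have se0 : 0 < Num.sqrt e by rewrite sqrtr_gt0.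
have se0' : 0 < (Num.sqrt e)%:C :> R[i] by rewrite ltcR.
have /cvgrPdist_lt/(_ _ se0')[N _ NP] := ucvg.
exists N => n Nn; have := NP n Nn; rewrite /= distrC hnorm_lt//.
by rewrite sqr_sqrtr// ltW.
Qed.

(** Approximate d by elements of D and apply the Cauchy-Schwarz inequality to
    d - x and d. *)
Lemma dense_orthogonal (D : set H) (d : H) :
  dense D -> (forall x, D x -> inner x d = 0) -> d = 0.
Proof.
move=> Dd orth; apply: hsip_eq0; apply/eqP; have [//|d0] := eqVneq (sqn hsip d) 0.
have {}d0 : 0 < sqn hsip d by rewrite lt_def d0 sqn_ge0.
have se0 : 0 < Num.sqrt (sqn hsip d) by rewrite sqrtr_gt0.
have [] := Dd (ball d (Num.sqrt (sqn hsip d))%:C).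
- by exists d; apply: ballxx; rewrite ltcR.
- by apply: ball_open; rewrite ltcR.
move=> x []; rewrite -ball_normE/= hnorm_lt// sqr_sqrtr ?ltW// => xd Dx.
have := Re_sip_sqr_le hsip (d - x) d.
rewrite sipBl [hsip x d]orth// subr0 -/(sqn hsip d) expr2 ler_pM2r//.
by rewrite leNgt xd.
Qed.

End hilbert_sequences.

Section product_form.
Context {R : realType} {U V : lmodType R[i]} (s : semiInner U) (t : semiInner V).

Definition prod_form (p q : U * V) : R[i] := s p.1 q.1 + t p.2 q.2.

Lemma prod_formZDl a p q r :
  prod_form (a *: p + q) r = a * prod_form p r + prod_form q r.
Proof. by rewrite /prod_form/= !sipZDl; ring. Qed.

Lemma prod_form_conj p q : prod_form p q = (prod_form q p)^*%C.
Proof. by rewrite /prod_form rmorphD/= -!sipC. Qed.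

Lemma Re_prod_form_ge0 p : 0 <= Re (prod_form p p).
Proof. by rewrite ReD addr_ge0 ?Re_sip_ge0. Qed.

Definition prod_sip : semiInner (U * V)%type :=
  SemiInner prod_formZDl prod_form_conj Re_prod_form_ge0.

Lemma sqn_prod p : sqn prod_sip p = sqn s p.1 + sqn t p.2.
Proof. by rewrite /sqn ReD. Qed.

End product_form.

(** * Domains of normal operators *)

Section normal_domain.
Context {R : realType} {K : hilbertType R} (N : operator K).
Local Notation ip := (@hsip R K).
Local Notation ip2 := (prod_sip ip ip).

Lemma adjointP (p q : K * K) : graph N p -> adjoint N q ->
  ip p.2 q.1 = ip p.1 q.2.
Proof. by move=> Np; apply. Qed.

Lemma adjoint_submod a (p q : K * K) :
  adjoint N p -> adjoint N q -> adjoint N (a *: p + q).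
Proof.
move=> Np Nq r Nr /=; rewrite -![inner _ _]/(ip _ _) !sipDr !sipZr.
by rewrite (adjointP Nr Np) (adjointP Nr Nq).
Qed.

Lemma adjointB (p q : K * K) :
  adjoint N p -> adjoint N q -> adjoint N (p - q).
Proof.
by move=> Np Nq; rewrite addrC -scaleN1r; exact: adjoint_submod.
Qed.

Lemma graphB (p q : K * K) : graph N p -> graph N q -> graph N (p - q).
Proof.
move=> Np Nq; rewrite addrC -scaleN1r.
exact: (graph_submod N).2.
Qed.

Lemma prod_complete (u : nat -> K * K) :
  sip_cauchy ip2 u -> exists l, sip_cvg ip2 u l.
Proof.
move=> uc.
have c1 : sip_cauchy ip (fst \o u).
  move=> e /uc[M MP]; exists M => m n Mm Mn; have := MP _ _ Mm Mn.
  by rewrite sqn_prod; apply: le_lt_trans; rewrite lerDl sqn_ge0.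
have c2 : sip_cauchy ip (snd \o u).
  move=> e /uc[M MP]; exists M => m n Mm Mn; have := MP _ _ Mm Mn.
  by rewrite sqn_prod; apply: le_lt_trans; rewrite lerDr sqn_ge0.
have [l1 l1P] := hilbert_complete_seq c1.
have [l2 l2P] := hilbert_complete_seq c2.
exists (l1, l2) => e e0.
have e2 : 0 < e / 2 by rewrite divr_gt0.
have [M1 M1P] := l1P _ e2; have [M2 M2P] := l2P _ e2.
exists (maxn M1 M2) => n; rewrite geq_max => /andP[n1 n2].
by rewrite sqn_prod [ltRHS]splitr ltrD ?M1P ?M2P.
Qed.

Lemma closed_graph_cvg (u : nat -> K * K) l : closed (graph N) ->
  (forall n, graph N (u n)) -> sip_cvg ip2 u l -> graph N l.
Proof.
move=> Ncl uN ul.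
have c1 : (fst \o u) @ \oo --> l.1.
  apply: sip_cvg_cvg => e /ul[M MP]; exists M => n Mn; have := MP _ Mn.
  by rewrite sqn_prod; apply: le_lt_trans; rewrite lerDl sqn_ge0.
have c2 : (snd \o u) @ \oo --> l.2.
  apply: sip_cvg_cvg => e /ul[M MP]; exists M => n Mn; have := MP _ Mn.
  by rewrite sqn_prod; apply: le_lt_trans; rewrite lerDr sqn_ge0.
have c : (fun n => ((u n).1, (u n).2)) @ \oo --> (l.1, l.2).
  exact: (cvg_pair c1 c2).
rewrite [l]surjective_pairing.
apply: (@closed_cvg _ _ _ _ _ (graph N) Ncl _ _ c); apply: nearW => n.
by rewrite -surjective_pairing; exact: uN.
Qed.

Lemma adjoint_cvg (u v : nat -> K) x y :
  (forall n, adjoint N (u n, v n)) -> sip_cvg ip u x -> sip_cvg ip v y ->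
  adjoint N (x, y).
Proof.
move=> uvN ux vy p Np /=; rewrite -![inner _ _]/(ip _ _).
apply/eqP; rewrite -subr_eq0; apply/eqP.
set z := ip p.2 x - ip p.1 y.
have zE n : z = ip p.1 (v n - y) - ip p.2 (u n - x).
  by rewrite /z !sipBr (adjointP Np (uvN n))/=; ring.
have small (w : nat -> K) l q e : sip_cvg ip w l -> 0 < e ->
    exists M, forall n, (M <= n)%N ->
    sqn ip q * sqn ip (w n - l) < e.
  move=> wl e0; have q1 : 0 < sqn ip q + 1 by rewrite ltr_wpDl ?sqn_ge0.
  have [M MP] := wl _ (divr_gt0 e0 q1).
  exists M => n /MP; rewrite ltr_pdivlMr// mulrC; apply: le_lt_trans.
  by rewrite ler_wpM2r ?sqn_ge0// lerDl.
have z0 e : 0 < e -> Re z ^+ 2 <= e /\ Im z ^+ 2 <= e.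
  move=> e0; have e4 : 0 < e / 4 by rewrite divr_gt0.
  have [M1 M1P] := small _ _ p.1 _ vy e4.
  have [M2 M2P] := small _ _ p.2 _ ux e4.
  pose n := maxn M1 M2.
  have h1 := M1P n (leq_maxl _ _); have h2 := M2P n (leq_maxr _ _).
  have r1 := Re_sip_sqr_le ip p.1 (v n - y).
  have r2 := Re_sip_sqr_le ip p.2 (u n - x).
  have i1 := Im_sip_sqr_le ip p.1 (v n - y).
  have i2 := Im_sip_sqr_le ip p.2 (u n - x).
  rewrite (zE n) ReB ImB.
  move: (le_lt_trans r1 h1) (le_lt_trans r2 h2) (le_lt_trans i1 h1) (le_lt_trans i2 h2).
  move: (Re _) (Re _) (Im _) (Im _) => a b c d ha hb hc hd.
  by split; have := sqr_ge0 (a + b); have := sqr_ge0 (c + d); lra.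
have sq0 (a : R) : (forall e, 0 < e -> a ^+ 2 <= e) -> a = 0.
  move=> ae; apply/eqP; rewrite -sqrf_eq0 eq_le sqr_ge0 andbT.
  by apply/ler_addgt0Pr => e /ae; rewrite add0r.
by apply: complexP; apply: sq0 => e /z0[].
Qed.

(** The projection of (h, 0) on the graph of N produces the resolvent of
    N^* N at -1. *)
Lemma resolvent_onto : closed (graph N) -> forall h,
  exists a b c, [/\ graph N (a, b), adjoint N (b, c) & h = a + c].
Proof.
move=> Ncl h.
have [||u uN uc|w Nw orth] :=
  @orthogonal_projection R _ ip2 (graph N) _ _ _ (h, 0).
- exact: (graph_submod N).1.
- exact: (graph_submod N).2.
- have [l lP] := prod_complete uc.
  by exists l => //; exact: closed_graph_cvg uN lP.
exists w.1, w.2, (h - w.1); split.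
- by rewrite -surjective_pairing.
- move=> p Np /=; rewrite -![inner _ _]/(ip _ _).
  have := orth _ Np; rewrite -[ip2 _ _]/(ip (h - w.1) p.1 + ip (0 - w.2) p.2).
  rewrite sub0r sipNl => /eqP; rewrite subr_eq0 => /eqP h0.
  by rewrite sipC -h0 -sipC.
- by rewrite addrC subrK.
Qed.

(** The restriction of N to the domain of N^* N. *)
Definition gram_graph : set (K * K) :=
  [set p | graph N p /\ exists c, adjoint N (p.2, c)].

(** An element of the graph orthogonal to the restriction of N to the domain of
    N^* N has its first component orthogonal to the range of 1 + N^* N. *)
Lemma gram_core : closed (graph N) -> forall p, graph N p ->
  forall e : R, 0 < e -> exists2 q, gram_graph q & sqn ip2 (p - q) < e.
Proof.
move=> Ncl p Np.
pose W : set (K * K) := [set p | forall e : R, 0 < e ->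
  exists2 q, gram_graph q & sqn ip2 (p - q) < e].
have gW q : gram_graph q -> W q.
  by move=> gq e e0; exists q => //; rewrite subrr sqn0.
have g0 : gram_graph 0.
  split; first exact: (graph_submod N).1.
  by exists 0 => q Nq /=; rewrite !linear0r.
have glin a q r : gram_graph q -> gram_graph r -> gram_graph (a *: q + r).
  move=> [Nq [c qc]] [Nr [d rd]]; split; first exact: (graph_submod N).2.
  by exists (a *: c + d); exact: (adjoint_submod a qc rd).
have WN q : W q -> graph N q.
  move=> Wq.
  have /choice[u uP] : forall n : nat, exists r, gram_graph r /\ sqn ip2 (q - r) < n.+1%:R^-1.
    move=> n; have n0 : 0 < n.+1%:R^-1 :> R by rewrite invr_gt0.
    by have [r ? ?] := Wq _ n0; exists r.
  apply: (@closed_graph_cvg u) => //; first by move=> n; case: (uP n) => -[].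
  move=> e /natSinv_small[M MP]; exists M => n Mn.
  by rewrite sqn_subC; apply: lt_trans (uP n).2 _; exact: MP.
have [||u uW uc|w Ww orth] := @orthogonal_projection R _ ip2 W _ _ _ p.
- exact: gW.
- move=> a q r Wq Wr e e0.
  pose k := Re a ^+ 2 + Im a ^+ 2 + 1.
  have k0 : 0 < k by rewrite ltr_wpDl// addr_ge0 ?sqr_ge0.
  have e1 : 0 < e / (4 * k) by rewrite divr_gt0// mulr_gt0.
  have e2 : 0 < e / 4 by rewrite divr_gt0.
  have [q' gq' qq'] := Wq _ e1; have [r' gr' rr'] := Wr _ e2.
  exists (a *: q' + r'); first exact: glin.
  have -> : a *: q + r - (a *: q' + r') = a *: (q - q') + (r - r').
    by rewrite opprD addrACA -scalerBr.
  apply: le_lt_trans (sqnD_le _ _ _) _; rewrite sqnZ.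
  move: qq' rr'; rewrite ltr_pdivlMr ?mulr_gt0//.
  have : (Re a ^+ 2 + Im a ^+ 2) * sqn ip2 (q - q') <= k * sqn ip2 (q - q').
    by rewrite ler_wpM2r ?sqn_ge0// lerDl.
  by move: (sqn _ _) (sqn _ _) => b c; lra.
- have [l lP] := prod_complete uc.
  exists l => // e e0.
  have e4 : 0 < e / 4 by rewrite divr_gt0.
  have [M MP] := lP _ e4; have [q gq uq] := uW M _ e4.
  exists q => //; apply: le_lt_trans (sqn_sub_le _ _ (u M) _) _.
  have := MP M (leqnn _); rewrite sqn_subC; move: uq.
  by move: (sqn _ _) (sqn _ _) => b c; lra.
have [d1 d2] : (p - w).1 = 0 /\ (p - w).2 = 0.
  have Nd := graphB Np (WN _ Ww).
  have [a [b [c [Nab Nbc hac]]]] := resolvent_onto Ncl (p - w).1.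
  have gab : gram_graph (a, b) by split=> //; exists c.
  have := orth _ (gW _ gab).
  rewrite -[ip2 _ _]/(ip (p - w).1 a + ip (p - w).2 b).
  have e1 : ip (p - w).2 b = ip (p - w).1 c := adjointP Nd Nbc.
  rewrite e1 -sipDr -hac => h0.
  have d10 : (p - w).1 = 0.
    by apply: hsip_eq0; rewrite /sqn h0.
  split=> //; apply: (graph_functional (o := N)).
  by rewrite -d10 -surjective_pairing.
have -> : p = w.
  by apply/eqP; rewrite -subr_eq0; apply/eqP; rewrite [p - w]surjective_pairing d1 d2.
exact: Ww.
Qed.

(** On the domain of N^* N = N N^* the operators N and N^* have the same norm,
    so convergence in the graph norm of N transfers to N^*. *)
Theorem normal_dom_adjoint : normal_operator N ->
  forall p, graph N p -> exists v, adjoint N (p.1, v).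
Proof.
move=> [_ Ncl NN] p Np.
have /choice[u uP] : forall n : nat, exists q : K * K * (K * K),
    [/\ graph N q.1, adjoint N (q.1.2, q.2.2), adjoint N (q.1.1, q.2.1),
        graph N (q.2.1, q.2.2) & sqn ip2 (p - q.1) < n.+1%:R^-1].
  move=> n; have n0 : 0 < n.+1%:R^-1 :> R by rewrite invr_gt0.
  have [[a b] [Nab [c bc]] abp] := gram_core Ncl Np n0.
  have : (adjoint N \; graph N)%relation (a, c) by exists b.
  rewrite -NN => -[v av vc].
  by exists (a, b, (v, c)).
have ucvg : sip_cvg ip2 (fun n => (u n).1) p.
  move=> e /natSinv_small[M MP]; exists M => n Mn.
  have [_ _ _ _ un] := uP n.
  by rewrite sqn_subC; apply: lt_trans un _; exact: MP.
have same m n : sqn ip ((u m).2.1 - (u n).2.1) = sqn ip ((u m).1.2 - (u n).1.2).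
  have [m1 m2 m3 m4 _] := uP m; have [n1 n2 n3 n4 _] := uP n.
  have e1 : ip ((u m).1.2 - (u n).1.2) ((u m).1.2 - (u n).1.2) =
      ip ((u m).1.1 - (u n).1.1) ((u m).2.2 - (u n).2.2).
    exact: adjointP (graphB m1 n1) (adjointB m2 n2).
  have e2 : ip ((u m).2.2 - (u n).2.2) ((u m).1.1 - (u n).1.1) =
      ip ((u m).2.1 - (u n).2.1) ((u m).2.1 - (u n).2.1).
    exact: adjointP (graphB m4 n4) (adjointB m3 n3).
  by rewrite /sqn e1 -e2 Re_sipC.
have [v vP] : exists v, sip_cvg ip (fun n => (u n).2.1) v.
  apply: hilbert_complete_seq => e e0.
  have e4 : 0 < e / 4 by rewrite divr_gt0.
  have [M MP] := ucvg _ e4; exists M => m n Mm Mn; rewrite same.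
  apply: le_lt_trans (sqn_sub_le _ _ p.2 _) _.
  have := MP _ Mm; have := MP _ Mn; rewrite [sqn _ (_ - p)]sqn_subC !sqn_prod/=.
  have := sqn_ge0 ip (p.1 - (u n).1.1); have := sqn_ge0 ip ((u m).1.1 - p.1).
  by move: (sqn _ _) (sqn _ _) (sqn _ _) (sqn _ _) => a b c d; lra.
exists v; apply: (adjoint_cvg (u := fun n => (u n).1.1) _ _ vP); first by move=> n; case: (uP n).
move=> e /ucvg[M MP]; exists M => n /MP; rewrite sqn_prod.
by apply: le_lt_trans; rewrite lerDl sqn_ge0.
Qed.

End normal_domain.

(** * From normal extensions to the Halmos condition *)

(** The positivity condition of Halmos and Bram: for N normal extending S its matrix
    is the Gram matrix of the vectors N^*^m f_m. *)
Definition halmos_positive (R : realType) (H : hilbertType R) (S : H -> H) : Prop :=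
  forall (d : nat) (f : nat -> H),
    0 <= Re (\sum_(m < d) \sum_(n < d) hsip (iter n S (f m)) (iter m S (f n))).

Section subnormal_to_halmos.
Context {R : realType} {H K : hilbertType R}.

(** Polarization. *)
Lemma isometry_sip (V : {linear H -> K}) : (forall f, `|V f| = `|f|) ->
  forall f g, hsip (V f) (V g) = hsip f g.
Proof.
move=> iso.
have sqnV f : sqn hsip (V f) = sqn hsip f.
  have : inner (V f) (V f) = inner f f by rewrite -!norm_inner iso.
  by rewrite /sqn /= => ->.
have ReV f g : Re (hsip (V f) (V g)) = Re (hsip f g).
  have := sqnV (f + g); rewrite linearD !sqnD !sqnV; lra.
move=> f g; apply: complexP; first exact: ReV.
have := ReV ((0 +i* 1) *: f) g; rewrite linearZ !sipZl !ReM /=; lra.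
Qed.

(** If W intertwines S and N then so does N^* W, because N N^* = N^* N; this also
    keeps its range in the domain of N^*, which contains that of N. Starting from V,
    the maps N^*^k V are thus defined everywhere although N may be unbounded. *)
Theorem normal_extension_halmos (S : H -> H) (V : {linear H -> K})
    (N : operator K) :
  (forall f, `|V f| = `|f|) -> normal_operator N ->
  (forall f, graph N (V f, V (S f))) -> halmos_positive S.
Proof.
move=> iso Nn VN d f.
have [Nd _ NN] := Nn.
have uniq x y y' : adjoint N (x, y) -> adjoint N (x, y') -> y = y'.
  move=> xy xy'; apply/eqP; rewrite -subr_eq0; apply/eqP.
  apply: (dense_orthogonal Nd) => p [q Npq].
  have := adjointP Npq (adjointB xy xy'); rewrite /= subrr linear0r.
  by move=> /esym.
have /choice[next nextP] : forall W : H -> K, exists W' : H -> K,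
    (forall h, graph N (W h, W (S h))) ->
    (forall h, graph N (W' h, W' (S h))) /\ (forall h, adjoint N (W h, W' h)).
  move=> W; case: (pselect (forall h, graph N (W h, W (S h)))) => [WN|nW]; last first.
    by exists W.
  have /choice[W' W'P] : forall h, exists w,
      adjoint N (W h, w) /\ exists2 c, adjoint N (W (S h), c) & graph N (w, c).
    move=> h; have [c cP] := normal_dom_adjoint Nn (WN (S h)).
    have : (adjoint N \; graph N)%relation (W h, c).
      by exists (W (S h)); [exact: WN|exact: cP].
    by rewrite -NN => -[w hw wc]; exists w; split; last by exists c.
  exists W' => _; split=> h; last by case: (W'P h).
  have [_ [c c1 c2]] := W'P h.
  by have <- := uniq _ _ _ c1 (W'P (S h)).1.
pose W k := iter k next V.
have WN k : forall h, graph N (W k h, W k (S h)).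
  by elim: k => [//|k IHk]; exact: (nextP _ IHk).1.
have Wadj k h : adjoint N (W k h, W k.+1 h) by exact: (nextP _ (WN k)).2.
have shift k l g h : hsip (W l g) (W k.+1 h) = hsip (W l (S g)) (W k h).
  by rewrite (adjointP (WN l g) (Wadj k h)).
have gram0 k g h : hsip (V g) (W k h) = hsip (iter k S g) h.
  elim: k g => [|k IHk] g; first exact: isometry_sip.
  by rewrite (shift k 0%N) IHk iterSr.
have gram k l g h : hsip (W l g) (W k h) = hsip (iter k S g) (iter l S h).
  elim: k g => [|k IHk] g; first by rewrite sipC gram0 -sipC.
  by rewrite shift IHk iterSr.
under eq_bigr do under eq_bigr do rewrite -gram.
under eq_bigr do rewrite -sip_sumr.
by rewrite -sip_suml; exact: sqn_ge0.
Qed.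

End subnormal_to_halmos.

(** * Limits for a semi-inner product *)

Section sip_limits.
Context {R : realType} {U : lmodType R[i]} (s : semiInner U).
Implicit Types (u v : nat -> U) (x y : U).

Lemma sqnZD_le a x y :
  sqn s (a *: x + y) <= 2 * (Re a ^+ 2 + Im a ^+ 2) * sqn s x + 2 * sqn s y.
Proof. by apply: le_trans (sqnD_le _ _ _) _; rewrite sqnZ mulrA. Qed.

(** The continuity of (x, y) |-> a x + y, in the form given by sqnZD_le. *)
Lemma scale_threshold (a : R[i]) (e : R) : 0 < e -> exists2 d : R, 0 < d &
  forall p q : R, 0 <= p -> 0 <= q -> p < d -> q < d ->
    2 * (Re a ^+ 2 + Im a ^+ 2) * p + 2 * q < e.
Proof.
move=> e0; pose k := Re a ^+ 2 + Im a ^+ 2 + 1.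
have k0 : 0 < k by rewrite ltr_wpDl// addr_ge0 ?sqr_ge0.
exists (e / (4 * k)) => [|p q p0 q0]; first by rewrite divr_gt0// mulr_gt0.
rewrite !ltr_pdivlMr ?mulr_gt0// => pe qe.
have h1 : (Re a ^+ 2 + Im a ^+ 2) * p <= k * p by rewrite ler_wpM2r// lerDl.
have h2 : q <= k * q.
  by rewrite ler_peMl// /k lerDr addr_ge0 ?sqr_ge0.
by move: h1 h2 pe qe; move: (k) => k'; lra.
Qed.

Lemma sip_cauchyZD a u v : sip_cauchy s u -> sip_cauchy s v ->
  sip_cauchy s (fun n => a *: u n + v n).
Proof.
move=> uc vc e /(scale_threshold a)[d /[dup] /uc[N NP] /vc[M MP] dP].
exists (maxn N M) => m n; rewrite !geq_max => /andP[m1 m2] /andP[n1 n2].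
rewrite opprD addrACA -scalerBr; apply: le_lt_trans (sqnZD_le _ _ _) _.
by apply: dP; rewrite ?sqn_ge0 ?NP ?MP.
Qed.

Lemma sip_cvgZD a u v x y : sip_cvg s u x -> sip_cvg s v y ->
  sip_cvg s (fun n => a *: u n + v n) (a *: x + y).
Proof.
move=> uc vc e /(scale_threshold a)[d /[dup] /uc[N NP] /vc[M MP] dP].
exists (maxn N M) => n; rewrite !geq_max => /andP[n1 n2].
rewrite opprD addrACA -scalerBr; apply: le_lt_trans (sqnZD_le _ _ _) _.
by apply: dP; rewrite ?sqn_ge0 ?NP ?MP.
Qed.

Lemma sip_cvg_unique u x y : sip_cvg s u x -> sip_cvg s u y -> sqn s (x - y) = 0.
Proof.
move=> ux uy; apply/eqP; rewrite eq_le sqn_ge0 andbT.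
apply/ler_addgt0Pr => e e0; rewrite add0r.
have e4 : 0 < e / 4 by rewrite divr_gt0.
have [N NP] := ux _ e4; have [M MP] := uy _ e4.
have := NP _ (leq_maxl N M); have := MP _ (leq_maxr N M).
have := sqn_sub_le s x (u (maxn N M)) y; rewrite [sqn s (x - u _)]sqn_subC.
move: (sqn _ _) (sqn _ _) (sqn _ _) => a b c; lra.
Qed.

Lemma sip_cauchy_bounded u : sip_cauchy s u ->
  exists2 B, 0 < B & exists N, forall n, (N <= n)%N -> sqn s (u n) <= B.
Proof.
move=> /(_ _ ltr01)[N NP].
have s0 := sqn_ge0 s (u N).
exists (2 + 2 * sqn s (u N)); first by lra.
exists N => n Nn; have := NP _ _ Nn (leqnn _).
have := sqnD_le s (u n - u N) (u N); rewrite subrK.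
move: (sqn s (u n)) (sqn s (u n - _)) => a b; lra.
Qed.

Lemma sip_cvg_near u v x : sip_cvg s u x ->
  (forall e, 0 < e -> exists N, forall n, (N <= n)%N -> sqn s (u n - v n) < e) ->
  sip_cvg s v x.
Proof.
move=> ux uv e e0; have e4 : 0 < e / 4 by rewrite divr_gt0.
have [N NP] := ux _ e4; have [M MP] := uv _ e4.
exists (maxn N M) => n; rewrite geq_max => /andP[/NP h1 /MP h2].
apply: le_lt_trans (sqn_sub_le _ _ (u n) _) _.
by move: h1 h2; rewrite [sqn s (v n - _)]sqn_subC; move: (sqn _ _) (sqn _ _) => a b; lra.
Qed.

Lemma sip_cvg_le u x (B : R) N : sip_cvg s u x ->
  (forall n, (N <= n)%N -> sqn s (u n) <= B) -> sqn s x <= 2 * B.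
Proof.
move=> ux uB; apply/ler_addgt0Pr => e e0.
have [M MP] := ux _ (divr_gt0 e0 (ltr0n _ 2)).
have := uB _ (leq_maxl N M); have := MP _ (leq_maxr N M).
have := sqnD_le s (x - u (maxn N M)) (u (maxn N M)); rewrite subrK [sqn s (x - _)]sqn_subC.
move: (sqn _ _) (sqn _ _) (sqn _ _) => a b c; lra.
Qed.

End sip_limits.

(** * The complex line as a Hilbert space *)

Section complex_line.
Context {R : realType}.
Implicit Types z w : R[i].

Definition cprod (z w : R[i]^o) : R[i] := z * w^*%C.

Lemma cprodZDl a (x y z : R[i]^o) : cprod (a *: x + y) z = a * cprod x z + cprod y z.
Proof. by rewrite /cprod mulrDl -mulrA. Qed.

Lemma cprod_conj (x y : R[i]^o) : cprod x y = (cprod y x)^*%C.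
Proof. by rewrite /cprod rmorphM/= conjcK mulrC. Qed.

Lemma cprod_ge0 (x : R[i]^o) : 0 <= Re (cprod x x).
Proof.
by rewrite ReM Re_conjc Im_conjc mulrN opprK -!expr2 addr_ge0 ?sqr_ge0.
Qed.

Definition csip : semiInner R[i]^o := SemiInner cprodZDl cprod_conj cprod_ge0.

Lemma csqnE (z : R[i]^o) : sqn csip z = Re z ^+ 2 + Im z ^+ 2.
Proof. by rewrite /sqn ReM Re_conjc Im_conjc mulrN opprK -!expr2. Qed.

Lemma csqn_eq0 (z : R[i]^o) : sqn csip z = 0 -> z = 0.
Proof.
rewrite csqnE => /eqP; rewrite paddr_eq0 ?sqr_ge0// !sqrf_eq0.
by move=> /andP[/eqP r0 /eqP i0]; apply: complexP.
Qed.

Lemma csqn_conj (z : R[i]^o) : sqn csip (z^*%C : R[i]^o) = sqn csip z.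
Proof. by rewrite !csqnE Re_conjc Im_conjc sqrrN. Qed.

Lemma csip_cvg_unique (u : nat -> R[i]^o) x y :
  sip_cvg csip u x -> sip_cvg csip u y -> x = y.
Proof.
move=> ux uy; apply/eqP; rewrite -subr_eq0; apply/eqP.
exact: csqn_eq0 (sip_cvg_unique ux uy).
Qed.

Lemma csip_cvg_conj (u : nat -> R[i]^o) x :
  sip_cvg csip u x -> sip_cvg csip (fun n => (u n)^*%C : R[i]^o) (x^*%C : R[i]^o).
Proof.
move=> ux e /ux[N NP]; exists N => n /NP.
by rewrite -csqn_conj rmorphB.
Qed.

Lemma csip_complete (u : nat -> R[i]^o) : sip_cauchy csip u ->
  exists l, sip_cvg csip u l.
Proof.
move=> uc.
have part (p : R[i]^o -> R) : (forall z w, p (z - w) = p z - p w) ->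
    (forall z, p z ^+ 2 <= sqn csip z) ->
    exists l, forall e, 0 < e -> exists N, forall n, (N <= n)%N -> (p (u n) - l) ^+ 2 < e.
  move=> pB ple.
  have pc : cvg (p (u n) @[n --> \oo]).
    apply/cauchy_cvgP/cauchy_exP => e e0.
    have [N NP] := uc _ (exprn_gt0 2 e0); exists (p (u N)).
    exists N => // n /= Nn; rewrite -ball_normE/= -pB.
    rewrite -ltr_sqr ?nnegrE ?normr_ge0 ?ltW// real_normK ?num_real//.
    by apply: le_lt_trans (ple _) _; exact: NP.
  exists (lim (p (u n) @[n --> \oo])) => e e0.
  have se0 : 0 < Num.sqrt e by rewrite sqrtr_gt0.
  have /cvgrPdist_lt/(_ _ se0)[N _ NP] := pc.
  exists N => n Nn; have := NP n Nn => /=; rewrite distrC.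
  rewrite -ltr_sqr ?nnegrE ?normr_ge0 ?ltW// real_normK ?num_real//.
  by rewrite sqr_sqrtr// ltW.
have [||a aP] := part (@complex.Re R); [exact: ReB| |].
  by move=> z; rewrite csqnE lerDl sqr_ge0.
have [||b bP] := part (@complex.Im R); [exact: ImB| |].
  by move=> z; rewrite csqnE lerDr sqr_ge0.
exists (a +i* b) => e e0; have e2 : 0 < e / 2 by rewrite divr_gt0.
have [N NP] := aP _ e2; have [M MP] := bP _ e2.
exists (maxn N M) => n; rewrite geq_max => /andP[/NP h1 /MP h2].
by rewrite csqnE ReB ImB/= [ltRHS]splitr ltrD.
Qed.

Lemma csqn_sip_le (U : lmodType R[i]) (s : semiInner U) (x y : U) :
  sqn csip (s x y) <= 2 * (sqn s x * sqn s y).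
Proof.
rewrite csqnE; have := Re_sip_sqr_le s x y; have := Im_sip_sqr_le s x y.
by move: (_ ^+ 2) (_ ^+ 2) (_ * _) => a b c; lra.
Qed.

End complex_line.

(** * Completion of a semi-inner product space *)

Section completion.
Context {R : realType} {U : lmodType R[i]} (s : semiInner U).
Local Notation C := (@csip R).

Definition represents (l : U -> R[i]^o) (u : nat -> U) : Prop :=
  sip_cauchy s u /\ forall f, sip_cvg C (fun n => s (u n) f) (l f).

(** The completion of a semi-inner product space, realized by the antilinear
    functionals that are limits of the functionals s x: null vectors give the zero
    functional, so no quotient has to be formed. *)
Record completion := MkCompletion {
  completion_fun :> U -> R[i]^o;
  _ : completion_fun \in [pred l : U -> R[i]^o | `[< exists u, represents l u >]]
}.

HB.instance Definition _ := [isSub for completion_fun].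
HB.instance Definition _ := [Choice of completion by <:].

Lemma representsZD a l u k v : represents l u -> represents k v ->
  represents (a *: l + k) (fun n => a *: u n + v n).
Proof.
move=> [uc ul] [vc vk]; split; first exact: sip_cauchyZD.
move=> f; have := sip_cvgZD a (ul f) (vk f).
congr (sip_cvg _ _ _); apply/funext => n.
by rewrite sipZDl.
Qed.

Lemma representable_submod_closed :
  submod_closed [pred l : U -> R[i]^o | `[< exists u, represents l u >]].
Proof.
split=> [|a l k].
  rewrite inE; exists (fun=> 0); split.
    by move=> e e0; exists 0%N => m n _ _; rewrite /= subrr (sqn0 s).
  by move=> f e e0; exists 0%N => n _; rewrite sip0l subrr (sqn0 C).
rewrite !inE => -[u ul] [v vk].
by exists (fun n => a *: u n + v n); exact: representsZD.
Qed.

HB.instance Definition _ := GRing.SubChoice_isSubLmodule.Build _ _ _ completion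
  representable_submod_closed.

Definition mk_completion l (h : exists u, represents l u) : completion :=
  @MkCompletion l (asboolT h).

Lemma completion_rep (l : completion) : exists u, represents l u.
Proof. by case: l => l lP; apply/asboolP; exact: lP. Qed.

Lemma completion_ext (l k : completion) : (forall f, l f = k f) -> l = k.
Proof. by move=> lk; apply/val_inj/funext => f /=; exact: lk. Qed.

(** The convergence s (u n) f --> l f is uniform for f in the unit ball. *)
Lemma represents_approx l u : represents l u -> forall e, 0 < e ->
  exists N, forall n, (N <= n)%N -> forall f,
    sqn C (l f - s (u n) f) <= e * sqn s f.
Proof.
move=> [uc ul] e e0; have e4 : 0 < e / 4 by rewrite divr_gt0.
have [N NP] := uc _ e4; exists N => n Nn f.
have cv : sip_cvg C (fun m => s (u m - u n) f) (l f - s (u n) f).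
  move=> d /(ul f)[M MP]; exists M => m /MP.
  by congr (sqn _ _ < _); rewrite sipBl opprB addrA subrK.
have -> : e * sqn s f = 2 * (e / 2 * sqn s f) by field.
apply: (sip_cvg_le cv (N := N)) => m Nm; apply: le_trans (csqn_sip_le _ _ _) _.
have := ltW (NP _ _ Nm Nn); have := sqn_ge0 s f.
move: (sqn s _) (sqn s f) => b a a0 be.
have : b * a <= e / 4 * a by rewrite ler_wpM2r.
lra.
Qed.

(** Test the uniform estimate on the vector u n - v n itself. *)
Lemma represents_near l u v : represents l u -> represents l v ->
  forall e, 0 < e -> exists N, forall n, (N <= n)%N -> sqn s (u n - v n) < e.
Proof.
move=> ul vl e e0; have e2 : 0 < e / 8 by rewrite divr_gt0.
have [N NP] := represents_approx ul e2; have [M MP] := represents_approx vl e2.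
exists (maxn N M) => n; rewrite geq_max => /andP[/NP h1 /MP h2].
set w := u n - v n; have := h1 w; have := h2 w.
have := sqn_sub_le C (s (v n) w) (l w) (s (u n) w).
rewrite [sqn _ (s (v n) w - l w)]sqn_subC -sipBl -opprB sipNl sqnN -/w.
rewrite sipxx csqnE/= expr0n addr0.
have w0 := sqn_ge0 s w; move: (sqn C _) (sqn C _) => a b h3 h4 h5.
have : sqn s w * sqn s w <= e / 2 * sqn s w by rewrite -expr2; lra.
have [->//|wn0] := eqVneq (sqn s w) 0.
have {}w0 : 0 < sqn s w by rewrite lt_def wn0.
by rewrite ler_pM2r// => h6; apply: le_lt_trans h6 _; lra.
Qed.

Lemma bounded_small (u v : nat -> U) : sip_cauchy s v ->
  (forall e, 0 < e -> exists N, forall n, (N <= n)%N -> sqn s (u n) < e) ->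
  forall e, 0 < e -> exists N, forall n m, (N <= n)%N -> (N <= m)%N ->
    sqn C (s (u n) (v m)) < e /\ sqn C (s (v m) (u n)) < e.
Proof.
move=> /sip_cauchy_bounded[B B0 [M MP]] us e e0.
have eB : 0 < e / (2 * B) by rewrite divr_gt0// mulr_gt0.
have [N NP] := us _ eB; exists (maxn N M) => n m.
rewrite !geq_max => /andP[n1 _] /andP[_ m2].
have h : 2 * (sqn s (u n) * sqn s (v m)) < e.
  apply: (@le_lt_trans _ _ (2 * (sqn s (u n) * B))).
    by rewrite ler_pM2l// ler_wpM2l ?sqn_ge0// MP.
  by have := NP _ n1; rewrite ltr_pdivlMr ?mulr_gt0// mulrCA.
split; apply: le_lt_trans (csqn_sip_le _ _ _) _ => //.
by rewrite [sqn s (v m) * _]mulrC.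
Qed.

Lemma sip_pair_cauchy u v : sip_cauchy s u -> sip_cauchy s v ->
  sip_cauchy C (fun n => s (u n) (v n)).
Proof.
move=> uc vc e e0; have e4 : 0 < e / 8 by rewrite divr_gt0.
have [B B0 [N NP]] := sip_cauchy_bounded uc.
have [B' B'0 [N' NP']] := sip_cauchy_bounded vc.
have [M MP] := uc _ (divr_gt0 e4 B'0).
have [M' MP'] := vc _ (divr_gt0 e4 B0).
exists (maxn (maxn N N') (maxn M M')) => m n.
rewrite !geq_max => /andP[/andP[a1 a2] /andP[a3 a4]] /andP[/andP[b1 b2] /andP[b3 b4]].
have -> : s (u m) (v m) - s (u n) (v n) = s (u m - u n) (v m) + s (u n) (v m - v n).
  by rewrite sipBl sipBr addrA subrK.
apply: le_lt_trans (sqnD_le _ _ _) _.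
have := csqn_sip_le s (u m - u n) (v m); have := csqn_sip_le s (u n) (v m - v n).
have := MP _ _ a3 b3; have := MP' _ _ a4 b4; rewrite !ltr_pdivlMr//.
have h1 : sqn s (u m - u n) * sqn s (v m) <= sqn s (u m - u n) * B'.
  by rewrite ler_wpM2l ?sqn_ge0 ?NP'.
have h2 : sqn s (u n) * sqn s (v m - v n) <= sqn s (v m - v n) * B.
  by rewrite mulrC ler_wpM2l ?sqn_ge0 ?NP.
move: h1 h2; move: (sqn C _) (sqn C _) (_ * sqn s _) (_ * sqn s _) (_ * B) (_ * B').
by move=> a b c d x y; lra.
Qed.

Lemma sip_pair_near u v u' v' : sip_cauchy s u' -> sip_cauchy s v ->
  (forall e, 0 < e -> exists N, forall n, (N <= n)%N -> sqn s (u n - u' n) < e) ->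
  (forall e, 0 < e -> exists N, forall n, (N <= n)%N -> sqn s (v n - v' n) < e) ->
  forall e, 0 < e -> exists N, forall n, (N <= n)%N ->
    sqn C (s (u n) (v n) - s (u' n) (v' n)) < e.
Proof.
move=> uc vc uu vv e e0; have e4 : 0 < e / 4 by rewrite divr_gt0.
have [N NP] := bounded_small vc uu e4.
have [M MP] := bounded_small uc vv e4.
exists (maxn N M) => n; rewrite geq_max => /andP[nN nM].
have -> : s (u n) (v n) - s (u' n) (v' n) =
    s (u n - u' n) (v n) + s (u' n) (v n - v' n).
  by rewrite sipBl sipBr addrA subrK.
apply: le_lt_trans (sqnD_le _ _ _) _.
have [h1 _] := NP _ _ nN nN; have [_ h2] := MP _ _ nM nM.
by move: h1 h2; move: (sqn C _) (sqn C _) => a b; lra.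
Qed.

Lemma completion_inner_ex (l k : completion) : exists z, forall u v,
  represents l u -> represents k v -> sip_cvg C (fun n => s (u n) (v n)) z.
Proof.
have [u ul] := completion_rep l; have [v vk] := completion_rep k.
have [z uvz] := csip_complete (sip_pair_cauchy ul.1 vk.1).
exists z => u' v' u'l v'k; apply: sip_cvg_near uvz _.
apply: sip_pair_near; [exact: u'l.1|exact: vk.1| |].
  exact: represents_near ul u'l.
exact: represents_near vk v'k.
Qed.

Definition completion_inner (l k : completion) : R[i] :=
  projT1 (cid (completion_inner_ex l k)).

Lemma completion_innerP (l k : completion) u v :
  represents l u -> represents k v ->
  sip_cvg C (fun n => s (u n) (v n)) (completion_inner l k).
Proof. by rewrite /completion_inner; case: cid => z; exact. Qed.

Lemma completion_inner_eq (l k : completion) u v z :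
  represents l u -> represents k v ->
  sip_cvg C (fun n => s (u n) (v n)) z -> completion_inner l k = z.
Proof. by move=> ul vk; apply: csip_cvg_unique; exact: completion_innerP. Qed.

Lemma completion_innerZDl a (l k m : completion) :
  completion_inner (a *: l + k) m =
  a * completion_inner l m + completion_inner k m.
Proof.
have [u ul] := completion_rep l; have [v vk] := completion_rep k.
have [w wm] := completion_rep m.
have r : represents (completion_fun (a *: l + k)) (fun n => a *: u n + v n).
  exact: representsZD.
apply: (completion_inner_eq r wm).
have := sip_cvgZD a (completion_innerP ul wm) (completion_innerP vk wm).
by congr (sip_cvg _ _ _); apply/funext => n; rewrite sipZDl.
Qed.

Lemma completion_inner_conj (l k : completion) :
  completion_inner l k = (completion_inner k l)^*%C.
Proof.
have [u ul] := completion_rep l; have [v vk] := completion_rep k.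
apply: (completion_inner_eq ul vk).
have := csip_cvg_conj (completion_innerP vk ul).
by congr (sip_cvg _ _ _); apply/funext => n; rewrite -sipC.
Qed.

Lemma completion_sqn_cvg (l : completion) u : represents l u ->
  sip_cvg C (fun n => (sqn s (u n))%:C : R[i]^o) (completion_inner l l).
Proof.
move=> ul; have := completion_innerP ul ul.
by congr (sip_cvg _ _ _); apply/funext => n; rewrite sipxx.
Qed.

Lemma Re_completion_inner_ge0 (l : completion) :
  0 <= Re (completion_inner l l).
Proof.
have [u ul] := completion_rep l; rewrite leNgt; apply/negP => l0.
have l1 : 0 < - Re (completion_inner l l) by rewrite oppr_gt0.
have [N NP] := completion_sqn_cvg ul (exprn_gt0 2 l1).
have := NP N (leqnn _); rewrite csqnE ReB/=.
have := sqn_ge0 s (u N); have := sqr_ge0 (Im ((sqn s (u N))%:C - completion_inner l l)).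
move: l0 l1; move: (sqn s _) (Re _) (Im _) => a b c l0 l1 c0 a0.
have := mulr_ge0 a0 (ltW l1); have := sqr_ge0 a; lra.
Qed.

Definition completion_sip : semiInner completion :=
  SemiInner completion_innerZDl completion_inner_conj Re_completion_inner_ge0.
Local Notation K := completion_sip.

Lemma completion_sqn_le (l : completion) u N B : represents l u ->
  (forall n, (N <= n)%N -> sqn s (u n) <= B) -> sqn K l <= B.
Proof.
move=> ul uB; rewrite leNgt; apply/negP => lB.
have lB0 : 0 < sqn K l - B by rewrite subr_gt0.
have [M MP] := completion_sqn_cvg ul (exprn_gt0 2 lB0).
have := uB _ (leq_maxl N M); have := MP _ (leq_maxr N M).
rewrite csqnE ReB/= -/(sqn K l).
have := sqr_ge0 (Im ((sqn s (u (maxn N M)))%:C - completion_inner l l)).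
move: lB0; move: (sqn s _) (sqn K _) (Im _) => a b c lB0 c0 h1 h2.
have h3 : (b - B) ^+ 2 <= (a - b) ^+ 2.
  rewrite -[(a - b) ^+ 2]sqrrN opprB ler_sqr ?nnegrE; lra.
lra.
Qed.

Lemma completion_sip_eq0 (l : completion) : sqn K l = 0 -> l = 0.
Proof.
have [u ul] := completion_rep l => l0.
apply: completion_ext => f.
apply: (csip_cvg_unique (ul.2 f)) => e e0.
have f1 : 0 < sqn s f + 1 by rewrite ltr_wpDl ?sqn_ge0.
have d0 : 0 < e / (2 * (sqn s f + 1)) by rewrite divr_gt0// mulr_gt0.
have [N NP] := completion_sqn_cvg ul (exprn_gt0 2 d0).
exists N => n /NP; rewrite subr0 csqnE ReB/= -/(sqn K l) l0 subr0 => h.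
apply: le_lt_trans (csqn_sip_le _ _ _) _.
have : sqn s (u n) < e / (2 * (sqn s f + 1)).
  rewrite -ltr_sqr ?nnegrE ?sqn_ge0 ?ltW//; apply: le_lt_trans h.
  by rewrite lerDl sqr_ge0.
rewrite ltr_pdivlMr ?mulr_gt0//; have := sqn_ge0 s (u n); have := sqn_ge0 s f.
by move: (sqn s (u n)) (sqn s f) => a b; lra.
Qed.

Lemma completion_inner_bilinear : bilinear_for
  (GRing.Scale.Law.clone _ _ ( *%R ) _)
  (GRing.Scale.Law.clone _ _ (Num.conj \; *%R ) _) completion_inner.
Proof.
split=> [h|h] a f g /=; first exact: (sipZDl K).
by rewrite -![completion_inner _ _]/(K _ _) sipDr sipZr.
Qed.

HB.instance Definition _ := bilinear_isBilinear.Build R[i] completion completion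
  R[i] (GRing.Scale.Law.clone _ _ ( *%R ) _)
  (GRing.Scale.Law.clone _ _ (Num.conj \; *%R ) _) completion_inner
  completion_inner_bilinear.

Lemma completion_inner_hermitian (f g : completion) :
  completion_inner f g = (-1) ^+ false * (completion_inner g f)^*.
Proof. by rewrite expr0 mul1r; exact: (sipC K). Qed.

HB.instance Definition _ :=
  isHermitianSesquilinear.Build R[i] completion false Num.conj completion_inner
    completion_inner_hermitian.

Lemma completion_inner_gt0 (f : completion) : f != 0 -> 0 < completion_inner f f.
Proof.
move=> f0; rewrite -[completion_inner f f]/(K f f) sipxx ltcR.
rewrite lt_def sqn_ge0 andbT; apply: contra_neq f0; exact: completion_sip_eq0.
Qed.

HB.instance Definition _ :=
  isDotProduct.Build R[i] completion completion_inner completion_inner_gt0.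

Lemma represents_cst x : represents (s x) (fun=> x).
Proof.
split=> [e e0|f e e0]; first by exists 0%N => m n _ _; rewrite subrr sqn0.
by exists 0%N => n _; rewrite subrr sqn0.
Qed.

Definition embed (x : U) : completion :=
  mk_completion (ex_intro _ _ (represents_cst x)).

Lemma embedZD a x y : embed (a *: x + y) = a *: embed x + embed y.
Proof. by apply: completion_ext => f; exact: sipZDl. Qed.

Lemma embedB x y : embed (x - y) = embed x - embed y.
Proof. by rewrite addrC -scaleN1r embedZD scaleN1r addrC. Qed.

Lemma sip_embed x y : K (embed x) (embed y) = s x y.
Proof.
apply: (@completion_inner_eq (embed x) (embed y) _ _ _
  (represents_cst x) (represents_cst y)) => e e0.
by exists 0%N => n _; rewrite subrr sqn0.
Qed.

Lemma represents_sqn_near (l : completion) u : represents l u ->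
  forall e, 0 < e -> exists N, forall n, (N <= n)%N -> sqn K (l - embed (u n)) <= e.
Proof.
move=> ul e e0; have [N NP] := ul.1 _ e0; exists N => n Nn.
have r : represents (completion_fun (l - embed (u n))) (fun m => - 1 *: u n + u m).
  have := representsZD (-1) (represents_cst (u n)) ul.
  congr (represents _ _); apply/funext => f /=.
  by rewrite -[RHS]/(l f - s (u n) f) -[LHS]/(-1 * s (u n) f + l f) mulN1r addrC.
apply: (completion_sqn_le r (N := N)) => m Nm.
by rewrite addrC scaleN1r ltW// NP.
Qed.

(** Replace each term of a Cauchy sequence by a nearby vector of U; the new sequence
    is Cauchy in U and represents the limit. *)
Lemma completion_complete (u : nat -> completion) :
  (forall e : R[i], 0 < e -> exists N, forall m n, (N <= m)%N -> (N <= n)%N ->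
     completion_inner (u m - u n) (u m - u n) < e) ->
  exists l, forall e : R[i], 0 < e -> exists N, forall n, (N <= n)%N ->
     completion_inner (u n - l) (u n - l) < e.
Proof.
have ltE (l : completion) (e : R[i]) : 0 < e ->
    (completion_inner l l < e) = (sqn K l < Re e).
  case: e => a b; rewrite ltcE/= => /andP[/eqP -> _].
  by rewrite -[completion_inner l l]/(K l l) sipxx; exact: (ltcR (sqn K l) a).
move=> uc.
have {}uc : sip_cauchy K u.
  move=> e e0; have e0' : 0 < e%:C by rewrite ltcR.
  have [N NP] := uc _ e0'; exists N => m n Nm Nn.
  by have := NP _ _ Nm Nn; rewrite ltE.
have /choice[w wP] : forall n : nat, exists x, sqn K (u n - embed x) <= n.+1%:R^-1.
  move=> n; have [v vu] := completion_rep (u n).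
  have n0 : 0 < n.+1%:R^-1 :> R by rewrite invr_gt0.
  by have [N NP] := represents_sqn_near vu n0; exists (v N); exact: NP.
have wc : sip_cauchy s w.
  move=> e e0; have e16 : 0 < e / 16 by rewrite divr_gt0.
  have [N NP] := uc _ e16; have [M MP] := natSinv_small e16.
  exists (maxn N M) => m n; rewrite !geq_max => /andP[m1 m2] /andP[n1 n2].
  have -> : sqn s (w m - w n) = sqn K (embed (w m) - embed (w n)).
    by rewrite -embedB /sqn sip_embed.
  apply: le_lt_trans (sqn_sub_le _ _ (u m) _) _.
  have := sqn_sub_le K (u m) (u n) (embed (w n)).
  have := NP _ _ m1 n1; have := MP _ m2; have := MP _ n2.
  have := wP m; have := wP n; rewrite [sqn K (embed (w m) - _)]sqn_subC.
  move: (sqn K _) (sqn K _) (sqn K _) (sqn K _) (_^-1) (_^-1) => a b c d x y.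
  lra.
have /choice[l lP] : forall f, exists z, sip_cvg C (fun n => s (w n) f) z.
  move=> f; apply: csip_complete; apply: sip_pair_cauchy => // e e0.
  by exists 0%N => m n _ _; rewrite subrr sqn0.
have lr : represents l w by [].
pose L := mk_completion (ex_intro _ w lr).
exists L => e e0.
have re0 : 0 < Re e by move: e0; rewrite ltcE/= => /andP[].
have e4 : 0 < Re e / 8 by rewrite divr_gt0.
have [N NP] := represents_sqn_near (lr : represents (completion_fun L) w) e4.
have [M MP] := natSinv_small e4.
exists (maxn N M) => n; rewrite geq_max => /andP[n1 n2]; rewrite ltE//.
apply: le_lt_trans (sqn_sub_le _ _ (embed (w n)) _) _.
have := NP _ n1; have := MP _ n2; have := wP n; rewrite [sqn K (L - _)]sqn_subC.
by move: (sqn K _) (sqn K _) (_^-1) => a b c; lra.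
Qed.

HB.instance Definition _ := Lmodule_isHilbert.Build R completion completion_complete.

End completion.

(** * Operators on the completion *)

Section completion_maps.
Context {R : realType} {U : lmodType R[i]} (s : semiInner U).

Section extension.
Variables (a b : U -> U) (M : R).
Hypothesis aB : forall x y, a (x - y) = a x - a y.
Hypothesis a_le : forall x, sqn s (a x) <= M * sqn s x.
Hypothesis ab : forall x y, s (a x) y = s x (b y).

Lemma represents_precomp l u : represents s l u -> represents s (l \o b) (a \o u).
Proof.
move=> [uc ul]; split=> [e e0|f]; last first.
  by have := ul (b f); congr (sip_cvg _ _ _); apply/funext => n /=; rewrite ab.
have M1 : 0 < `|M| + 1 by rewrite ltr_wpDl.
have [N NP] := uc _ (divr_gt0 e0 M1); exists N => m n Nm Nn /=.
rewrite -aB; apply: le_lt_trans (a_le _) _.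
have := NP _ _ Nm Nn; rewrite ltr_pdivlMr//; apply: le_lt_trans.
rewrite mulrC ler_wpM2l ?sqn_ge0//.
by apply: le_trans (ler_norm _) _; rewrite lerDl.
Qed.

Lemma precomp_ex (l : completion s) : exists u, represents s (l \o b) u.
Proof.
by have [u ul] := completion_rep l; exists (a \o u); exact: represents_precomp.
Qed.

(** Since s (a x) f = s x (b f), extending a amounts to precomposing with b. *)
Definition extend (l : completion s) : completion s :=
  mk_completion (precomp_ex l).

Lemma extendZD c l k : extend (c *: l + k) = c *: extend l + extend k.
Proof. exact: completion_ext. Qed.

Lemma extend_embed x : extend (embed s x) = embed s (a x).
Proof. by apply: completion_ext => f; rewrite /= ab. Qed.

End extension.

Lemma extend_adjoint (a b : U -> U) (M M' : R) aB a_le ab bB b_le ba :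
  forall l k : completion s,
  hsip (@extend a b M aB a_le ab l) k = hsip l (@extend b a M' bB b_le ba k).
Proof.
move=> l k.
have [u ul] := completion_rep l; have [v vk] := completion_rep k.
have r1 := represents_precomp aB a_le ab ul.
have r2 := represents_precomp bB b_le ba vk.
apply: (@completion_inner_eq _ _ s (extend aB a_le ab l) k _ _ _ r1 vk).
have := @completion_innerP _ _ s l (extend bB b_le ba k) _ _ ul r2.
by congr (sip_cvg _ _ _); apply/funext => n /=; rewrite ab.
Qed.

End completion_maps.

(** * Everywhere defined normal operators *)

Section everywhere_defined_normal.
Context {R : realType} {K : hilbertType R} (a b : K -> K).
Hypothesis aZD : forall c x y, a (c *: x + y) = c *: a x + a y.
Hypothesis ab : forall x y, hsip (a x) y = hsip x (b y).
Hypothesis abC : forall x, a (b x) = b (a x).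

Lemma total_graph_submod : [set p : K * K | p.2 = a p.1] 0 /\
  forall c (p q : K * K), [set p : K * K | p.2 = a p.1] p ->
    [set p : K * K | p.2 = a p.1] q -> [set p : K * K | p.2 = a p.1] (c *: p + q).
Proof.
split=> [|c p q /= -> ->]; last by rewrite aZD.
by have := aZD (-1) 0 0; rewrite scaler0 addr0 scaleN1r addNr.
Qed.

Lemma total_graph_functional y : [set p : K * K | p.2 = a p.1] (0, y) -> y = 0.
Proof.
move=> /= ->; by have := aZD (-1) 0 0; rewrite scaler0 addr0 scaleN1r addNr.
Qed.

Definition total_operator : operator K :=
  Operator total_graph_submod total_graph_functional.

Lemma hsip_inj (x y : K) : (forall z, hsip z x = hsip z y) -> x = y.
Proof.
move=> xy; apply/eqP; rewrite -subr_eq0; apply/eqP; apply: hsip_eq0.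
by rewrite /sqn sipBr xy subrr.
Qed.

Lemma adjoint_total : adjoint total_operator = [set p : K * K | p.2 = b p.1].
Proof.
apply/seteqP; split=> -[x y] /=.
  move=> xy; apply: hsip_inj => z; rewrite -ab.
  by have := xy (z, a z) erefl => /= ->.
by move=> -> [z w] /= ->; exact: ab.
Qed.

Lemma total_operator_closed : closed (graph total_operator).
Proof.
have -> : graph total_operator = [set p : K * K | p.2 = a p.1] by [].
move=> -[x y] /= cl.
apply: hsip_inj => z.
have small (e : R) : 0 < e -> exists p, [/\ p.2 = a p.1,
    sqn hsip (x - p.1) < e ^+ 2 & sqn hsip (y - p.2) < e ^+ 2].
  move=> e0; have e0' : 0 < e%:C :> R[i] by rewrite ltcR.
  have : nbhs (x, y) (ball x e%:C `*` ball y e%:C).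
    by exists (ball x e%:C, ball y e%:C) => //; split; exact: nbhsx_ballx.
  move/cl => -[p [/= p2 []]]; rewrite -!ball_normE/= !hnorm_lt// => h1 h2.
  by exists p.
apply/eqP; rewrite -subr_eq0; apply/eqP; apply: csqn_eq0.
apply/eqP; rewrite eq_le sqn_ge0 andbT; apply/ler_addgt0Pr => d d0; rewrite add0r.
have z1 : 0 < 8 * (sqn hsip z + sqn hsip (b z) + 1).
  by rewrite mulr_gt0// ltr_wpDl// addr_ge0 ?sqn_ge0.
pose e := Num.sqrt (d / (8 * (sqn hsip z + sqn hsip (b z) + 1))).
have e0 : 0 < e by rewrite sqrtr_gt0 divr_gt0.
have [p [p2 h1 h2]] := small _ e0.
have eE : e ^+ 2 = d / (8 * (sqn hsip z + sqn hsip (b z) + 1)).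
  by rewrite sqr_sqrtr// ltW// divr_gt0.
have -> : hsip z y - hsip z (a x) = hsip z (y - p.2) - (hsip (x - p.1) (b z))^*%C.
  rewrite -ab -sipC p2.
  have -> : a (x - p.1) = a x - a p.1.
    by rewrite addrC -scaleN1r aZD scaleN1r addrC.
  by rewrite !sipBr; ring.
apply: le_trans (sqnD_le _ _ _) _; rewrite sqnN csqn_conj.
have := csqn_sip_le hsip z (y - p.2); have := csqn_sip_le hsip (x - p.1) (b z).
move: h1 h2; rewrite eE !ltr_pdivlMr//.
have := sqn_ge0 hsip z; have := sqn_ge0 hsip (b z).
have := sqn_ge0 hsip (y - p.2); have := sqn_ge0 hsip (x - p.1).
move: (sqn csip _) (sqn csip _) (sqn hsip (x - _)) (sqn hsip (y - _)).
move: (sqn hsip z) (sqn hsip (b z)) => A B c1 c2 X Y X0 Y0 B0 A0 h1 h2 h3 h4.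
have := mulr_ge0 X0 A0; have := mulr_ge0 X0 B0.
have := mulr_ge0 Y0 A0; have := mulr_ge0 Y0 B0.
lra.
Qed.

Lemma total_operator_normal : normal_operator total_operator.
Proof.
split.
- rewrite /densely_defined (_ : _.`1 = setT); last first.
    by apply/seteqP; split=> // x _; exists (a x).
  by move=> O O0 _; rewrite setIT.
- exact: total_operator_closed.
- rewrite adjoint_total; apply/seteqP; split=> -[x y] /= [z] /= zx yz.
    by exists (a x) => //=; rewrite yz zx abC.
  by exists (b x) => //=; rewrite yz zx abC.
Qed.

End everywhere_defined_normal.

(** * Finitely supported sequences *)

Section finite_sequences.
Context {U : nmodType}.

Definition finitely_supported (f : nat -> U) : Prop :=
  exists d, forall k, (d <= k)%N -> f k = 0.

End finite_sequences.

Section finite_sequence_space.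
Context {K : pzRingType} {U : lmodType K}.

Record finseq := MkFinseq {
  finseq_fun :> nat -> U;
  _ : finseq_fun \in [pred f : nat -> U | `[< finitely_supported f >]]
}.

HB.instance Definition _ := [isSub for finseq_fun].
HB.instance Definition _ := [Choice of finseq by <:].

Lemma finitely_supported_submod_closed :
  submod_closed [pred f : nat -> U | `[< finitely_supported f >]].
Proof.
split=> [|a f g]; rewrite !inE; first by exists 0%N.
move=> [d dP] [e eP]; exists (maxn d e) => k; rewrite geq_max => /andP[dk ek].
by rewrite -[LHS]/(a *: f k + g k) dP// eP// scaler0 addr0.
Qed.

HB.instance Definition _ := GRing.SubChoice_isSubLmodule.Build _ _ _ finseq
  finitely_supported_submod_closed.

Lemma finseqP (f : finseq) : exists d, forall k, (d <= k)%N -> f k = 0.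
Proof. by case: f => f fP; apply/asboolP; exact: fP. Qed.

Definition mk_finseq f (h : finitely_supported f) : finseq :=
  @MkFinseq f (asboolT h).

Lemma finseq_ext (f g : finseq) : (forall k, f k = g k) -> f = g.
Proof. by move=> fg; apply/val_inj/funext => k /=; exact: fg. Qed.

Definition bound (f : finseq) : nat := projT1 (cid (finseqP f)).

Lemma boundP f k : (bound f <= k)%N -> f k = 0.
Proof. by rewrite /bound; case: cid => d dP /=; exact: dP. Qed.

End finite_sequence_space.
Arguments finseq {K} U.

(** * From the Halmos condition to normal extensions *)

Section bram_halmos.
Context {R : realType} {H : hilbertType R} (S : H -> H).
Hypothesis SZD : forall c x y, S (c *: x + y) = c *: S x + S y.
Variable B : R.
Hypothesis B_ge0 : 0 <= B.
Hypothesis S_le : forall x, sqn hsip (S x) <= B * sqn hsip x.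
Hypothesis Spos : halmos_positive S.
Local Notation ip := (@hsip R H).

Lemma iter0 n : iter n S 0 = 0.
Proof.
have S0 : S 0 = 0 by have := SZD (-1) 0 0; rewrite scaler0 addr0 scaleN1r addNr.
by elim: n => //= n ->.
Qed.

Lemma iterZD n c x y : iter n S (c *: x + y) = c *: iter n S x + iter n S y.
Proof. by elim: n => //= n ->; rewrite SZD. Qed.

Lemma iter_sqn_le n x : sqn ip (iter n S x) <= B ^+ n * sqn ip x.
Proof.
elim: n => [|n IHn]; first by rewrite expr0 mul1r.
apply: le_trans (S_le _) _; rewrite exprS -mulrA.
by rewrite ler_wpM2l.
Qed.

(** The inner product that sum_m N^*^m f_m and sum_n N^*^n g_n would have for a
    normal extension N of S. *)
Definition halmos_sum (d e : nat) (f g : nat -> H) : R[i] :=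
  \sum_(m < d) \sum_(n < e) ip (iter n S (f m)) (iter m S (g n)).

Definition halmos_form (f g : finseq H) : R[i] := halmos_sum (bound f) (bound g) f g.

Lemma halmos_formE (f g : finseq H) d e :
  (forall k, (d <= k)%N -> f k = 0) -> (forall k, (e <= k)%N -> g k = 0) ->
  halmos_form f g = halmos_sum d e f g.
Proof.
have ext d1 d2 e1 e2 : (d1 <= d2)%N -> (e1 <= e2)%N ->
    (forall k, (d1 <= k)%N -> f k = 0) -> (forall k, (e1 <= k)%N -> g k = 0) ->
    halmos_sum d1 e1 f g = halmos_sum d2 e2 f g.
  move=> d12 e12 f0 g0; rewrite /halmos_sum.
  rewrite -!(big_mkord xpredT (fun m => \sum_(n < _) ip (iter n S (f m)) (iter m S (g n)))).
  rewrite [RHS](big_cat_nat _ (n := d1))//.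
  rewrite [X in _ = _ + X]big_nat_cond [X in _ = _ + X]big1 ?addr0; last first.
    move=> m /andP[/andP[dm _] _]; rewrite big1// => n _.
    by rewrite f0// iter0 sip0l.
  apply: eq_bigr => m _.
  rewrite -!(big_mkord xpredT (fun n => ip (iter n S (f m)) (iter m S (g n)))).
  rewrite [RHS](big_cat_nat _ (n := e1))//.
  rewrite [X in _ = _ + X]big_nat_cond [X in _ = _ + X]big1 ?addr0// => n.
  by move=> /andP[/andP[en _] _]; rewrite g0// iter0 sip0r.
move=> f0 g0; rewrite /halmos_form.
rewrite (ext _ (maxn (bound f) d) _ (maxn (bound g) e) (leq_maxl _ _) (leq_maxl _ _)).
- by rewrite (ext d (maxn (bound f) d) e (maxn (bound g) e))// leq_maxr.
- exact: boundP.
- exact: boundP.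
Qed.

Lemma common_bound2 (f g : finseq H) : exists d,
  (forall k, (d <= k)%N -> f k = 0) /\ (forall k, (d <= k)%N -> g k = 0).
Proof.
exists (maxn (bound f) (bound g)); split=> k; rewrite geq_max => /andP[h1 h2].
  exact: boundP.
exact: boundP.
Qed.

Lemma halmos_formZDl c f g h :
  halmos_form (c *: f + g) h = c * halmos_form f h + halmos_form g h.
Proof.
have [d [f0 g0]] := common_bound2 f g; have h0 := @boundP _ _ h.
have fg0 k : (d <= k)%N -> (c *: f + g) k = 0.
  by move=> dk; rewrite -[LHS]/(c *: f k + g k) f0// g0// scaler0 addr0.
rewrite (halmos_formE fg0 h0) (halmos_formE f0 h0) (halmos_formE g0 h0).
rewrite /halmos_sum mulr_sumr -big_split; apply: eq_bigr => m _.
rewrite mulr_sumr -big_split; apply: eq_bigr => n _.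
have -> : (c *: f + g) m = c *: f m + g m by [].
by rewrite iterZD sipZDl.
Qed.

Lemma halmos_form_conj f g : halmos_form f g = (halmos_form g f)^*%C.
Proof.
rewrite /halmos_form /halmos_sum rmorph_sum exchange_big; apply: eq_bigr => n _.
by rewrite rmorph_sum; apply: eq_bigr => m _; exact: sipC.
Qed.

Lemma Re_halmos_form_ge0 f : 0 <= Re (halmos_form f f).
Proof. exact: Spos. Qed.

Definition halmos_sip : semiInner (finseq H) :=
  SemiInner halmos_formZDl halmos_form_conj Re_halmos_form_ge0.
Local Notation s := halmos_sip.

Lemma apply_finite (f : finseq H) : finitely_supported (S \o f).
Proof.
have [d dP] := finseqP f; exists d => k /dP /= ->; exact: (iter0 1).
Qed.
(** The operator N of the extension to be constructed, since N commutes with N^*. *)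
Definition applyS f : finseq H := mk_finseq (apply_finite f).

Lemma shift_finite (f : finseq H) :
  finitely_supported (fun k => if k is k'.+1 then f k' else 0).
Proof. by have [d dP] := finseqP f; exists d.+1 => -[//|k]; exact: dP. Qed.
(** The operator N^* of the extension to be constructed. *)
Definition shift f : finseq H := mk_finseq (shift_finite f).

Lemma applyS_shift f : applyS (shift f) = shift (applyS f).
Proof. by apply: finseq_ext => -[|k] //=; exact: (iter0 1). Qed.

Lemma applyS_adjoint f g : s (applyS f) g = s f (shift g).
Proof.
have f0 := @boundP _ _ f; have g0 := @boundP _ _ g.
have f1 k : (bound f <= k)%N -> applyS f k = 0.
  by move=> /f0 /= ->; exact: (iter0 1).
have g1 k : ((bound g).+1 <= k)%N -> shift g k = 0.
  by case: k => // k; exact: g0.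
rewrite -[LHS]/(halmos_form _ _) -[RHS]/(halmos_form _ _).
rewrite (halmos_formE f1 g0) (halmos_formE f0 g1); apply: eq_bigr => m _.
rewrite big_ord_recl [shift g ord0](_ : _ = 0)// iter0 sip0r add0r.
apply: eq_bigr => n _; rewrite [applyS f m](_ : _ = S (f m))// -iterSr.
by rewrite [shift g (lift ord0 n)](_ : _ = g n).
Qed.

Lemma shift_adjoint f g : s (shift f) g = s f (applyS g).
Proof. by rewrite sipC -applyS_adjoint -sipC. Qed.

Lemma sqn_shift f : sqn s (shift f) = sqn s (applyS f).
Proof.
by rewrite /sqn shift_adjoint applyS_shift -applyS_adjoint.
Qed.

(** The squared norms of the iterates of applyS on f form a log-convex sequence, as for
    every normal operator, and it grows at most like B ^ k because the iterates of S
    do; hence already its first step grows by at most B. *)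
Lemma applyS_sqn_le f : sqn s (applyS f) <= B * sqn s f.
Proof.
pose delta k := sqn s (iter k applyS f).
have it k m : iter k applyS f m = iter k S (f m).
  by elim: k => //= k ->.
have [d f0] := finseqP f.
have : delta 1%N <= B * delta 0%N; last by [].
apply: (@log_convex_growth _ _ (\sum_(m < d) \sum_(n < d)
    (B ^+ n * sqn ip (f m) + B ^+ m * sqn ip (f n)))) => //.
- by move=> n; exact: sqn_ge0.
- move=> k; rewrite /delta /=; set g := iter k applyS f.
  rewrite {1}/sqn applyS_adjoint.
  apply: le_trans (Re_sip_sqr_le _ _ _) _.
  by rewrite sqn_shift.
- move=> k; rewrite /delta [X in X <= _]/sqn.
  have fk j : (d <= j)%N -> iter k applyS f j = 0.
    by move=> dj; rewrite it f0// iter0.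
  rewrite -[s _ _]/(halmos_form _ _) (halmos_formE fk fk) /halmos_sum.
  rewrite Re_sum mulr_suml; apply: ler_sum => m _.
  rewrite Re_sum mulr_suml; apply: ler_sum => n _.
  rewrite !it -!iterD.
  have h1 := iter_sqn_le (n + k) (f m); have h2 := iter_sqn_le (m + k) (f n).
  have := sqn_ge0 ip (iter (n + k) S (f m) - iter (m + k) S (f n)).
  rewrite sqnB; move: h1 h2; rewrite !exprD.
  have := sqn_ge0 ip (iter (n + k) S (f m)).
  have := sqn_ge0 ip (iter (m + k) S (f n)).
  move: (sqn ip (f m)) (sqn ip (f n)) (B ^+ n) (B ^+ m) (B ^+ k).
  move: (sqn ip _) (sqn ip _) (Re _) => a b c p q x y z.
  by lra.
Qed.

Lemma applySB f g : applyS (f - g) = applyS f - applyS g.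
Proof.
apply: finseq_ext => k; rewrite -[LHS]/(S (f k - g k)) -[RHS]/(S (f k) - S (g k)).
by rewrite addrC -scaleN1r SZD scaleN1r addrC.
Qed.

Lemma shiftB f g : shift (f - g) = shift f - shift g.
Proof.
by apply: finseq_ext => -[|k] //; rewrite -[RHS]/(0 - 0 : H) subr0.
Qed.

Lemma shift_sqn_le f : sqn s (shift f) <= B * sqn s f.
Proof. by rewrite sqn_shift applyS_sqn_le. Qed.

Let N := extend applySB applyS_sqn_le applyS_adjoint.
Let Nadj := extend shiftB shift_sqn_le shift_adjoint.

Lemma single_finite (x : H) : finitely_supported (fun k => if k is 0%N then x else 0).
Proof. by exists 1%N => -[]. Qed.
Definition single x : finseq H := mk_finseq (single_finite x).

Lemma sip_single x y : s (single x) (single y) = ip x y.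
Proof.
have h (z : H) k : (1 <= k)%N -> single z k = 0 by case: k.
rewrite -[LHS]/(halmos_form _ _) (halmos_formE (h x) (h y)).
by rewrite /halmos_sum !big_ord1.
Qed.

Definition V0 x : completion s := embed s (single x).

Lemma V0_linear : linear V0.
Proof.
move=> c x y; rewrite /V0 -embedZD; congr (embed _ _).
apply: finseq_ext => -[|k] //=.
by rewrite -[RHS]/(c *: 0 + 0 : H) scaler0 addr0.
Qed.

HB.instance Definition _ := GRing.isLinear.Build R[i] H (completion s) _ V0 V0_linear.

Theorem halmos_normal_extension : exists (K : hilbertType R)
    (V : {linear H -> K}) (N : operator K),
  [/\ forall f, `|V f| = `|f|, normal_operator N &
      forall f, graph N (V f, V (S f))].
Proof.
have NZD : forall c l k, N (c *: l + k) = c *: N l + N k.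
  by move=> c l k; exact: extendZD.
exists (completion s : hilbertType R), V0, (total_operator NZD); split.
- move=> f; apply/eqP; rewrite -(@eqrXn2 _ 2)// !norm_inner; apply/eqP.
  by rewrite -[RHS](sip_single f f) -[RHS](sip_embed s).
- apply: (@total_operator_normal _ _ _ Nadj).
  + exact: extend_adjoint.
  + move=> l; apply: completion_ext => f /=.
    by rewrite applyS_shift.
- move=> f /=; rewrite /V0 /N extend_embed; congr (embed _ _).
  by apply: finseq_ext => -[|k] //=; rewrite [S 0](iter0 1).
Qed.

End bram_halmos.

(** * Riemann sums of monotone functions *)

Section interval_sums.
Context {R : realType}.
Local Notation leb := (@lebesgue_measure R).
Implicit Types (f : R -> R) (a b c : R).

Lemma lebesgue_measure_oc a b : a <= b -> leb `]a, b] = (b - a)%:E.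
Proof.
rewrite lebesgue_measure_itv/= lte_fin le_eqVlt => /predU1P[->|->].
  by rewrite ltxx subrr.
by rewrite EFinB.
Qed.

Lemma integral_oc_cst a b c : a <= b ->
  (\int[leb]_(x in `]a, b]) c%:E = (c * (b - a))%:E)%E.
Proof. by move=> ab; rewrite integral_cst//= lebesgue_measure_oc. Qed.

Lemma integral_oc_ge a b c f : a <= b -> measurable_fun setT f ->
  (forall x, 0 <= f x) -> 0 <= c -> (forall x, a < x <= b -> c <= f x) ->
  ((c * (b - a))%:E <= \int[leb]_(x in `]a, b]) (f x)%:E)%E.
Proof.
move=> ab mf f0 c0 cf; rewrite -integral_oc_cst//.
apply: ge0_le_integral => //=.
by apply/measurable_EFinP; exact: measurable_funTS.
Qed.

Lemma integral_oc_le a b c f : a <= b -> measurable_fun setT f ->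
  (forall x, 0 <= f x) -> (forall x, a < x <= b -> f x <= c) ->
  (\int[leb]_(x in `]a, b]) (f x)%:E <= (c * (b - a))%:E)%E.
Proof.
move=> ab mf f0 fc; rewrite -integral_oc_cst//.
apply: ge0_le_integral => //=.
- by move=> x _; rewrite lee_fin.
- by apply/measurable_EFinP; exact: measurable_funTS.
Qed.

Lemma integral_partition f (t : nat -> R) n : measurable_fun setT f ->
  (forall x, 0 <= f x) -> (forall j, t j <= t j.+1) ->
  (\int[leb]_(x in `]t 0%N, t n]) (f x)%:E =
   \sum_(j < n) \int[leb]_(x in `]t j, t j.+1]) (f x)%:E)%E.
Proof.
move=> mf f0 tS.
have t0 m : t 0%N <= t m by elim: m => // m /le_trans; apply.
elim: n => [|n IHn].
  by rewrite big_ord0 set_itvoc0 integral_set0.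
have -> : `]t 0%N, t n.+1]%classic = `]t 0%N, t n] `|` `]t n, t n.+1].
  apply/seteqP; split=> x /=; rewrite !in_itv/=.
    move=> /andP[x0 xn]; case: (leP x (t n)) => xtn; [left|right].
      by rewrite x0.
    by [].
  move=> [/andP[x0 xn]|/andP[x0 xn]].
    by rewrite x0 (le_trans xn).
  by rewrite xn (le_lt_trans (t0 n)).
rewrite ge0_integral_setU//=; last 3 first.
- by apply/measurable_EFinP; exact: measurable_funTS.
- by move=> x _; rewrite lee_fin.
- apply/disj_setPS => x [/=]; rewrite !in_itv/= => /andP[_ h1] /andP[h2 _].
  by have := le_lt_trans h1 h2; rewrite ltxx.
by rewrite big_ord_recr/= IHn.
Qed.

Lemma riemann_sum_bracket f c N : 0 <= c -> {homo f : x y / x <= y} ->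
  (forall x, 0 <= f x) ->
  let step := c / N.+1%:R in
  ((\sum_(j < N.+1) f (j%:R * step) * step)%:E <=
     \int[leb]_(x in `]0%R, c]) (f x)%:E <=
   (\sum_(j < N.+1) f (j.+1%:R * step) * step)%:E)%E.
Proof.
move=> c0 fmono f0; set step := c / N.+1%:R => /=.
have mf : measurable_fun setT f by exact: nondecreasing_measurable.
have s0 : 0 <= step by rewrite divr_ge0.
have sS j : j.+1%:R * step - j%:R * step = step.
  by rewrite -natr1; ring.
have tS j : j%:R * step <= j.+1%:R * step by rewrite ler_wpM2r// ler_nat.
have -> : `]0, c]%classic = `]0%:R * step, N.+1%:R * step]%classic.
  by rewrite mul0r /step mulrC divfK// pnatr_eq0.
rewrite (@integral_partition _ (fun j => j%:R * step))//.
apply/andP; split.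
- rewrite -sumEFin; apply: lee_sum => j _.
  rewrite -[X in (_ * X)%:E](sS j); apply: integral_oc_ge => // x /andP[h _].
  by apply: fmono; exact: ltW.
- rewrite -[leRHS]sumEFin; apply: lee_sum => j _.
  rewrite -[X in (_ * X)%:E](sS j); apply: integral_oc_le => // x /andP[_ h].
  exact: fmono.
Qed.

(** The difference of the two sums telescopes. *)
Lemma riemann_sum_gap f c N : 0 <= c -> (forall x, 0 <= f x <= 1) ->
  let step := c / N.+1%:R in
  \sum_(j < N.+1) f (j.+1%:R * step) * step -
  \sum_(j < N.+1) f (j%:R * step) * step <= step.
Proof.
move=> c0 f01; set step := c / N.+1%:R => /=; have s0 : 0 <= step by rewrite divr_ge0.
rewrite -sumrB -(big_mkord xpredT (fun j => f (j.+1%:R * step) * step - f (j%:R * step) * step)).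
rewrite telescope_sumr// -mulrBl ler_piMl//.
have /andP[_ h1] := f01 (N.+1%:R * step); have /andP[h2 _] := f01 (0%:R * step).
by lra.
Qed.

End interval_sums.

(** * Moment functionals *)

Section moments.
Context {R : comNzRingType}.
Implicit Types (gamma : nat -> R) (p q : {poly R}).

(** The linear functional on polynomials sending the n-th power to gamma n. *)
Definition moment gamma p : R := \sum_(i < size p) p`_i * gamma i.

Lemma momentE gamma p d : (size p <= d)%N ->
  moment gamma p = \sum_(i < d) p`_i * gamma i.
Proof.
move=> pd; rewrite /moment (big_ord_widen _ (fun i => p`_i * gamma i) pd) big_mkcond.
by apply: eq_bigr => i _; case: ltnP => // h; rewrite nth_default ?mul0r.
Qed.

Lemma momentZD gamma a p q :
  moment gamma (a *: p + q) = a * moment gamma p + moment gamma q.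
Proof.
pose d := maxn (size (a *: p + q)) (maxn (size p) (size q)).
rewrite !(momentE gamma (d := d)) ?leq_max ?leqnn ?orbT//.
rewrite mulr_sumr -big_split; apply: eq_bigr => i _ /=.
by rewrite coefD coefZ mulrDl mulrA.
Qed.

Lemma moment0 gamma : moment gamma 0 = 0.
Proof. by rewrite /moment size_poly0 big_ord0. Qed.

Lemma momentD gamma p q : moment gamma (p + q) = moment gamma p + moment gamma q.
Proof. by rewrite -[p]scale1r momentZD mul1r scale1r. Qed.

Lemma momentZ gamma a p : moment gamma (a *: p) = a * moment gamma p.
Proof. by rewrite -[a *: p]addr0 momentZD moment0 addr0. Qed.

Lemma momentN gamma p : moment gamma (- p) = - moment gamma p.
Proof. by rewrite -scaleN1r momentZ mulN1r. Qed.

Lemma momentB gamma p q : moment gamma (p - q) = moment gamma p - moment gamma q.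
Proof. by rewrite momentD momentN. Qed.

Lemma moment_sum gamma I (r : seq I) (P : pred I) (F : I -> {poly R}) :
  moment gamma (\sum_(i <- r | P i) F i) = \sum_(i <- r | P i) moment gamma (F i).
Proof.
by apply: (big_morph (moment gamma)) => [p q|]; rewrite ?momentD ?moment0.
Qed.

Lemma momentXn gamma n : moment gamma 'X^n = gamma n.
Proof.
rewrite (momentE gamma (d := n.+1)) ?size_polyXn// big_ord_recr/=.
rewrite coefXn eqxx mul1r big1 ?add0r// => i _.
by rewrite coefXn/= ltn_eqF ?mul0r.
Qed.

Lemma momentMXn gamma p k :
  moment gamma (p * 'X^k) = moment (fun n => gamma (n + k)%N) p.
Proof.
rewrite -[p in LHS]coefK poly_def mulr_suml moment_sum; apply: eq_bigr => i _.
by rewrite -scalerAl -exprD momentZ momentXn.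
Qed.

Lemma moment_scale gamma a p : moment (fun n => a * gamma n) p = a * moment gamma p.
Proof. by rewrite /moment mulr_sumr; apply: eq_bigr => i _; rewrite mulrCA. Qed.

Lemma moment_sum_seq n (g : nat -> nat -> R) p :
  moment (fun k => \sum_(m < n) g m k) p = \sum_(m < n) moment (g m) p.
Proof.
rewrite /moment exchange_big; apply: eq_bigr => i _ /=.
by rewrite mulr_sumr.
Qed.

End moments.

(** * Bernstein polynomials *)

Section bernstein.
Context {R : realType}.
Implicit Types (m n k : nat).

Definition bern n k : {poly R} := 'C(n, k)%:R *: ('X^k * (1 - 'X) ^+ (n - k)).

(** The quotient of falling factorials k ^_ m / n ^_ m: with these in place of the
    powers (k / n) ^ m the Bernstein operator reproduces 'X^m exactly, and they are
    uniformly close to these powers for large n. *)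
Fixpoint falling_ratio m n k : R :=
  if m is m'.+1 then k%:R / n%:R * falling_ratio m' n.-1 k.-1 else 1.

Lemma bern_falling_ratio m n : (m <= n)%N ->
  \sum_(k < n.+1) falling_ratio m n k *: bern n k = 'X^m.
Proof.
elim: m n => [|m IHm] n mn.
  rewrite expr0; have -> : 1 = ((1 - 'X) + 'X) ^+ n :> {poly R} by rewrite subrK expr1n.
  rewrite exprDn; apply: eq_bigr => k _.
  by rewrite scale1r /bern scaler_nat mulrC.
case: n mn => // n mn; rewrite big_ord_recl /= mul0r mul0r scale0r add0r.
rewrite exprS -(IHm n mn) mulr_sumr; apply: eq_bigr => k _ /=.
have key : k.+1%:R / n.+1%:R * 'C(n.+1, k.+1)%:R = 'C(n, k)%:R :> R.
  have n0 : n.+1%:R != 0 :> R by rewrite pnatr_eq0.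
  apply: (mulfI n0); rewrite mulrA mulrCA divff// mulr1 -!natrM; congr (_%:R).
  by rewrite mul_bin_diag.
rewrite /bump leq0n add1n /bern subSS -!scalerAr exprS -mulrA !scalerA.
by rewrite -key; congr (_ *: _); ring.
Qed.

(** Replacing (k, n) by (k - 1, n - 1) in one factor moves k / n by at most
    1 / (n - 1). *)
Lemma falling_ratio_near m (e : R) : 0 < e -> exists N, forall n k,
  (N <= n)%N -> (k <= n)%N -> `|falling_ratio m n k - (k%:R / n%:R) ^+ m| <= e.
Proof.
elim: m e => [|m IHm] e e0.
  by exists 0%N => n k _ _ /=; rewrite expr0 subrr normr0 ltW.
have e2 : 0 < e / 2 by rewrite divr_gt0.
have [N1 N1P] := IHm _ e2.
have [N2 N2P] := natSinv_small (divr_gt0 e2 (ltr0Sn R m)).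
exists (maxn N1 N2).+2 => -[|[|n]]// k Nn kn.
have {Nn}[h1 h2] : (N1 <= n)%N /\ (N2 <= n)%N.
  by move: Nn; rewrite !ltnS geq_max => /andP[].
case: k kn => [|k] kn /=; first by rewrite !mul0r expr0n subrr normr0 ltW.
set x : R := k.+1%:R / n.+2%:R.
pose y : R := k%:R / n.+1%:R.
have x01 : 0 <= x <= 1.
  by rewrite divr_ge0//= ler_pdivrMr ?ltr0n// mul1r ler_nat.
have y01 : 0 <= y <= 1.
  by rewrite divr_ge0//= ler_pdivrMr ?ltr0n// mul1r ler_nat.
have yx : `|y - x| <= n.+1%:R^-1.
  have n1 : n.+1%:R != 0 :> R by rewrite pnatr_eq0.
  have n2 : n.+2%:R != 0 :> R by rewrite pnatr_eq0.
  have -> : y - x = - ((n.+1 - k)%N%:R / n.+2%:R) * n.+1%:R^-1.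
    rewrite natrB// /y /x; move: n1 n2; rewrite -[n.+2%:R]natr1 -[k.+1%:R]natr1.
    by move: (n.+1%:R) (k%:R) => a b a0 a1; field; rewrite a1 a0.
  rewrite normrM normrN [`|_^-1|]ger0_norm ?invr_ge0// ler_piMl ?invr_ge0//.
  rewrite ger0_norm ?divr_ge0// ler_pdivrMr ?ltr0n// mul1r ler_nat.
  by rewrite (leq_trans (leq_subr _ _)).
have -> : x * falling_ratio m n.+1 k - x ^+ m.+1 =
    x * ((falling_ratio m n.+1 k - y ^+ m) + (y ^+ m - x ^+ m)).
  by rewrite exprS; ring.
have /andP[x0 x1] := x01.
rewrite normrM (ger0_norm x0); apply: le_trans (ler_piMl (normr_ge0 _) x1) _.
apply: le_trans (ler_normD _ _) _; rewrite [leRHS]splitr; apply: lerD.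
  by apply: N1P => //; exact: leqW.
apply: le_trans (exprB_le _ y01 x01) _.
apply: le_trans (ler_wpM2l (ler0n _ _) yx) _.
have := N2P _ h2; rewrite ltr_pdivlMr ?ltr0n// => /ltW; apply: le_trans.
by rewrite mulrC ler_wpM2l ?invr_ge0// ler_nat.
Qed.

End bernstein.

(** Compactness of [0, 1]. *)
Lemma ultra_limit (R : realType) (F : set_system nat) (x : nat -> R) :
  UltraFilter F -> (forall n, 0 <= x n <= 1) -> exists l : R, x n @[n --> F] --> l.
Proof.
move=> UF x01.
have FF : ProperFilter F by exact: ultra_proper.
have F01 : F (x @^-1` `[0, 1]%classic).
  by apply: filterS filterT => n _ /=; rewrite in_itv/= x01.
have [l [_ ll]] := @segment_compact R 0 1 (fmap x F) (fmap_proper_filter x FF) F01.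
exists l => A Al; have [//|FnA] := in_ultra_setVsetC (x @^-1` A) UF.
by have [y [xy Ay]] := ll (~` A) A FnA Al.
Qed.

(** * The Hausdorff moment problem *)

Section hausdorff.
Context {R : realType} (gamma : nat -> R).
Hypothesis pos : forall j k, 0 <= moment gamma ('X^j * (1 - 'X) ^+ k).
Local Notation leb := (@lebesgue_measure R).

Definition bern_weight n k : R := moment gamma (bern n k).

Lemma bern_weight_ge0 n k : 0 <= bern_weight n k.
Proof. by rewrite /bern_weight momentZ mulr_ge0. Qed.

Lemma sum_falling_ratio m n : (m <= n)%N ->
  \sum_(k < n.+1) falling_ratio m n k * bern_weight n k = gamma m.
Proof.
move=> mn; rewrite -[RHS]momentXn -(@bern_falling_ratio R _ _ mn) moment_sum.
by apply: eq_bigr => k _; rewrite momentZ.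
Qed.

Lemma sum_bern_weight n : \sum_(k < n.+1) bern_weight n k = gamma 0%N.
Proof.
rewrite -(sum_falling_ratio (leq0n n)).
by apply: eq_bigr => k _; rewrite mul1r.
Qed.

Lemma gamma0_ge0 : 0 <= gamma 0%N.
Proof. by rewrite -(sum_bern_weight 0); apply: sumr_ge0 => k _; exact: bern_weight_ge0. Qed.

(** The m-th moment of the measure with mass bern_weight n k at each point k / n. *)
Definition bern_moment n m : R :=
  \sum_(k < n.+1) (k%:R / n%:R) ^+ m * bern_weight n k.

Lemma bern_moment_cvg m : bern_moment n m @[n --> \oo] --> gamma m.
Proof.
apply/cvgrPdist_le => e e0.
have g1 : 0 < gamma 0%N + 1 by rewrite ltr_wpDl// gamma0_ge0.
have [N NP] := falling_ratio_near m (divr_gt0 e0 g1).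
exists (maxn N m) => // n /=; rewrite geq_max => /andP[Nn mn].
rewrite -(sum_falling_ratio mn) -sumrB.
apply: le_trans (ler_norm_sum _ _ _) _.
apply: (@le_trans _ _ (\sum_(k < n.+1) e / (gamma 0%N + 1) * bern_weight n k)).
  apply: ler_sum => k _; rewrite -mulrBl normrM (ger0_norm (bern_weight_ge0 _ _)).
  by rewrite ler_wpM2r ?bern_weight_ge0// NP// -ltnS.
rewrite -mulr_sumr sum_bern_weight mulrAC ler_pdivrMr// ler_wpM2l ?ltW//.
by rewrite ltrDl.
Qed.

Definition bern_cdf n k : R := \sum_(j < k) bern_weight n j.

Lemma bern_cdfS n k : bern_cdf n k.+1 = bern_cdf n k + bern_weight n k.
Proof. by rewrite /bern_cdf big_ord_recr. Qed.

Lemma bern_cdf_le n k k' : (k <= k')%N -> bern_cdf n k <= bern_cdf n k'.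
Proof.
move=> kk'; rewrite -(subnKC kk'); elim: (k' - k)%N => [|j IHj]; first by rewrite addn0.
by apply: le_trans IHj _; rewrite addnS bern_cdfS lerDl bern_weight_ge0.
Qed.

(** The quantile function of that measure: its value on ]bern_cdf n k, bern_cdf n k.+1]
    is k / n. *)
Definition quantile n (u : R) : R := (\sum_(j < n) (bern_cdf n j.+1 < u)%R%:R) / n%:R.

Lemma quantile_mono n : {homo quantile n : u v / u <= v}.
Proof.
move=> u v uv; rewrite ler_wpM2r ?invr_ge0//; apply: ler_sum => j _.
by rewrite ler_nat; case: (ltP (bern_cdf n j.+1) u) => // h; rewrite (lt_le_trans h uv).
Qed.

Lemma quantile01 n u : 0 <= quantile n u <= 1.
Proof.
apply/andP; split; first by rewrite divr_ge0// sumr_ge0.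
case: n => [|n]; first by rewrite /quantile invr0 mulr0.
rewrite ler_pdivrMr ?ltr0n// mul1r.
have -> : n.+1%:R = \sum_(j < n.+1) 1 :> R by rewrite sumr_const card_ord.
by apply: ler_sum => j _; case: (_ < _).
Qed.

Lemma quantile_cst n k u : (k <= n)%N -> bern_cdf n k < u <= bern_cdf n k.+1 ->
  quantile n u = k%:R / n%:R.
Proof.
move=> kn /andP[ku uk]; congr (_ / _).
transitivity (\sum_(j < n) (j < k)%N%:R : R).
  apply: eq_bigr => j _; congr (_%:R); congr nat_of_bool.
  case: ltnP => jk; first by rewrite (le_lt_trans (bern_cdf_le n jk) ku).
  by apply/negbTE; rewrite -leNgt; apply: le_trans uk (bern_cdf_le _ _).
rewrite -(big_mkord xpredT (fun j => (j < k)%N%:R)) (big_cat_nat _ (n := k))//=.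
rewrite [X in _ + X]big_nat_cond [X in _ + X]big1 ?addr0; last first.
  by move=> j /andP[/andP[kj _] _]; rewrite ltnNge kj.
rewrite big_nat_cond (eq_bigr (fun=> 1)); last by move=> j /andP[/andP[_ ->]].
by rewrite -big_nat_cond big_const_nat subn0 iter_addr addr0.
Qed.

Lemma quantile_integral n m :
  (\int[leb]_(u in `]0%R, gamma 0%N]) (quantile n u ^+ m)%:E = (bern_moment n m)%:E)%E.
Proof.
have c0 : bern_cdf n 0 = 0 by rewrite /bern_cdf big_ord0.
have c1 : bern_cdf n n.+1 = gamma 0%N by exact: sum_bern_weight.
have mono : {homo (fun u => quantile n u ^+ m) : u v / u <= v}.
  move=> u v uv; have /andP[u0 _] := quantile01 n u.
  by rewrite lerXn2r ?nnegrE ?quantile_mono//; have /andP[] := quantile01 n v.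
rewrite -c1 -[X in `]X, _]]c0 integral_partition; last 3 first.
- exact: nondecreasing_measurable.
- by move=> u; rewrite exprn_ge0//; have /andP[] := quantile01 n u.
- by move=> j; exact: bern_cdf_le.
rewrite -sumEFin; apply: eq_bigr => k _.
transitivity (\int[leb]_(u in `]bern_cdf n k, bern_cdf n k.+1]) ((k%:R / n%:R) ^+ m)%:E)%E.
  apply: eq_integral => u; rewrite inE/= in_itv/= => uk.
  by rewrite (@quantile_cst n k)// -ltnS.
by rewrite integral_oc_cst ?bern_cdf_le// bern_cdfS addrC addKr.
Qed.

(** A limit of the quantile functions along an ultrafilter is again monotone, and
    since Riemann sums of monotone functions approximate their integrals at a
    uniform rate, the integrals of the powers pass to the limit as well. *)
Lemma limit_quantile : exists q : R -> R, [/\ {homo q : u v / u <= v},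
  forall u, 0 <= q u <= 1 & forall m,
  (\int[leb]_(u in `]0%R, gamma 0%N]) (q u ^+ m)%:E = (gamma m)%:E)%E].
Proof.
have [F [UF ooF]] := @ultraFilterLemma _ \oo _.
have FF : ProperFilter F by exact: ultra_proper.
have /choice[q qP] : forall u, exists l : R, quantile n u @[n --> F] --> l.
  by move=> u; apply: ultra_limit => n; exact: quantile01.
have q_mono : {homo q : u v / u <= v}.
  move=> u v uv; apply: (ler_cvg_to (qP u) (qP v)).
  by apply: nearW => n; exact: quantile_mono.
have q01 u : 0 <= q u <= 1.
  apply/andP; split.
    apply: (ler_cvg_to (cvg_cst (0 : R)) (qP u)); apply: nearW => n.
    by have /andP[] := quantile01 n u.
  apply: (ler_cvg_to (qP u) (cvg_cst (1 : R))); apply: nearW => n.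
  by have /andP[] := quantile01 n u.
exists q; split=> // m.
have pow_mono (f : R -> R) : {homo f : u v / u <= v} -> (forall u, 0 <= f u <= 1) ->
    {homo (fun u => f u ^+ m) : u v / u <= v}.
  move=> fm f01 u v uv; have /andP[u0 _] := f01 u; have /andP[v0 _] := f01 v.
  by rewrite lerXn2r ?nnegrE ?fm.
have pow01 (f : R -> R) : (forall u : R, 0 <= f u <= 1) -> forall u, 0 <= f u ^+ m <= 1.
  by move=> f01 u; have /andP[u0 u1] := f01 u; rewrite exprn_ge0//= exprn_ile1.
have g0 := gamma0_ge0.
have powF u : quantile n u ^+ m @[n --> F] --> q u ^+ m.
  apply: (@continuous_cvg _ _ _ F FF _ (fun x : R => x ^+ m) _ _ (qP u)).
  exact: exprn_continuous.
have mF : bern_moment n m @[n --> F] --> gamma m.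
  by move=> A Am; apply: ooF; exact: bern_moment_cvg Am.
(* Both gamma m and the integral of q ^+ m lie between these two sums, whose
   distance is at most gamma 0 / N.+1. *)
pose low N := \sum_(j < N.+1) q (j%:R * (gamma 0%N / N.+1%:R)) ^+ m * (gamma 0%N / N.+1%:R).
pose up N := \sum_(j < N.+1) q (j.+1%:R * (gamma 0%N / N.+1%:R)) ^+ m * (gamma 0%N / N.+1%:R).
have sumF N (p : nat -> R) (w : R) :
    \sum_(j < N) quantile n (p j) ^+ m * w @[n --> F] -->
    \sum_(j < N) q (p j) ^+ m * w.
  elim: N => [|N IHN].
    by rewrite big_ord0; under eq_fun do rewrite big_ord0; exact: cvg_cst.
  rewrite big_ord_recr/=; under eq_fun do rewrite big_ord_recr/=.
  by apply: cvgD => //; apply: cvgM; [exact: powF|exact: cvg_cst].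
have gamma_in N : low N <= gamma m <= up N.
  apply/andP; split.
    apply: (ler_cvg_to (sumF N.+1 (fun j => j%:R * (gamma 0%N / N.+1%:R)) _) mF).
    apply: nearW => n; rewrite -lee_fin -quantile_integral.
    have [] := andP (@riemann_sum_bracket R (fun u => quantile n u ^+ m)
      (gamma 0%N) N g0 _ _) => //.
      by apply: pow_mono => [|u]; [exact: quantile_mono|exact: quantile01].
    by move=> u; have /andP[] := pow01 _ (quantile01 n) u.
  apply: (ler_cvg_to mF (sumF N.+1 (fun j => j.+1%:R * (gamma 0%N / N.+1%:R)) _)).
  apply: nearW => n; rewrite -lee_fin -quantile_integral.
  have [] := andP (@riemann_sum_bracket R (fun u => quantile n u ^+ m)
      (gamma 0%N) N g0 _ _) => //.
    by apply: pow_mono => [|u]; [exact: quantile_mono|exact: quantile01].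
  by move=> u; have /andP[] := pow01 _ (quantile01 n) u.
have int_in N : ((low N)%:E <= \int[leb]_(u in `]0%R, gamma 0%N]) (q u ^+ m)%:E <= (up N)%:E)%E.
  apply: (@riemann_sum_bracket R (fun u => q u ^+ m)) => //; first exact: pow_mono.
  by move=> u; have /andP[] := pow01 _ q01 u.
have gap N : up N - low N <= gamma 0%N / N.+1%:R.
  by apply: (@riemann_sum_gap R (fun u => q u ^+ m)) => //; exact: pow01.
have [I IE] : exists I, (\int[leb]_(u in `]0%R, gamma 0%N]) (q u ^+ m)%:E = I%:E)%E.
  have := int_in 0%N; case: integral => [I| |] //=; first by exists I.
  by move=> /andP[].
rewrite IE; congr (_%:E).
have {}int_in N : low N <= I <= up N by have := int_in N; rewrite IE !lee_fin.
have close N : `|I - gamma m| <= gamma 0%N / N.+1%:R.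
  have := gap N; have /andP[h1 h2] := gamma_in N; have /andP[h3 h4] := int_in N.
  move: h1 h2 h3 h4; move: (low N) (up N) (gamma 0%N / _) => x y g *.
  by rewrite ler_norml; apply/andP; split; lra.
apply/eqP; rewrite -subr_eq0 -normr_le0; apply/ler_addgt0Pr => e e0; rewrite add0r.
have g1 : 0 < gamma 0%N + 1 by rewrite ltr_wpDl.
have [N NP] := natSinv_small (divr_gt0 e0 g1).
apply: le_trans (close N) _; have := NP _ (leqnn N).
rewrite ltr_pdivlMr// => /ltW; apply: le_trans; rewrite mulrC.
by rewrite ler_wpM2l ?invr_ge0// lerDl.
Qed.

End hausdorff.

(** After scaling [0, B] to [0, 1] the measure is the image of Lebesgue measure on
    ]0, gamma 0] under the limit quantile function. *)
Theorem hausdorff_moment (R : realType) (gamma : nat -> R) (B : R) : 0 < B ->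
  (forall j k, 0 <= moment gamma ('X^j * (B%:P - 'X) ^+ k)) ->
  exists nu : {measure set (measurableTypeR R) -> \bar R}, forall n,
    (\int[nu]_(t in `[0%R, +oo[) (t ^+ n)%:E = (gamma n)%:E)%E.
Proof.
move=> B0 pos.
pose c n := gamma n / B ^+ n.
have cpos j k : 0 <= moment c ('X^j * (1 - 'X) ^+ k).
  have mc (p : {poly R}) : moment c p = moment gamma (p \Po (B^-1 *: 'X)).
    rewrite [moment c p]/moment comp_polyE moment_sum; apply: eq_bigr => i _.
    by rewrite momentZ exprZn momentZ momentXn /c exprVn [gamma i / _]mulrC.
  have -> : moment c ('X^j * (1 - 'X) ^+ k) =
      B^-1 ^+ (j + k) * moment gamma ('X^j * (B%:P - 'X) ^+ k).
    have E : B^-1 *: (B%:P - 'X) = 1 - B^-1 *: 'X.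
      by rewrite scalerBr -mul_polyC -polyCM mulVf ?gt_eqF.
    rewrite mc -momentZ; congr moment.
    rewrite comp_polyM !rmorphXn/= comp_polyB comp_polyX -[1]/(1%:P) comp_polyC.
    by rewrite -E !exprZn -scalerAl -scalerAr scalerA exprD.
  by rewrite mulr_ge0// exprn_ge0// invr_ge0 ltW.
have [q [q_mono q01 q_int]] := limit_quantile cpos.
have c0E : c 0%N = gamma 0%N by rewrite /c expr0 divr1.
pose D : set R := `]0%R, gamma 0%N]%classic.
(* The value -1 puts the mass coming from outside D off the half-line on which the
   moments are computed. *)
pose psi (u : R) : measurableTypeR R := if u \in D then B * q u else - 1.
have mq : measurable_fun setT q by exact: nondecreasing_measurable.
have mD : measurable D by exact: measurable_itv.
have mpsi : measurable_fun [set: measurableTypeR R] psi.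
  apply: measurable_fun_ifT.
  - apply: (measurable_fun_bool true); rewrite setTI [X in measurable X](_ : _ = D)//.
    by apply/seteqP; split=> u; [exact: set_mem|exact: mem_set].
  - by apply: measurable_funM => //; exact: measurable_cst.
  - exact: measurable_cst.
exists (pushforward (@lebesgue_measure R) psi) => n.
rewrite ge0_integral_pushforward//=; last 2 first.
- by apply/measurable_EFinP; exact: measurable_funTS.
- by move=> t; rewrite inE/= in_itv/= andbT => t0; rewrite lee_fin exprn_ge0.
have -> : psi @^-1` `[0, +oo[%classic = D.
  apply/seteqP; split=> u /=; rewrite in_itv/= andbT /psi.
    by case: ifPn => [/set_mem//|_]; rewrite lerNr oppr0 ler10.
  by move=> Du; rewrite mem_set// mulr_ge0 ?(ltW B0)//; have /andP[] := q01 u.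
have -> : gamma n = B ^+ n * c n by rewrite /c mulrC divfK// expf_neq0// gt_eqF.
rewrite EFinM -q_int c0E -ge0_integralZl//; last 3 first.
- by apply/measurable_EFinP; apply: measurable_funTS; exact: measurable_funX.
- by move=> u _; rewrite lee_fin exprn_ge0//; have /andP[] := q01 u.
- by rewrite lee_fin exprn_ge0// ltW.
by apply: eq_integral => u; rewrite inE => Du; rewrite /psi mem_set// exprMn EFinM.
Unshelve. exact: mpsi.
Qed.

(** * Squared norms along an orbit *)

Section halmos_moments.
Context {R : realType} {H : hilbertType R} (S : H -> H).
Hypothesis SZD : forall c x y, S (c *: x + y) = c *: S x + S y.
Variable B : R.
Hypothesis B_gt0 : 0 < B.
Hypothesis S_le : forall x, sqn hsip (S x) <= B * sqn hsip x.
Hypothesis Spos : halmos_positive S.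
Local Notation ip := (@hsip R H).
Local Notation s := (halmos_sip SZD Spos).

Definition orbit_sqn f n : R := sqn ip (iter n S f).

Lemma orbit_comb_finite (p : {poly R}) f :
  finitely_supported (fun k => (p`_k)%:C *: iter k S f).
Proof. by exists (size p) => k h; rewrite nth_default// scale0r. Qed.

(** The vector p(N^* N) f, since sum_k p_k (N^* N)^k f = sum_k N^*^k (p_k S^k f). *)
Definition orbit_comb p f : finseq H := mk_finseq (orbit_comb_finite p f).

Lemma iterSZ n c x : iter n S (c *: x) = c *: iter n S x.
Proof. by have := iterZD SZD n c x 0; rewrite !addr0 (iter0 SZD) addr0. Qed.

Lemma sqn_orbit_comb p f : sqn s (orbit_comb p f) = moment (orbit_sqn f) (p * p).
Proof.
have h k : (size p <= k)%N -> orbit_comb p f k = 0.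
  by move=> pk /=; rewrite nth_default// scale0r.
rewrite /sqn -[s _ _]/(halmos_form _ _ _) (halmos_formE SZD h h) /halmos_sum Re_sum.
rewrite -[X in moment _ (X * _)]coefK -[X in moment _ (_ * X)]coefK poly_def.
rewrite mulr_suml moment_sum; apply: eq_bigr => m _.
rewrite mulr_sumr moment_sum Re_sum; apply: eq_bigr => n _.
rewrite -scalerAl -scalerAr -exprD !momentZ momentXn.
rewrite -[orbit_comb p f m]/(_ *: _) -[orbit_comb p f n]/(_ *: _).
rewrite !iterSZ sipZl sipZr -!iterD [(n + m)%N]addnC sipxx.
by rewrite !(ReM, ImM)/= oppr0 !(mul0r, mulr0, subr0).
Qed.

Lemma applyS_orbit_comb p f : applyS SZD (orbit_comb p f) = orbit_comb p (S f).
Proof.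
apply: finseq_ext => k /=; rewrite -[LHS]/(iter 1 S _) iterSZ.
by rewrite -iterSr.
Qed.

Lemma orbit_sqnS f : orbit_sqn (S f) = fun n => orbit_sqn f (n + 1).
Proof. by apply/funext => n; rewrite /orbit_sqn addn1 iterSr. Qed.

Lemma moment_sqr_ge0 f p : 0 <= moment (orbit_sqn f) (p * p).
Proof. by rewrite -sqn_orbit_comb; exact: sqn_ge0. Qed.

(** The norm of N does not exceed that of S, in squared form. *)
Lemma moment_sqr_le f p :
  0 <= moment (orbit_sqn f) ((B%:P - 'X) * (p * p)).
Proof.
have := applyS_sqn_le SZD (ltW B_gt0) S_le Spos (orbit_comb p f).
rewrite applyS_orbit_comb !sqn_orbit_comb orbit_sqnS -momentMXn.
rewrite mulrBl momentB mul_polyC momentZ subr_ge0.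
by rewrite ['X * _]mulrC.
Qed.

(** Even powers are collected into a square. A remaining factor B - X is covered by
    moment_sqr_le, and a remaining factor X replaces f by S f. *)
Lemma moment_box_ge0 f j k : 0 <= moment (orbit_sqn f) ('X^j * (B%:P - 'X) ^+ k).
Proof.
have step g : 0 <= moment (orbit_sqn g) ('X^(j./2.*2) * (B%:P - 'X) ^+ k).
  pose p : {poly R} := 'X^(j./2) * (B%:P - 'X) ^+ k./2.
  have -> : 'X^(j./2.*2) * (B%:P - 'X) ^+ k = (B%:P - 'X) ^+ odd k * (p * p).
    rewrite -[in LHS](odd_double_half k) /p -!addnn !exprD.
    set x := 'X^(j./2); set y := (B%:P - 'X) ^+ k./2.
    by rewrite [LHS]mulrCA [x * y * _]mulrACA.
  case: (odd k); first by rewrite expr1; exact: moment_sqr_le.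
  by rewrite expr0 mul1r; exact: moment_sqr_ge0.
rewrite -(odd_double_half j); case: (odd j); last by rewrite add0n.
rewrite add1n exprSr mulrAC -[X in _ * X]expr1 momentMXn -orbit_sqnS.
exact: step.
Qed.

(** For a subnormal S with normal extension N the measure is the distribution of
    N^* N in the state f. *)
Theorem halmos_moment_measure f :
  exists nu : {measure set (measurableTypeR R) -> \bar R}, forall n,
    (\int[nu]_(t in `[0%R, +oo[) (t ^+ n)%:E = (sqn ip (iter n S f))%:E)%E.
Proof. by apply: (hausdorff_moment B_gt0) => j k; exact: moment_box_ge0. Qed.

End halmos_moments.

(** * Measures with moments of geometric growth *)

Section real_integrals.
Context d (T : measurableType d) (R : realType) (nu : {measure set T -> \bar R}).
Variables (D : set T) (mD : measurable D).

Lemma Rintegral_sum n (f : nat -> T -> R) :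
  (forall i, nu.-integrable D (EFin \o f i)) ->
  \int[nu]_(x in D) (\sum_(i < n) f i x) = \sum_(i < n) \int[nu]_(x in D) f i x.
Proof.
move=> fi; rewrite /Rintegral.
under eq_integral do rewrite -sumEFin.
rewrite (integral_sum mD (f := fun (i : 'I_n) x => (f i x)%:E)); last first.
  by move=> i; exact: fi.
rewrite (eq_bigr (fun i : 'I_n => (\int[nu]_(x in D) f i x)%:E)) ?sumEFin//.
by move=> i _; rewrite /Rintegral fineK//; exact: integrable_fin_num (fi i).
Qed.

Lemma integrable_sumR n (f : nat -> T -> R) :
  (forall i, nu.-integrable D (EFin \o f i)) ->
  nu.-integrable D (EFin \o (fun x => \sum_(i < n) f i x)).
Proof.
move=> fi; have := @integrable_sum _ _ _ nu D mD _ (index_enum 'I_n) xpredT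
  (fun (i : 'I_n) x => (f i x)%:E) (fun i _ => fi i).
apply: eq_integrable => // x _ /=.
by rewrite sumEFin.
Qed.

End real_integrals.

Section compactly_supported_moments.
Context {R : realType} (nu : {measure set (measurableTypeR R) -> \bar R}).
Variables (c : nat -> R) (C B M : R).
Hypotheses (B_ge0 : 0 <= B) (BM : B < M).
Hypothesis nu_c : forall n,
  (\int[nu]_(t in `[0%R, +oo[) (t ^+ n)%:E = (c n)%:E)%E.
Hypothesis c_le : forall n, c n <= C * B ^+ n.
Let D : set (measurableTypeR R) := `[0%R, +oo[%classic.
Let A : set (measurableTypeR R) := `[M, +oo[%classic.

Let mD : measurable D. Proof. exact: measurable_itv. Qed.
Let mA : measurable A. Proof. exact: measurable_itv. Qed.
Let M_gt0 : 0 < M. Proof. exact: le_lt_trans BM. Qed.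

(** The mass beyond M contributes at least M ^ n times itself to the n-th moment, which
    grows only like B ^ n. *)
Lemma moment_measure_tail : nu A = 0%E.
Proof.
have AM n : ((M ^+ n)%:E * nu A <= (c n)%:E)%E.
  rewrite -nu_c -integral_cst//.
  apply: (@le_trans _ _ (\int[nu]_(t in A) (t ^+ n)%:E)%E).
    apply: ge0_le_integral => //=.
    - by move=> t _; rewrite lee_fin exprn_ge0// ltW.
    - by apply/measurable_EFinP; apply: measurable_funTS; exact: measurable_funX.
    - move=> t; rewrite /A/= in_itv/= andbT => Mt.
      by rewrite lee_fin lerXn2r ?nnegrE ?(le_trans _ Mt)// ltW.
  apply: ge0_subset_integral => //=.
  - by apply/measurable_EFinP; apply: measurable_funTS; exact: measurable_funX.
  - by move=> t; rewrite /D/= in_itv/= andbT => t0; rewrite lee_fin exprn_ge0.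
  - by move=> t; rewrite /A /D /= !in_itv/= !andbT; apply: le_trans; exact: ltW.
have [v vE] : exists v, nu A = v%:E.
  have A0 : (0 <= nu A)%E by exact: measure_ge0.
  move: A0 (AM 0%N); rewrite expr0 mul1e.
  by case: (nu A) => [v _ _|_|]; [exists v|rewrite leye_eq|rewrite leeNy_eq].
have v0 : 0 <= v by rewrite -lee_fin -vE.
have vle n : v <= C * (B / M) ^+ n.
  have := AM n; rewrite vE -EFinM lee_fin => h.
  rewrite expr_div_n mulrA ler_pdivlMr ?exprn_gt0// mulrC.
  exact: le_trans h (c_le n).
rewrite vE; congr (_%:E); apply/eqP; rewrite eq_le v0 andbT.
have lim0 : C * (B / M) ^+ n @[n --> \oo] --> C * 0.
  apply: cvgM; first exact: cvg_cst.
  apply: cvg_expr; rewrite ger0_norm ?divr_ge0// ?ltW//.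
  by rewrite ltr_pdivrMr// mul1r.
rewrite -(mulr0 C); apply: (ler_cvg_to (cvg_cst (v : R)) lim0).
exact: nearW.
Qed.

(** All the mass lies in [0, M[, where p is nonnegative. *)
Lemma moment_ge0_of_measure (p : {poly R}) :
  (forall t, 0 <= t <= M -> 0 <= p.[t]) -> 0 <= moment c p.
Proof.
move=> p0.
have ti n : nu.-integrable D (EFin \o (fun t : R => t ^+ n)).
  apply/integrableP; split.
    by apply/measurable_EFinP; apply: measurable_funTS; exact: measurable_funX.
  apply: le_lt_trans (ltry (c n)); rewrite -nu_c le_eqVlt; apply/orP; left.
  apply/eqP; apply: eq_integral => t; rewrite inE /D/= in_itv/= andbT => t0.
  by rewrite ger0_norm// exprn_ge0.
have pE : moment c p = \int[nu]_(t in D) p.[t].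
  have -> : \int[nu]_(t in D) p.[t] = \int[nu]_(t in D) \sum_(i < size p) p`_i * t ^+ i.
    by apply: eq_Rintegral => t _; rewrite horner_coef.
  rewrite (@Rintegral_sum _ _ _ nu D mD _ (fun i t => p`_i * t ^+ i)).
    apply: eq_bigr => i _; rewrite RintegralZl//.
    by rewrite /Rintegral nu_c.
  by move=> i; exact: (integrableZl _ _ (ti i)).
have pi : nu.-integrable D (EFin \o (fun t => p.[t])).
  have := @integrable_sumR _ _ _ nu D mD (size p) (fun i t => p`_i * t ^+ i)
    (fun i => integrableZl mD p`_i (ti i)).
  by apply: eq_integrable => // t _ /=; rewrite horner_coef.
pose D' : set (measurableTypeR R) := `[0%R, M[%classic.
have mD' : measurable D' by exact: measurable_itv.
have DE : D = D' `|` A.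
  apply/seteqP; split=> t; rewrite /D /A /D' /= !in_itv/= !andbT.
    by move=> t0; case: (ltP t M) => h; [left; rewrite t0|right].
  by move=> [/andP[]//|h]; apply: le_trans h; exact: ltW.
rewrite pE DE Rintegral_setU//; last 2 first.
- by rewrite -DE.
- apply/disj_setPS => t [/=]; rewrite /A /D' /= !in_itv/= andbT => /andP[_ h1] h2.
  by have := le_lt_trans h2 h1; rewrite ltxx.
rewrite [X in _ + X](_ : _ = 0) ?addr0.
  apply: Rintegral_ge0 => t; rewrite /D'/= in_itv/= => /andP[t0 tM].
  by apply: p0; rewrite t0 ltW.
rewrite /Rintegral null_set_integral//; last exact: moment_measure_tail.
have /integrableP[+ _] := pi.
by apply: measurable_funS => //; rewrite DE; exact: subsetUr.
Qed.

End compactly_supported_moments.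

(** * Integration on countable discrete spaces *)

Section discrete_integrals.
Context {R : realType} {T : pointedType} (mu : discreteMeasure R T).
Hypothesis Tcount : countable [set: T].
Implicit Types (nu : {measure set (discrete_space T) -> \bar R}).

Lemma integral_point nu (f : discrete_space T -> \bar R) x :
  (\int[nu]_(y in [set x]) f y = f x * nu [set x])%E.
Proof.
rewrite -(integral_cst nu (D := [set x]))//.
by apply: eq_integral => y; rewrite inE => ->.
Qed.

(** The space is a countable disjoint union of points. *)
Lemma integral_density nu (w : T -> R) : (forall x, 0 <= w x) ->
  (forall x, nu [set x] = (w x)%:E * mu [set x])%E ->
  forall f : discrete_space T -> \bar R, (forall x, 0 <= f x)%E ->
  (\int[nu]_x f x = \int[mu]_x (f x * (w x)%:E))%E.
Proof.
move=> w0 nuE f f0.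
have /countable_injP[code code_inj] := Tcount.
pose F n : set (discrete_space T) := [set x | code x = n].
have FT : [set: discrete_space T] = \bigcup_n F n.
  by apply/seteqP; split=> // x _; exists (code x).
have tF : trivIset [set: nat] F.
  by move=> i j _ _ [x [/= <- <-]].
rewrite FT !ge0_integral_bigcup//; last first.
  by move=> x _; rewrite mule_ge0// lee_fin.
apply: eq_eseriesr => n _.
have [->|/set0P[x Fx]] := eqVneq (F n) set0; first by rewrite !integral_set0.
have -> : F n = [set x].
  apply/seteqP; split=> [y Fy|y ->//].
  by apply: code_inj; rewrite ?inE// [LHS]Fy Fx.
by rewrite !integral_point nuE muleA.
Qed.

End discrete_integrals.

(** * Local moment functionals of a self-map *)

Section composition_positivity.
Context {R : realType} {T : pointedType} (mu : discreteMeasure R T) (phi : T -> T).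
Hypothesis Tcount : countable [set: T].
Variable M : R.
Hypothesis M_gt0 : 0 < M.

Definition fibre_mass n x : R := fine (mu (iter n phi @^-1` [set x])).
(** The function h of the n-th iterate of phi. *)
Definition weight n x : R := fibre_mass n x / fine (mu [set x]).

Hypothesis fibre_le : forall n x,
  (mu (iter n phi @^-1` [set x]) <= (M ^+ n)%:E * mu [set x])%E.

Lemma mass_gt0 x : 0 < fine (mu [set x]).
Proof. by rewrite fine_gt0// dmeasure_gt0 dmeasure_lty. Qed.

Lemma massE x : mu [set x] = (fine (mu [set x]))%:E.
Proof. by rewrite fineK// ge0_fin_numE// dmeasure_lty. Qed.

Lemma fibre_massE n x : mu (iter n phi @^-1` [set x]) = (fibre_mass n x)%:E.
Proof.
rewrite /fibre_mass fineK// ge0_fin_numE//; apply: le_lt_trans (fibre_le n x) _.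
by rewrite massE -EFinM ltry.
Qed.

Lemma weight_ge0 n x : 0 <= weight n x.
Proof. by rewrite divr_ge0// fine_ge0. Qed.

Lemma weight_mass n x : weight n x * fine (mu [set x]) = fibre_mass n x.
Proof. by rewrite divfK// gt_eqF// mass_gt0. Qed.

Lemma weight0 x : weight 0 x = 1.
Proof.
by rewrite /weight/fibre_mass/= divff// gt_eqF// mass_gt0.
Qed.

Lemma weight_le n x : weight n x <= M ^+ n.
Proof.
rewrite ler_pdivrMr ?mass_gt0//.
by rewrite -lee_fin EFinM -fibre_massE -massE fibre_le.
Qed.

Lemma ge0_change_of_variables n (f : discrete_space T -> \bar R) :
  (forall x, 0 <= f x)%E ->
  (\int[mu]_x f (iter n phi x) = \int[mu]_x (f x * (weight n x)%:E))%E.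
Proof.
move=> f0.
have mphi : measurable_fun [set: discrete_space T]
  (iter n phi : discrete_space T -> discrete_space T) by [].
transitivity (\int[pushforward mu (iter n phi : discrete_space T -> discrete_space T)]_x f x)%E.
  by rewrite [RHS]ge0_integral_pushforward// => x _; exact: f0.
apply: (integral_density Tcount); [exact: weight_ge0| |exact: f0].
move=> x; rewrite /= /pushforward fibre_massE massE -EFinM.
by rewrite weight_mass.
Unshelve. all: exact: mphi.
Qed.

Lemma change_of_variables n (f : T -> R) :
  \int[mu]_x f (iter n phi x) = \int[mu]_x (f x * weight n x).
Proof.
rewrite /Rintegral; congr fine; rewrite integralE [RHS]integralE.
congr (_ - _)%E.
  transitivity (\int[mu]_x (maxe (f (iter n phi x))%:E 0))%E.
    by apply: eq_integral => x _; rewrite ?funeposE ?funenegE.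
  rewrite (ge0_change_of_variables n (f := fun x => maxe (f x)%:E 0%E)); last first.
    by move=> x; rewrite le_max lexx orbT.
  apply: eq_integral => x _.
  by rewrite funeposE EFinM maxe_pMl ?lee_fin ?weight_ge0// mul0e.
transitivity (\int[mu]_x (maxe (- (f (iter n phi x))%:E) 0))%E.
    by apply: eq_integral => x _; rewrite ?funeposE ?funenegE.
rewrite (ge0_change_of_variables n (f := fun x => (maxe (- (f x)%:E) 0)%E)); last first.
  by move=> x; rewrite le_max lexx orbT.
apply: eq_integral => x _.
by rewrite funenegE /= -mulNr EFinM maxe_pMl ?lee_fin ?weight_ge0// mul0e.
Qed.

Local Notation Int f := (mu.-integrable [set: discrete_space T] (EFin \o (f : T -> R))).

Lemma IntP (f g : T -> R) : (forall x, `|f x| <= `|g x|) -> Int g -> Int f.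
Proof. by move=> fg; apply: le_integrable => // x _; rewrite lee_fin. Qed.

Lemma Int_iter n f : Int f -> Int (fun x => f (iter n phi x)).
Proof.
move=> /integrableP[_ fi]; apply/integrableP; split=> //.
rewrite (ge0_change_of_variables n (f := fun x => `|(f x)%:E|%E))//.
apply: (@le_lt_trans _ _ (\int[mu]_x ((M ^+ n)%:E * `|(f x)%:E|))%E).
  apply: ge0_le_integral => //=.
  - by move=> x _; rewrite lee_fin mulr_ge0 ?weight_ge0.
  - by move=> x _; rewrite lee_fin mulrC ler_wpM2r ?weight_le.
rewrite ge0_integralZl//; last by rewrite lee_fin exprn_ge0// ltW.
by rewrite lte_mul_pinfty// lee_fin exprn_ge0// ltW.
Qed.

Lemma Int_mul_weight n f : Int f -> Int (fun x => f x * weight n x).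
Proof.
move=> fi; have := integrableZr_fin (M ^+ n) fi; apply: IntP => x.
rewrite normrM [leRHS]normrM [leRHS]mulrC ler_wpM2l// (ger0_norm (weight_ge0 _ _)).
by rewrite (ger0_norm (exprn_ge0 _ (ltW M_gt0))) weight_le.
Qed.

(** Integration against the measure that the weights at x represent. *)
Definition local_moment x p : R := moment (weight^~ x) p.

Lemma Int_mul_moment f p : Int f -> Int (fun x => f x * local_moment x p).
Proof.
move=> fi; have := @integrable_sumR _ _ _ mu _ measurableT (size p)
  (fun i x => p`_i * (f x * weight i x))
  (fun i => integrableZr_fin p`_i (Int_mul_weight i fi)).
apply: IntP => x; rewrite mulr_sumr le_eqVlt; apply/orP; left; apply/eqP.
by congr `|_|; apply: eq_bigr => i _; rewrite mulrCA.
Qed.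

Lemma integral_moment f p : Int f ->
  \int[mu]_x (f x * local_moment x p) =
  moment (fun k => \int[mu]_x f (iter k phi x)) p.
Proof.
move=> fi.
transitivity (\int[mu]_x (\sum_(i < size p) p`_i * (f x * weight i x))).
  apply: eq_Rintegral => x _; rewrite mulr_sumr.
  by apply: eq_bigr => i _; rewrite mulrCA.
rewrite (@Rintegral_sum _ _ _ mu _ measurableT _ (fun i x => p`_i * (f x * weight i x))).
  apply: eq_bigr => i _; rewrite RintegralZl//; last exact: Int_mul_weight.
  by rewrite change_of_variables.
by move=> i; exact: integrableZr_fin (Int_mul_weight i fi).
Qed.

Hypothesis local_pos : forall x p, (forall t, 0 <= t <= M -> 0 <= p.[t]) ->
  0 <= local_moment x p.

Lemma local_moment_le x p q : (forall t, 0 <= t <= M -> p.[t] <= q.[t]) ->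
  local_moment x p <= local_moment x q.
Proof.
move=> pq; rewrite -subr_ge0 -momentB; apply: local_pos => t t0.
by rewrite !hornerE subr_ge0 pq.
Qed.

Lemma local_momentC x (c : R) : local_moment x c%:P = c.
Proof.
by rewrite -[c%:P]mulr1 mul_polyC -(expr0 'X) /local_moment momentZ momentXn weight0 mulr1.
Qed.

Lemma fibre_massS x n :
  fibre_mass n.+1 x = \int[mu]_z (\1_(phi @^-1` [set x]) (iter n phi z)).
Proof.
rewrite /fibre_mass /Rintegral; congr fine.
transitivity (\int[mu]_z (\1_(iter n.+1 phi @^-1` [set x]) z)%:E)%E.
  by rewrite integral_indic// setIT.
by apply: eq_integral => z _; rewrite /= !indicE.
Qed.

Lemma Int_fibre x : Int (\1_(phi @^-1` [set x]) : T -> R).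
Proof.
apply/integrableP; split=> //.
have -> : (\int[mu]_z `|(EFin \o (\1_(phi @^-1` [set x]) : T -> R)) z| =
    mu (phi @^-1` [set x]))%E.
  transitivity (\int[mu]_z (\1_(phi @^-1` [set x]) z)%:E)%E.
    by apply: eq_integral => z _ /=; rewrite ger0_norm.
  by rewrite integral_indic// setIT.
by have := fibre_massE 1 x => /= ->; rewrite ltry.
Qed.

(** The measures represented at the points z with phi z = x, weighted by the masses
    of z, add up to t times the measure represented at x; the left-hand side is one of
    these nonnegative contributions. *)
Lemma local_moment_fibre y p : (forall t, 0 <= t <= M -> 0 <= p.[t]) ->
  fine (mu [set y]) * local_moment y p <=
  fine (mu [set phi y]) * local_moment (phi y) (p * 'X).
Proof.
move=> p0; set x := phi y.
have -> : fine (mu [set x]) * local_moment x (p * 'X) =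
    \int[mu]_z (\1_(phi @^-1` [set x]) z * local_moment z p).
  rewrite integral_moment; last exact: Int_fibre.
  rewrite -moment_scale -['X]expr1 momentMXn; congr moment; apply/funext => n.
  by rewrite mulrC weight_mass addn1 fibre_massS.
have -> : fine (mu [set y]) * local_moment y p =
    \int[mu]_(z in [set y]) local_moment z p.
  by rewrite /Rintegral integral_point massE /= mulrC.
rewrite [leLHS]Rintegral_mkcond; apply: le_Rintegral => //.
- have := Int_mul_moment p (Int_fibre x); apply: IntP => z.
  rewrite /= patchE; case: ifPn => [/set_mem ->|_]; last by rewrite normr0.
  by rewrite indicE mem_set// mul1r.
- exact: Int_mul_moment (Int_fibre x).
- move=> z _; rewrite /= patchE; case: ifPn => [/set_mem ->|_].
    by rewrite indicE mem_set// mul1r.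
  by rewrite mulr_ge0// local_pos.
Qed.

(** For y = t / M the terms y (1 - y) ^ j decrease in j and telescope to a sum at
    most 1. *)
Lemma bump_le k (t : R) : 0 <= t <= M ->
  0 <= t * (1 - M^-1 * t) ^+ k <= M / k.+1%:R.
Proof.
move=> /andP[t0 tM]; set y := M^-1 * t.
have y0 : 0 <= y by rewrite mulr_ge0// invr_ge0 ltW.
have y1 : y <= 1 by rewrite /y mulrC ler_pdivrMr// mul1r.
have z0 : 0 <= 1 - y by rewrite subr_ge0.
have -> : t = M * y by rewrite /y mulVKf// gt_eqF.
apply/andP; split; first exact: mulr_ge0 (mulr_ge0 (ltW M_gt0) y0) (exprn_ge0 _ z0).
rewrite -mulrA ler_pM2l// -[leRHS]mul1r ler_pdivlMr ?ltr0n//.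
apply: (@le_trans _ _ (y * \sum_(j < k.+1) (1 - y) ^+ j)).
  rewrite -mulrA ler_wpM2l// mulr_natr.
  rewrite -[X in _ *+ X](card_ord k.+1) -sumr_const; apply: ler_sum => j _.
  by rewrite ler_wiXn2l// ?gerBl// -ltnS.
have -> : y * \sum_(j < k.+1) (1 - y) ^+ j = 1 - (1 - y) ^+ k.+1.
  by rewrite -[RHS]opprB subrX1; ring.
by rewrite gerBl exprn_ge0.
Qed.

(** On [0, M] these polynomials decrease to the indicator function of 0. *)
Definition decay k : {poly R} := (1 - M^-1 *: 'X) ^+ k.

Lemma horner_decay k t : (decay k).[t] = (1 - M^-1 * t) ^+ k.
Proof. by rewrite /decay !hornerE. Qed.

Lemma decay01 k t : 0 <= t <= M -> 0 <= (decay k).[t] <= 1.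
Proof.
move=> /andP[t0 tM]; rewrite horner_decay.
have y0 : 0 <= M^-1 * t by rewrite mulr_ge0// invr_ge0 ltW.
have y1 : M^-1 * t <= 1 by rewrite mulrC ler_pdivrMr// mul1r.
by rewrite exprn_ge0 ?subr_ge0//= exprn_ile1 ?subr_ge0// gerBl.
Qed.

(** The measure represented at y has no atom at 0: it is bounded by a multiple of
    t times the measure represented at phi y. *)
Lemma local_moment_decay y : exists C, forall k,
  0 <= local_moment y (decay k) <= C / k.+1%:R.
Proof.
have m0 := mass_gt0 y.
exists (fine (mu [set phi y]) * M / fine (mu [set y])) => k; apply/andP; split.
  by apply: local_pos => t /(decay01 k)/andP[].
rewrite mulrAC ler_pdivlMr// mulrC.
apply: (@le_trans _ _ (fine (mu [set phi y]) * local_moment (phi y) (decay k * 'X))).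
  by apply: local_moment_fibre => t /(decay01 k)/andP[].
rewrite -mulrA ler_wpM2l ?fine_ge0// -(local_momentC (phi y) (M / k.+1%:R)).
apply: local_moment_le => t /(bump_le k)/andP[_].
by rewrite hornerC hornerM hornerX horner_decay mulrC.
Qed.

(** * The Halmos condition for composition operators *)

Section families.
Variables (d : nat) (a : nat -> T -> R).
Hypothesis a_sqr : forall m, Int (fun x => a m x ^+ 2).

Lemma Int_iter_prod m n j k :
  Int (fun x => a m (iter j phi x) * a n (iter k phi x)).
Proof.
have := integrableD_fin (Int_iter j (a_sqr m)) (Int_iter k (a_sqr n)).
apply: IntP => x; set u := a m _; set v := a n _.
rewrite [leRHS]ger0_norm ?addr_ge0 ?sqr_ge0// ler_norml; apply/andP; split.
  have := sqr_ge0 (u + v); have := sqr_ge0 u; have := sqr_ge0 v; lra.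
have := sqr_ge0 (u - v); have := sqr_ge0 u; have := sqr_ge0 v; lra.
Qed.

Definition halmos_density x : R :=
  \sum_(m < d) \sum_(n < d) a m (iter n phi x) * a n (iter m phi x).

Lemma Int_halmos_density : Int halmos_density.
Proof.
apply: (@integrable_sumR _ _ _ mu _ measurableT d (fun m x =>
  \sum_(n < d) a m (iter n phi x) * a n (iter m phi x))) => m.
apply: (@integrable_sumR _ _ _ mu _ measurableT d (fun n x =>
  a m (iter n phi x) * a n (iter m phi x))) => n.
exact: Int_iter_prod.
Qed.

Lemma integral_halmos_density : \int[mu]_x halmos_density x =
  \sum_(m < d) \sum_(n < d)
    \int[mu]_x (a m (iter n phi x) * a n (iter m phi x)).
Proof.
rewrite (@Rintegral_sum _ _ _ mu _ measurableT d (fun m x =>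
  \sum_(n < d) a m (iter n phi x) * a n (iter m phi x))); last first.
  move=> m; apply: (@integrable_sumR _ _ _ mu _ measurableT d (fun n x =>
    a m (iter n phi x) * a n (iter m phi x))) => n.
  exact: Int_iter_prod.
apply: eq_bigr => m _.
rewrite (@Rintegral_sum _ _ _ mu _ measurableT d (fun n x =>
  a m (iter n phi x) * a n (iter m phi x)))// => n.
exact: Int_iter_prod.
Qed.

(* chosen so that composing G m n with the iterate of order k + (m + n) gives the
   term of index (m, n) composed with the iterate of order k + (d + d) *)
Let G m n x : R := a m (iter (d + d - m) phi x) * a n (iter (d + d - n) phi x).

Let GI m n : Int (G m n). Proof. exact: Int_iter_prod. Qed.

Lemma integral_halmos_shift k :
  \int[mu]_x halmos_density (iter (k + (d + d)) phi x) =
  \sum_(m < d) \sum_(n < d) \int[mu]_x G m n (iter (k + (m + n)) phi x).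
Proof.
rewrite /halmos_density.
rewrite (@Rintegral_sum _ _ _ mu _ measurableT d (fun m x => \sum_(n < d)
  a m (iter n phi (iter (k + (d + d)) phi x)) *
  a n (iter m phi (iter (k + (d + d)) phi x)))); last first.
  move=> m; apply: (@integrable_sumR _ _ _ mu _ measurableT d (fun n x =>
    a m (iter n phi (iter (k + (d + d)) phi x)) *
    a n (iter m phi (iter (k + (d + d)) phi x)))) => n.
  exact: (Int_iter _ (Int_iter_prod m n n m)).
apply: eq_bigr => m _.
rewrite (@Rintegral_sum _ _ _ mu _ measurableT d (fun n x =>
  a m (iter n phi (iter (k + (d + d)) phi x)) *
  a n (iter m phi (iter (k + (d + d)) phi x)))); last first.
  by move=> n; exact: (Int_iter _ (Int_iter_prod m n n m)).
apply: eq_bigr => n _; apply: eq_Rintegral => x _; rewrite /G -!iterD.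
have md : (m <= d + d)%N by rewrite (leq_trans (ltnW (ltn_ord m)))// leq_addr.
have nd : (n <= d + d)%N by rewrite (leq_trans (ltnW (ltn_ord n)))// leq_addr.
have -> : (d + d - m + (k + (m + n)) = n + (k + (d + d)))%N.
  by lia.
have -> : (d + d - n + (k + (m + n)) = m + (k + (d + d)))%N.
  by lia.
by [].
Qed.

(** After multiplication by t ^ (2 d) the two factors of each term can be moved
    by the same power of phi, and a sum of squares appears. *)
Lemma halmos_density_sqr_ge0 q :
  0 <= \int[mu]_x (halmos_density x * local_moment x (q * q * 'X^(d + d))).
Proof.
rewrite (integral_moment _ Int_halmos_density) momentMXn.
under [X in moment X _]eq_fun do rewrite integral_halmos_shift.
rewrite (moment_sum_seq d (fun m k => \sum_(n < d)
  \int[mu]_x G m n (iter (k + (m + n)) phi x))).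
have -> : \sum_(m < d) moment (fun k => \sum_(n < d)
      \int[mu]_x G m n (iter (k + (m + n)) phi x)) (q * q) =
    \int[mu]_x \sum_(m < d) \sum_(n < d)
      G m n x * local_moment x (q * q * 'X^(m + n)).
  rewrite (@Rintegral_sum _ _ _ mu _ measurableT d (fun m x => \sum_(n < d)
      G m n x * local_moment x (q * q * 'X^(m + n)))); last first.
    move=> m; apply: (@integrable_sumR _ _ _ mu _ measurableT d (fun n x =>
      G m n x * local_moment x (q * q * 'X^(m + n)))) => n.
    exact: Int_mul_moment.
  apply: eq_bigr => m _.
  rewrite (moment_sum_seq d (fun n k => \int[mu]_x G m n (iter (k + (m + n)) phi x))).
  rewrite (@Rintegral_sum _ _ _ mu _ measurableT d (fun n x =>
      G m n x * local_moment x (q * q * 'X^(m + n)))); last first.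
    by move=> n; exact: Int_mul_moment.
  by apply: eq_bigr => n _; rewrite integral_moment// momentMXn.
apply: Rintegral_ge0 => x _.
pose r : {poly R} := \sum_(m < d) (a m (iter (d + d - m) phi x)) *: 'X^m.
have -> : \sum_(m < d) \sum_(n < d) G m n x * local_moment x (q * q * 'X^(m + n)) =
    local_moment x (q * q * (r * r)).
  rewrite /r mulr_suml mulr_sumr /local_moment moment_sum; apply: eq_bigr => m _.
  rewrite mulr_sumr mulr_sumr moment_sum; apply: eq_bigr => n _.
  by rewrite -momentZ; congr moment; rewrite -!mul_polyC /G polyCM exprD; ring.
by apply: local_pos => t _; rewrite !hornerM; apply: mulr_ge0; rewrite -expr2 sqr_ge0.
Qed.

(** Tends to 1 on ]0, M] and is a square times 'X^(d + d). *)
Definition almost_one k : {poly R} := (1 - decay k) ^+ (d + d).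

Lemma almost_oneE k : exists q, almost_one k = q * q * 'X^(d + d).
Proof.
pose g : {poly R} := M^-1 *: \sum_(j < k) (1 - M^-1 *: 'X) ^+ j.
exists (g ^+ d).
have -> : almost_one k = (g * 'X) ^+ (d + d).
  congr (_ ^+ _); rewrite /decay -[LHS]opprB subrX1 /g.
  by rewrite -!mul_polyC; ring.
by rewrite exprMn exprD.
Qed.

Lemma horner_almost_one k t :
  (almost_one k).[t] = (1 - (decay k).[t]) ^+ (d + d).
Proof. by rewrite /almost_one horner_exp hornerD hornerN hornerC. Qed.

Lemma local_moment_almost_one x k : 0 <= local_moment x (almost_one k) <= 1 /\
  1 - local_moment x (almost_one k) <= (d + d)%:R * local_moment x (decay k).
Proof.
have h t : 0 <= t <= M -> 0 <= (almost_one k).[t] <= 1.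
  move=> /(decay01 k)/andP[c0 c1]; rewrite horner_almost_one.
  have z0 : 0 <= 1 - (decay k).[t] by lra.
  apply/andP; split; first exact: exprn_ge0.
  by apply: exprn_ile1; lra.
split.
  apply/andP; split; first by apply: local_pos => t /h/andP[].
  rewrite -[leRHS](local_momentC x); apply: local_moment_le => t /h/andP[_].
  by rewrite hornerC.
rewrite -momentZ -[X in X - _](local_momentC x) -momentB.
apply: local_moment_le => t /(decay01 k).
rewrite hornerD hornerN hornerC hornerZ horner_almost_one.
exact: bernoulli_le.
Qed.

(** Multiplication by t ^ (2 d) is undone in the limit because the local measures have
    no atom at 0. *)
Theorem halmos_density_ge0 : 0 <= \int[mu]_x halmos_density x.
Proof.
pose F k x := halmos_density x * local_moment x (almost_one k).
have F0 k : 0 <= \int[mu]_x F k x.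
  have [q qE] := almost_oneE k; rewrite /F qE; exact: halmos_density_sqr_ge0.
have lim1 x : local_moment x (almost_one k) @[k --> \oo] --> (1 : R).
  have [C CP] := local_moment_decay x.
  apply/cvgrPdist_le => e e0.
  pose D := (d + d)%:R * `|C| + 1.
  have D0 : 0 < D by rewrite ltr_wpDl// mulr_ge0.
  have [N NP] := natSinv_small (divr_gt0 e0 D0).
  exists N => // k /= Nk; have [/andP[l0 l1] l2] := local_moment_almost_one x k.
  rewrite ger0_norm ?subr_ge0//; apply: le_trans l2 _.
  have /andP[_ CPk] := CP k.
  apply: (@le_trans _ _ ((d + d)%:R * (`|C| / k.+1%:R))).
    rewrite ler_wpM2l//; apply: le_trans CPk _.
    by rewrite ler_wpM2r ?invr_ge0// ler_norm.
  have := NP _ Nk; rewrite ltr_pdivlMr// => /ltW; apply: le_trans.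
  by rewrite mulrA mulrC ler_wpM2l ?invr_ge0// lerDl.
have FE x : (F k x)%:E @[k --> \oo] --> (halmos_density x)%:E.
  apply: cvg_EFin; first exact: nearW.
  rewrite -[halmos_density x]mulr1; apply: cvgM; first exact: cvg_cst.
  exact: lim1.
have absI := integrable_abse Int_halmos_density.
have [|||||_ _ cvgF] := @dominated_convergence _ _ _ mu _ measurableT
    (fun k (x : discrete_space T) => (F k x)%:E) (EFin \o halmos_density)
    (abse \o (EFin \o halmos_density)).
- by [].
- by [].
- by apply: aeW => x _; exact: FE.
- exact: absI.
- apply: aeW => x k _; rewrite /= lee_fin normrM ler_piMr//.
  have [/andP[l0 l1] _] := local_moment_almost_one x k.
  by rewrite ger0_norm.
rewrite -lee_fin /Rintegral fineK; last exact: integrable_fin_num Int_halmos_density.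
apply: (cvge_to_ge cvgF); apply: nearW => k.
have : mu.-integrable [set: discrete_space T] (EFin \o F k).
  exact: Int_mul_moment Int_halmos_density.
by move=> /integrable_fin_num h; have := F0 k; rewrite -lee_fin /Rintegral fineK//; exact: h.
Qed.

End families.

End composition_positivity.

(** * Bounded operators and subnormality *)

Section bounded_everywhere.
Context {R : realType} {H : hilbertType R} (A : operator H).

Lemma everywhere_bounded_map : everywhere_defined A -> bounded_operator A ->
  exists (S : H -> H) (B : R),
    [/\ forall f, graph A (f, S f), forall p, graph A p -> p.2 = S p.1,
        forall c x y, S (c *: x + y) = c *: S x + S y, 0 < B &
        forall x, sqn hsip (S x) <= B * sqn hsip x].
Proof.
move=> Aall [M MP].
have /choice[S SP] : forall f, exists g, graph A (f, g).
  by move=> f; have : (graph A).`1 f by rewrite Aall.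
have uniq p : graph A p -> p.2 = S p.1.
  move=> Ap; apply/eqP; rewrite -subr_eq0; apply/eqP.
  apply: (graph_functional (o := A)).
  have := graphB Ap (SP p.1).
  by rewrite [p - _]surjective_pairing /= subrr.
exists S, (M ^+ 2 + 1); split=> //.
- move=> c x y; apply: esym.
  exact: (uniq (c *: x + y, _) ((graph_submod A).2 c _ _ (SP x) (SP y))).
- by rewrite ltr_wpDl// sqr_ge0.
- move=> x; have := MP _ (SP x) => /= h.
  have : `|S x| ^+ 2 <= (M%:C * `|x|) ^+ 2.
    by rewrite lerXn2r ?nnegrE ?normr_ge0// (le_trans _ h)// normr_ge0.
  rewrite exprMn !norm_inner -[inner x x]/(hsip x x) -[inner _ _]/(hsip (S x) (S x)).
  rewrite !sipxx -rmorphXn -rmorphM/= lecR => /le_trans; apply.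
  by rewrite ler_wpM2r ?sqn_ge0// lerDl.
Qed.

(** The criterion of Halmos and Bram, for extensions that may be unbounded. *)
Theorem subnormal_halmosP (S : H -> H) (B : R) :
  (forall f, graph A (f, S f)) -> (forall p, graph A p -> p.2 = S p.1) ->
  (forall c x y, S (c *: x + y) = c *: S x + S y) -> 0 < B ->
  (forall x, sqn hsip (S x) <= B * sqn hsip x) ->
  subnormal A <-> halmos_positive S.
Proof.
move=> AS SA SZD B0 SB; split=> [[_ [K [V [N [iso Nn VN]]]]]|Spos].
  by apply: (normal_extension_halmos iso Nn) => f; exact: VN (AS f).
split.
  rewrite /densely_defined (_ : _.`1 = setT); first by move=> O O0 _; rewrite setIT.
  by apply/seteqP; split=> // f _; exists (S f).
have [K [V [N [iso Nn VN]]]] := halmos_normal_extension SZD (ltW B0) SB Spos.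
by exists K, V, N; split=> // p Ap; rewrite (SA _ Ap).
Qed.

End bounded_everywhere.

(** * Composition operators in square integrable functions *)

Section composition_halmos.
Context {R : realType} {T : pointedType} (mu : discreteMeasure R T) (phi : T -> T).
Variables (S : L2 mu -> L2 mu) (B : R).
Hypothesis S_phi : forall f x, S f x = f (phi x).
Hypothesis SZD : forall c x y, S (c *: x + y) = c *: S x + S y.
Hypothesis B_gt0 : 0 < B.
Hypothesis S_le : forall f, sqn hsip (S f) <= B * sqn hsip f.

Lemma iter_phi n f x : iter n S f x = f (iter n phi x).
Proof.
by elim: n x => //= n IHn x; rewrite S_phi IHn -iterSr.
Qed.

Lemma sqn_L2 (f : L2 mu) : (sqn hsip f)%:E = (\int[mu]_x (normc (f x) ^+ 2)%:E)%E.
Proof. by rewrite L2_integralE. Qed.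

(** For c ^ 2 = 1 / mu [set x] this is a unit vector, and the squared norms of its
    images under the powers of S are the values at x of the functions h. *)
Definition point_mass (c : R) x (y : T) : R[i]^o := (c * \1_[set x] y)%:C.

Lemma point_mass_integral c x n :
  (\int[mu]_y (normc (point_mass c x (iter n phi y)) ^+ 2)%:E =
   (c ^+ 2)%:E * mu (iter n phi @^-1` [set x]))%E.
Proof.
have <- : (\int[mu]_y (\1_(iter n phi @^-1` [set x]) y)%:E =
    mu (iter n phi @^-1` [set x]))%E by rewrite integral_indic// setIT.
rewrite -ge0_integralZl//; last by rewrite lee_fin sqr_ge0.
apply: eq_integral => y _; rewrite -EFinM; congr (_%:E).
rewrite sqr_normcE /= expr0n addr0 exprMn; congr (_ * _).
rewrite [RHS](_ : _ = \1_[set x] (iter n phi y)) ?indicE//.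
by case: (_ \in _); rewrite ?expr1n ?expr0n.
Qed.

Lemma point_mass_square_integrable c x : square_integrable mu (point_mass c x).
Proof.
rewrite /square_integrable (point_mass_integral c x 0).
rewrite lte_mul_pinfty// ?lee_fin ?sqr_ge0//; exact: dmeasure_lty.
Qed.

Definition point_L2 c x : L2 mu := toL2 (point_mass_square_integrable c x).

Lemma sqn_iter_point c x n : (sqn hsip (iter n S (point_L2 c x)))%:E =
  ((c ^+ 2)%:E * mu (iter n phi @^-1` [set x]))%E.
Proof.
rewrite sqn_L2 -point_mass_integral; apply: eq_integral => y _.
by rewrite iter_phi.
Qed.

Lemma fibre_growth n x :
  (mu (iter n phi @^-1` [set x]) <= (B ^+ n)%:E * mu [set x])%E.
Proof.
have := sqn_iter_point 1 x n; have := sqn_iter_point 1 x 0.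
rewrite expr1n !mul1e => /= h0 <-; rewrite -[X in (_ <= _ * X)%E]h0 -EFinM lee_fin.
exact: iter_sqn_le (ltW B_gt0) S_le n _.
Qed.

Lemma h_weight n x : h_ mu phi n x = (weight mu phi n x)%:E.
Proof.
rewrite /h_ (fibre_massE fibre_growth) massE inver.
by rewrite gt_eqF ?mass_gt0// -EFinM.
Qed.

Lemma halmos_stieltjes : halmos_positive S ->
  forall x, stieltjes_moment_sequence (fun n => h_ mu phi n x).
Proof.
move=> Spos x; have m0 := mass_gt0 mu x.
pose c := Num.sqrt (fine (mu [set x]))^-1.
have [nu nuP] := halmos_moment_measure SZD B_gt0 S_le Spos (point_L2 c x).
exists nu => n; rewrite nuP; split; first by rewrite ltry.
rewrite h_weight sqn_iter_point sqr_sqrtr ?invr_ge0 ?ltW//.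
by rewrite (fibre_massE fibre_growth) -EFinM mulrC.
Qed.

Hypothesis Tcount : countable [set: T].

(** Real and imaginary parts decouple because the Gram matrix of the indicator
    functions of points is real. *)
Lemma local_pos_halmos (M : R) : B <= M ->
  (forall x p, (forall t, 0 <= t <= M -> 0 <= p.[t]) ->
     0 <= local_moment mu phi x p) ->
  halmos_positive S.
Proof.
move=> BM pos d f.
have M0 : 0 < M by exact: lt_le_trans BM.
have growth n x : (mu (iter n phi @^-1` [set x]) <= (M ^+ n)%:E * mu [set x])%E.
  apply: le_trans (fibre_growth n x) _; rewrite lee_wpmul2r//.
  by rewrite lee_fin lerXn2r ?nnegrE ?(ltW B_gt0) ?(ltW M0).
have sqr_int (part : R[i] -> R) : (forall z, part z ^+ 2 <= normc z ^+ 2) ->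
    forall m, mu.-integrable [set: discrete_space T]
      (EFin \o (fun x => part (f m x) ^+ 2)).
  move=> partP m; apply: (@IntP _ _ _ _ (fun x => normc (f m x) ^+ 2)).
    by move=> x; rewrite !ger0_norm ?sqr_ge0//; exact: partP.
  apply/integrableP; split=> //; have := L2P (f m).
  rewrite /square_integrable; congr (_ < _)%E; apply: eq_integral => x _.
  by rewrite /= ger0_norm// sqr_ge0.
have re_int : forall m, mu.-integrable [set: discrete_space T]
    (EFin \o (fun x => Re (f m x) ^+ 2)).
  by apply: sqr_int => z; rewrite sqr_normcE lerDl sqr_ge0.
have im_int : forall m, mu.-integrable [set: discrete_space T]
    (EFin \o (fun x => Im (f m x) ^+ 2)).
  by apply: sqr_int => z; rewrite sqr_normcE lerDr sqr_ge0.
have h1 := halmos_density_ge0 Tcount M0 growth pos d re_int.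
have h2 := halmos_density_ge0 Tcount M0 growth pos d im_int.
have := addr_ge0 h1 h2.
rewrite (integral_halmos_density Tcount M0 growth d re_int).
rewrite (integral_halmos_density Tcount M0 growth d im_int).
rewrite -big_split; congr (0 <= _); rewrite Re_sum; apply: eq_bigr => m _.
rewrite -big_split Re_sum; apply: eq_bigr => n _.
rewrite -[LHS]/(_ + _) -RintegralD//; last 2 first.
- exact: (Int_iter_prod Tcount M0 growth re_int).
- exact: (Int_iter_prod Tcount M0 growth im_int).
apply: eq_Rintegral => x _.
by rewrite ReM Re_conjc Im_conjc mulrN opprK !iter_phi.
Qed.

End composition_halmos.

(** * The self-map with one cycle *)

Section tail_points.
Context {eta : option nat} {kappa : nat}.
Local Notation X := (X eta kappa).
Local Notation phi := (@phi eta kappa).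

Lemma X_countable : countable [set: X].
Proof.
apply/countable_injP.
exists (fun x : X => match x with
  | stem r => pickle (inl (val r) : nat + nat * nat)%type
  | branch i j => pickle (inr (sval i, j) : nat + nat * nat)%type
  end).
move=> [r|i j] [r'|i' j'] _ _ /(pcan_inj (@pickleK _))// [].
  by move=> /val_inj ->.
case: i i' => [i ip] [i' ip'] /= ii ->; move: ii ip ip' => <- ip ip'.
by rewrite (Prop_irrelevance ip ip').
Qed.

Lemma phi_branch z i j : phi z = branch i j <-> z = branch i j.+1.
Proof.
by split=> [|->//]; case: z => [r|i' [|j']] //= [-> ->].
Qed.

Lemma phi_stem z (r : 'I_kappa.+1) : (r < kappa)%N ->
  phi z = stem r <-> z = stem (inord r.+1).
Proof.
move=> rk; split=> [|->].
  case: z => [s|i' [|j']] //=; last by move=> [/(congr1 val)/= rE]; move: rk; rewrite -rE ltnn.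
  move=> [/(congr1 val)]; case: ifPn => [_ /= rE|s0].
    by move: rk; rewrite -rE ltnn.
  rewrite /= inordK; last by rewrite (leq_ltn_trans (leq_pred _))// ltn_ord.
  by move=> rE; congr stem; apply: val_inj; rewrite /= -rE prednK ?lt0n// inord_val.
rewrite /= inordK ?ltnS//=; congr stem; by apply: val_inj; rewrite /= inordK// ltnW.
Qed.

(** Every point is the only point that some iterate of phi sends to x_0 or to the
    first point of a branch. *)
Lemma iter_phi_branch n z i : iter n phi z = branch i 0%N <-> z = branch i n.
Proof.
elim: n z => [//|n IHn] z; rewrite iterSr; split=> [/IHn/phi_branch//|->].
by apply/IHn.
Qed.

Lemma iter_phi_stem n z : (n <= kappa)%N ->
  iter n phi z = stem ord0 <-> z = stem (inord n).
Proof.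
elim: n z => [|n IHn] z nk.
  by rewrite /= (_ : inord 0 = ord0 :> 'I_kappa.+1)//; apply: val_inj; exact: inordK.
have nk' : (n <= kappa)%N := ltnW nk.
have nE : (inord n : 'I_kappa.+1) = n :> nat by rewrite inordK// ltnS.
rewrite iterSr; split=> [/(IHn _ nk')|->].
  by move=> /phi_stem; rewrite nE; exact.
apply/(IHn _ nk')/phi_stem; rewrite nE//.
Qed.

Lemma initial_point (x : X) : exists x' n,
  ([set stem ord0] `|` range (fun i => branch i 0%N)) x' /\
  forall z, iter n phi z = x' <-> z = x.
Proof.
case: x => [r|i j].
  exists (stem ord0), (val r); split; first by left.
  have rk : (r <= kappa)%N by rewrite -ltnS.
  by move=> z; have := iter_phi_stem z rk; rewrite inord_val.
by exists (branch i 0%N), j; split=> [|z]; [by right; exists i|exact: iter_phi_branch].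
Qed.

End tail_points.

(** * From the initial points to all points *)

Section initial_points.
Context {R : realType} {eta : option nat} {kappa : nat}
  (mu : discreteMeasure R (X eta kappa)).
Variables (S : L2 mu -> L2 mu) (B : R).
Hypothesis S_phi : forall f x, S f x = f (phi x).
Hypothesis B_gt0 : 0 < B.
Hypothesis S_le : forall f, sqn hsip (S f) <= B * sqn hsip f.

(** The sequence of fibre masses of any point is a shift of the one of an initial
    point; a shift by r multiplies the represented measure by t ^ r. *)
Lemma local_pos_of_initial :
  (forall x : X eta kappa,
    ([set stem ord0] `|` range (fun i : J eta => branch i 0%N)) x ->
    stieltjes_moment_sequence (fun n : nat => h_ mu phi n x)) ->
  forall x p, (forall t, 0 <= t <= B + 1 -> 0 <= p.[t]) ->
    0 <= local_moment mu phi x p.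
Proof.
move=> init x p p0.
have growth := fibre_growth S_phi B_gt0 S_le.
have [x' [r [/init[nu nuP] x'E]]] := initial_point x.
have fibreE n : fibre_mass mu phi n x = fibre_mass mu phi (n + r) x'.
  congr (fine (mu _)); apply/seteqP; split=> z /=; rewrite addnC iterD.
    by move=> /x'E.
  by move=> /x'E.
have B1 : B < B + 1 by rewrite ltrDl.
have w0 : 0 <= moment (fun n => weight mu phi n x') (p * 'X^r).
  apply: (@moment_ge0_of_measure _ nu _ 1 B (B + 1)) => //; first exact: ltW.
  - by move=> n; rewrite -(nuP n).2 (h_weight S_phi B_gt0 S_le).
  - by move=> n; rewrite mul1r; exact: weight_le.
  - move=> t tB; rewrite hornerM hornerXn mulr_ge0 ?p0// exprn_ge0//.
    by case/andP: tB.
have -> : local_moment mu phi x p =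
    fine (mu [set x']) / fine (mu [set x]) *
    moment (fun n => weight mu phi n x') (p * 'X^r).
  rewrite momentMXn -moment_scale; congr moment; apply/funext => n.
  by rewrite {1}/weight fibreE -weight_mass; ring.
by rewrite mulr_ge0// divr_ge0 ?fine_ge0.
Qed.

End initial_points.

Theorem proposition4p3p6 (R : realType) (eta : option nat) (kappa : nat)
    (mu : discreteMeasure R (X eta kappa)) :
  eta <> Some 0%N ->
  everywhere_defined (composition_operator mu phi) ->
  bounded_operator (composition_operator mu phi) ->
  subnormal (composition_operator mu phi) <->
  forall x : X eta kappa,
    ([set stem ord0] `|` range (fun i : J eta => branch i 0%N)) x ->
    stieltjes_moment_sequence (fun n : nat => h_ mu phi n x).
Proof.
move=> _ Aall Abd.
have [S [B [AS SA SZD B0 SB]]] := everywhere_bounded_map Aall Abd.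
have S_phi f x : S f x = f (phi x) by exact: AS f x.
apply: (iff_trans (subnormal_halmosP AS SA SZD B0 SB)).
split=> [Spos x _|init]; first exact: halmos_stieltjes S_phi SZD B0 SB Spos x.
apply: (local_pos_halmos S_phi B0 SB X_countable (M := B + 1)).
  by rewrite lerDl.
exact: local_pos_of_initial S_phi B0 SB init.
Qed.
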